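(* Let $M$ be a Frobenius manifold with invariant metric $\langle\ ,\ \rangle$, Euler vector field $E$ and charge $d$. Let $(\ ,\ )$ be the bilinear form on $T^*M$ defined by $(\omega_1,\omega_2)=i_E(\omega_1\cdot\omega_2)$ (the intersection form), and regard $\langle\ ,\ \rangle$ as a bilinear form on $T^*M$. Then the metrics $(\ ,\ )_1:=(\ ,\ )$ and $(\ ,\ )_2:=\langle\ ,\ \rangle$ form a flat pencil on $M$ which is quasihomogeneous of degree $d$.
   Context: Summation over repeated indices is assumed; $\mathcal L$ denotes Lie derivative. **Frobenius manifolds.** A Frobenius algebra is a commutative associative algebra with unity together with a symmetric nondegenerate bilinear form $\langle\ ,\ \rangle$ satisfying $\langle ab,c\rangle=\langle a,bc\rangle$. A (smooth or analytic) Frobenius structure of charge $d$ on a manifold $M$ is a structure of Frobenius algebra on each tangent space $T_tM$, depending (smoothly, analytically) on $t$, such that: (FM1) the metric $\langle\ ,\ \rangle$ (not necessarily positive definite) is flat; with $\nabla$ its Levi-Civita connection, the unity vector field $e$ satisfies $\nabla e=0$; (FM2) with $c(u,v,w):=\langle u\cdot v,w\rangle$, the four-linear form $(\nabla_z c)(u,v,w)$ is symmetric in $u,v,w,z$; (FM3) a vector field $E$ (the Euler vector field) is fixed with $\nabla\nabla E=0$, such that the operators $Q_{Func}=E$ on functions and $Q_{Vect}=\mathrm{id}+\mathrm{ad}_E$ on vector fields make the vector fields a graded Frobenius algebra of charge $d$ over the graded ring of functions, i.e. $Q_{Vect}(ab)=Q_{Vect}(a)b+aQ_{Vect}(b)$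 and $E\langle a,b\rangle+d\langle a,b\rangle=\langle Q_{Vect}(a),b\rangle+\langle a,Q_{Vect}(b)\rangle$ for all vector fields $a,b$. In flat coordinates $t^\alpha$ of $\langle\ ,\ \rangle$ with $\eta_{\alpha\beta}=\langle\partial_\alpha,\partial_\beta\rangle$ and $\partial_\alpha\cdot\partial_\beta=c_{\alpha\beta}^\gamma\partial_\gamma$, condition (FM3) on $Q_{Func}, Q_{Vect}$ reads $\mathcal L_Ec_{\alpha\beta}^\gamma=c_{\alpha\beta}^\gamma$, $\mathcal L_E\eta_{\alpha\beta}=(2-d)\eta_{\alpha\beta}$. The product $\omega_1\cdot\omega_2$ of 1-forms is the product on $T^*M$ obtained from the product on $TM$ by identifying $TM\cong T^*M$ via $\langle\ ,\ \rangle$; as a form on $T^*M$, $\langle\ ,\ \rangle$ has matrix $(\eta^{\alpha\beta})=(\eta_{\alpha\beta})^{-1}$. $i_E$ is contraction with $E$. **Flat pencils.** A contravariant metric on $M$ is a symmetric bilinear form on $T^*M$ that is invertible on an open dense subset. In local coordinates $x^1,\dots,x^n$ write $g^{ij}=(dx^i,dx^j)$. Its contravariant Levi-Civita connection is a collection of functions $\Gamma_k^{ij}(x)$, defined in every coordinate patch on all of $M$, such that where $(g^{ij})$ is invertible $\Gamma_k^{ij}=-g^{is}\Gamma_{sk}^j$, with $\Gamma_{sk}^j$ the Levi-Civita connection of the inverse metric $g_{ij}dx^idx^j$. The contravariant metric is flat if, where it is invertible, the inverse metric is flat. Two contravariant metrics $(\ ,\ )_1,(\ ,\ )_2$ form a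 flat pencil if: (1) $(\ ,\ )_1-\lambda(\ ,\ )_2$ is a contravariant metric on $M$ for every $\lambda$; (2) if ${\Gamma_1}_k^{ij}$, ${\Gamma_2}_k^{ij}$ are their contravariant Levi-Civita connections, then ${\Gamma_1}_k^{ij}-\lambda{\Gamma_2}_k^{ij}$ is the contravariant Levi-Civita connection of $(\ ,\ )_1-\lambda(\ ,\ )_2$ for every $\lambda$; (3) $(\ ,\ )_1-\lambda(\ ,\ )_2$ is flat for every $\lambda$. The flat pencil is quasihomogeneous of degree $d$ if there is a function $\tau$ on $M$ such that the vector fields $E^i:=g_1^{is}\partial_s\tau$, $e^i:=g_2^{is}\partial_s\tau$ satisfy $[e,E]=e$, $\mathcal L_E(\ ,\ )_1=(d-1)(\ ,\ )_1$, $\mathcal L_e(\ ,\ )_1=(\ ,\ )_2$, $\mathcal L_e(\ ,\ )_2=0$.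
   Formalization: The function τ is proved to be single-valued on M when d ≠ 1 or when every closed 1-form on M is exact; in general τ may be multivalued (dτ is a global 1-form), since for d = 1 on R × S¹ a single-valued τ can fail to exist. *)

(* Defs.v *)
From HB Require Import structures.
From mathcomp Require Import all_boot all_order all_algebra.
From mathcomp Require Import all_classical all_reals all_analysis.
From mathcomp.real_closed Require Import complex.

Set Implicit Arguments.
Unset Strict Implicit.
Unset Printing Implicit Defensive.

Import Order.TTheory GRing.Theory Num.Theory.
Import numFieldNormedType.Exports.

Local Open Scope classical_set_scope.
Local Open Scope ring_scope.
Local Open Scope complex_scope.

(* Over the reals the manifolds below are the C^oo ones; over the complex
   numbers, where derivatives are complex derivatives, they are the complex
   analytic ones. *)
Variant real_or_complex : numFieldType -> Prop :=
  | RealScalars (R : realType) : real_or_complex R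
  | ComplexScalars (R : realType) : real_or_complex R[i].

Section Charts.
Context {K : numFieldType} {n : nat} {T : topologicalType}.

Record chart := Chart {
  chart_dom : set T;
  chart_coord : T -> 'rV[K]_n;
  chart_param : 'rV[K]_n -> T;
  dom_open : open chart_dom;
  image_open : open (chart_coord @` chart_dom);
  coord_continuous : {within chart_dom, continuous chart_coord};
  param_continuous : {within chart_coord @` chart_dom, continuous chart_param};
  coordK : forall p, chart_dom p -> chart_param (chart_coord p) = p
}.

(* partial derivative with respect to the i-th coordinate of the chart x,
   as a function on T; it is meaningful on [chart_dom x] *)
Definition pd (x : chart) (i : 'I_n) (f : T -> K) (p : T) : K :=
  'D_(delta_mx 0 i) (f \o chart_param x : 'rV[K]_n -> K) (chart_coord x p).

Fixpoint Ck (x : chart) (U : set T) (k : nat) (f : T -> K) : Prop :=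
  (forall p, U p -> {for p, continuous f}) /\
  (if k is k'.+1 then
     (forall p i, U p ->
        derivable (f \o chart_param x : 'rV[K]_n -> K) (chart_coord x p) (delta_mx 0 i)) /\
     (forall i, Ck x U k' (pd x i f))
   else True).

(* used with U open and contained in [chart_dom x] *)
Definition smooth_in (x : chart) (U : set T) (f : T -> K) : Prop :=
  forall k, Ck x U k f.

(* (jac x y p) i j = dx^i / dy^j *)
Definition jac (x y : chart) (p : T) : 'M[K]_n :=
  \matrix_(i, j) pd y j (fun q => chart_coord x q 0 i) p.

End Charts.
Arguments chart K n T : clear implicits.

Record manifold (K : numFieldType) (n : nat) := Manifold {
  space :> topologicalType;
  atlas : set (chart K n space);
  space_hausdorff : hausdorff_space space;
  space_second_countable : @second_countable space;
  atlas_cover : forall p, exists2 x, atlas x & chart_dom x p;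
  atlas_smooth : forall x y i, atlas x -> atlas y ->
    smooth_in y (chart_dom x `&` chart_dom y) (fun q => chart_coord x q 0 i)
}.
Arguments atlas {K n} m _.

(* Tensor calculus in a fixed chart. Tangent vectors and 1-forms are columns of
   components; all fields are functions on T, meaningful on [chart_dom x]. *)
Section LocalCalculus.
Context {K : numFieldType} {n : nat} {T : topologicalType}.
Variable x : chart K n T.
Implicit Types (X Y : T -> 'cV[K]_n) (f : T -> K) (g h : T -> 'M[K]_n).

Definition grad_form f (p : T) : 'cV[K]_n := \col_i pd x i f p.

Definition act_on_function X f (p : T) : K := \sum_s X p s 0 * pd x s f p.

Definition lie_bracket X Y (p : T) : 'cV[K]_n :=
  \col_k \sum_s (X p s 0 * pd x s (fun q => Y q k 0) p
                 - Y p s 0 * pd x s (fun q => X q k 0) p).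

(* Lie derivative of a bilinear form on the cotangent bundle *)
Definition lie_contra X h (p : T) : 'M[K]_n :=
  \matrix_(i, j) \sum_s (X p s 0 * pd x s (fun q => h q i j) p
                         - h p s j * pd x s (fun q => X q i 0) p
                         - h p i s * pd x s (fun q => X q j 0) p).

(* Christoffel symbol Gamma_{ij}^k of the (covariant) metric g *)
Definition christoffel g (k i j : 'I_n) (p : T) : K :=
  2%:R^-1 * \sum_l invmx (g p) k l *
    (pd x i (fun q => g q l j) p + pd x j (fun q => g q i l) p
     - pd x l (fun q => g q i j) p).

(* d_i Gamma_{jl}^k - d_j Gamma_{il}^k
   + Gamma_{im}^k Gamma_{jl}^m - Gamma_{jm}^k Gamma_{il}^m *)
Definition riemann g (k l i j : 'I_n) (p : T) : K :=
  pd x i (christoffel g k j l) p - pd x j (christoffel g k i l) p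
  + \sum_m (christoffel g k i m p * christoffel g m j l p
            - christoffel g k j m p * christoffel g m i l p).

(* (nabla_i X)^k *)
Definition nabla_vec g X (i k : 'I_n) (p : T) : K :=
  pd x i (fun q => X q k 0) p + \sum_m christoffel g k i m p * X p m 0.

(* (nabla_i nabla X)_j^k *)
Definition nabla2_vec g X (i j k : 'I_n) (p : T) : K :=
  pd x i (nabla_vec g X j k) p
  - \sum_m christoffel g m i j p * nabla_vec g X m k p
  + \sum_m christoffel g k i m p * nabla_vec g X j m p.

(* (nabla_l t)_{ijk} for a covariant 3-tensor t *)
Definition nabla_form3 g (t : 'I_n -> 'I_n -> 'I_n -> T -> K)
    (l i j k : 'I_n) (p : T) : K :=
  pd x l (t i j k) p
  - \sum_m christoffel g m l i p * t m j k p
  - \sum_m christoffel g m l j p * t i m k p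
  - \sum_m christoffel g m l k p * t i j m p.

End LocalCalculus.

Section FrobeniusAlgebra.
Context {K : numFieldType} {n : nat}.
Implicit Types (u v w : 'cV[K]_n).

Definition form_val (eta : 'M[K]_n) u v : K := (u^T *m eta *m v) 0 0.

(* (c k) i j is the structure constant c_{ij}^k *)
Definition alg_mul (c : 'I_n -> 'M[K]_n) u v : 'cV[K]_n :=
  \col_k form_val (c k) u v.

Record frobenius_algebra (c : 'I_n -> 'M[K]_n) (eta : 'M[K]_n) (e : 'cV[K]_n) :
    Prop := FrobeniusAlgebra {
  falg_comm : forall u v, alg_mul c u v = alg_mul c v u;
  falg_assoc : forall u v w,
    alg_mul c (alg_mul c u v) w = alg_mul c u (alg_mul c v w);
  falg_unit : forall u, alg_mul c e u = u;
  falg_sym : forall u v, form_val eta u v = form_val eta v u;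
  falg_nondeg : forall u, (forall v, form_val eta u v = 0) -> u = 0;
  falg_inv : forall u v w,
    form_val eta (alg_mul c u v) w = form_val eta u (alg_mul c v w)
}.

End FrobeniusAlgebra.

(* A tensor field on M is the family of its components in the charts of the
   atlas, smooth in every chart and related by the tensor transformation law. *)
Section TensorFields.
Context {K : numFieldType} {n : nat} (M : manifold K n).
Local Notation chartM := (chart K n M).

Definition smooth_on (U : set M) (f : M -> K) : Prop :=
  forall x, atlas M x -> smooth_in x (U `&` chart_dom x) f.

Definition is_vector_field (X : chartM -> M -> 'cV[K]_n) : Prop :=
  (forall x i, atlas M x -> smooth_in x (chart_dom x) (fun q => X x q i 0)) /\
  (forall x y p, atlas M x -> atlas M y -> chart_dom x p -> chart_dom y p ->
     X x p = jac x y p *m X y p).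

Definition is_1form (theta : chartM -> M -> 'cV[K]_n) : Prop :=
  (forall x i, atlas M x -> smooth_in x (chart_dom x) (fun q => theta x q i 0)) /\
  (forall x y p, atlas M x -> atlas M y -> chart_dom x p -> chart_dom y p ->
     theta x p = (jac y x p)^T *m theta y p).

Definition is_covariant_2tensor (eta : chartM -> M -> 'M[K]_n) : Prop :=
  (forall x i j, atlas M x -> smooth_in x (chart_dom x) (fun q => eta x q i j)) /\
  (forall x y p, atlas M x -> atlas M y -> chart_dom x p -> chart_dom y p ->
     eta x p = (jac y x p)^T *m eta y p *m jac y x p).

Definition is_contravariant_2tensor (g : chartM -> M -> 'M[K]_n) : Prop :=
  (forall x i j, atlas M x -> smooth_in x (chart_dom x) (fun q => g x q i j)) /\
  (forall x y p, atlas M x -> atlas M y -> chart_dom x p -> chart_dom y p ->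
     g x p = jac x y p *m g y p *m (jac x y p)^T).

Definition is_product (c : chartM -> M -> 'I_n -> 'M[K]_n) : Prop :=
  (forall x i j k, atlas M x -> smooth_in x (chart_dom x) (fun q => c x q k i j)) /\
  (forall x y p u v, atlas M x -> atlas M y -> chart_dom x p -> chart_dom y p ->
     alg_mul (c x p) (jac x y p *m u) (jac x y p *m v) =
     jac x y p *m alg_mul (c y p) u v).

(* theta = d tau on U *)
Definition potential_on (U : set M) (theta : chartM -> M -> 'cV[K]_n)
    (tau : M -> K) : Prop :=
  smooth_on U tau /\
  (forall x p, atlas M x -> chart_dom x p -> U p -> theta x p = grad_form x tau p).

Definition closed_1form (theta : chartM -> M -> 'cV[K]_n) : Prop :=
  is_1form theta /\
  (forall x p i j, atlas M x -> chart_dom x p ->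
     pd x i (fun q => theta x q j 0) p = pd x j (fun q => theta x q i 0) p).

(* The differential of a possibly multivalued function on M: single-valued
   branches exist near every point. *)
Definition locally_exact_1form (theta : chartM -> M -> 'cV[K]_n) : Prop :=
  is_1form theta /\
  (forall p, exists (U : set M) (tau : M -> K),
     [/\ open U, U p & potential_on U theta tau]).

(* H^1_dR(M) = 0 over the reals; implied by H^1(M, C) = 0, in particular by
   simple connectedness, over the complex numbers. *)
Definition closed_1forms_exact : Prop :=
  forall theta, closed_1form theta -> exists tau, potential_on setT theta tau.

End TensorFields.

Section Frobenius.
Context {K : numFieldType} {n : nat} (M : manifold K n).
Local Notation chartM := (chart K n M).

Definition Qvect (x : chartM) (E a : M -> 'cV[K]_n) (p : M) : 'cV[K]_n :=
  a p + lie_bracket x E a p.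

(* the components c(d_i, d_j, d_k) = <d_i . d_j, d_k> *)
Definition lowered_product (c : M -> 'I_n -> 'M[K]_n) (eta : M -> 'M[K]_n)
    (i j k : 'I_n) (p : M) : K :=
  \sum_l c p l i j * eta p l k.

Record frobenius_manifold (d : K) := FrobeniusManifold {
  fm_prod : chartM -> M -> 'I_n -> 'M[K]_n;
  fm_metric : chartM -> M -> 'M[K]_n;
  fm_unit : chartM -> M -> 'cV[K]_n;
  fm_euler : chartM -> M -> 'cV[K]_n;
  prod_tensor : is_product fm_prod;
  metric_tensor : is_covariant_2tensor fm_metric;
  unit_tensor : is_vector_field fm_unit;
  euler_tensor : is_vector_field fm_euler;
  tangent_algebra : forall x p, atlas M x -> chart_dom x p ->
    frobenius_algebra (fm_prod x p) (fm_metric x p) (fm_unit x p);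
  metric_flat : forall x p k l i j, atlas M x -> chart_dom x p ->
    riemann x (fm_metric x) k l i j p = 0;
  unit_parallel : forall x p i k, atlas M x -> chart_dom x p ->
    nabla_vec x (fm_metric x) (fm_unit x) i k p = 0;
  (* adjacent transpositions of the four arguments generate all permutations *)
  nabla_c_symmetric : forall x p l i j k, atlas M x -> chart_dom x p ->
    let nc := fun l i j k =>
      nabla_form3 x (fm_metric x) (lowered_product (fm_prod x) (fm_metric x)) l i j k p in
    [/\ nc l i j k = nc i l j k, nc l i j k = nc l j i k
      & nc l i j k = nc l i k j];
  nabla2_euler : forall x p i j k, atlas M x -> chart_dom x p ->
    nabla2_vec x (fm_metric x) (fm_euler x) i j k p = 0;
  (* a and b range over the vector fields on the domain of x *)
  graded_product : forall x (a b : M -> 'cV[K]_n) p, atlas M x -> chart_dom x p ->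
    (forall i, smooth_in x (chart_dom x) (fun q => a q i 0)) ->
    (forall i, smooth_in x (chart_dom x) (fun q => b q i 0)) ->
    Qvect x (fm_euler x) (fun q => alg_mul (fm_prod x q) (a q) (b q)) p =
    alg_mul (fm_prod x p) (Qvect x (fm_euler x) a p) (b p)
    + alg_mul (fm_prod x p) (a p) (Qvect x (fm_euler x) b p);
  graded_metric : forall x (a b : M -> 'cV[K]_n) p, atlas M x -> chart_dom x p ->
    (forall i, smooth_in x (chart_dom x) (fun q => a q i 0)) ->
    (forall i, smooth_in x (chart_dom x) (fun q => b q i 0)) ->
    act_on_function x (fm_euler x) (fun q => form_val (fm_metric x q) (a q) (b q)) p
    + d * form_val (fm_metric x p) (a p) (b p) =
    form_val (fm_metric x p) (Qvect x (fm_euler x) a p) (b p)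
    + form_val (fm_metric x p) (a p) (Qvect x (fm_euler x) b p)
}.

(* <,> as a bilinear form on the cotangent bundle *)
Definition cometric (d : K) (F : frobenius_manifold d) (x : chartM) (p : M) :
    'M[K]_n := invmx (fm_metric F x p).

(* the product of 1-forms: invmx fm_metric raises indices, fm_metric lowers them *)
Definition form_mul (d : K) (F : frobenius_manifold d) (x : chartM) (p : M)
    (w1 w2 : 'cV[K]_n) : 'cV[K]_n :=
  fm_metric F x p *m
    alg_mul (fm_prod F x p) (cometric F x p *m w1) (cometric F x p *m w2).

(* the matrix (dx^i, dx^j) = i_E (dx^i . dx^j) *)
Definition intersection_form (d : K) (F : frobenius_manifold d) (x : chartM)
    (p : M) : 'M[K]_n :=
  \matrix_(i, j)
    ((fm_euler F x p)^T *m form_mul F x p (delta_mx i 0) (delta_mx j 0)) 0 0.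

End Frobenius.

Section FlatPencils.
Context {K : numFieldType} {n : nat} (M : manifold K n).
Local Notation chartM := (chart K n M).
Implicit Types (g : chartM -> M -> 'M[K]_n)
  (Gamma : chartM -> 'I_n -> 'I_n -> 'I_n -> M -> K).

Definition contravariant_metric g : Prop :=
  [/\ is_contravariant_2tensor g,
      (forall x p, atlas M x -> chart_dom x p -> (g x p)^T = g x p)
    & exists U : set M, [/\ open U, dense U &
        forall x p, atlas M x -> chart_dom x p -> U p -> g x p \in unitmx]].

(* the covariant metric g_{ij}, meaningful where g is invertible *)
Definition inverse_metric g (x : chartM) (p : M) : 'M[K]_n := invmx (g x p).

(* Gamma x k i j is Gamma_k^{ij} in the chart x; it has to be smooth on the whole
   of the chart, also where g degenerates. *)
Definition contravariant_levi_civita g Gamma : Prop :=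
  (forall x k i j, atlas M x -> smooth_in x (chart_dom x) (Gamma x k i j)) /\
  (forall x p k i j, atlas M x -> chart_dom x p -> g x p \in unitmx ->
     Gamma x k i j p =
     - \sum_s g x p i s * christoffel x (inverse_metric g x) j s k p).

Definition flat_contravariant g : Prop :=
  forall x p k l i j, atlas M x -> chart_dom x p -> g x p \in unitmx ->
    riemann x (inverse_metric g x) k l i j p = 0.

Definition metric_pencil g1 g2 (lam : K) (x : chartM) (p : M) : 'M[K]_n :=
  g1 x p - lam *: g2 x p.

Definition flat_pencil g1 g2 : Prop :=
  [/\ contravariant_metric g1 /\ contravariant_metric g2,
      (forall lam, contravariant_metric (metric_pencil g1 g2 lam)),
      (exists Gamma1 Gamma2,
        [/\ contravariant_levi_civita g1 Gamma1,
            contravariant_levi_civita g2 Gamma2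
          & forall lam, contravariant_levi_civita (metric_pencil g1 g2 lam)
              (fun x k i j p => Gamma1 x k i j p - lam * Gamma2 x k i j p)])
    & forall lam, flat_contravariant (metric_pencil g1 g2 lam)].

(* The quasihomogeneity conditions for E = g1 dtau, e = g2 dtau; they involve
   tau only through its differential theta = dtau. *)
Definition quasihomogeneity g1 g2 (d : K) (theta : chartM -> M -> 'cV[K]_n) :
    Prop :=
  forall x p, atlas M x -> chart_dom x p ->
    let E := fun q => g1 x q *m theta x q in
    let e := fun q => g2 x q *m theta x q in
    [/\ lie_bracket x e E p = e p,
        lie_contra x E (g1 x) p = (d - 1) *: g1 x p,
        lie_contra x e (g1 x) p = g2 x p
      & lie_contra x e (g2 x) p = 0].

Definition quasihomogeneous g1 g2 (d : K) : Prop :=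
  exists tau : M -> K, smooth_on setT tau /\
    quasihomogeneity g1 g2 d (fun x => grad_form x tau).

(* the same with a possibly multivalued function tau *)
Definition quasihomogeneous_multivalued g1 g2 (d : K) : Prop :=
  exists theta, locally_exact_1form theta /\ quasihomogeneity g1 g2 d theta.

End FlatPencils.

(* Main.v *)
Require Import Defs.
From mathcomp Require Import all_boot all_order all_algebra.
From mathcomp Require Import all_classical all_reals all_analysis.
From mathcomp Require Import perm.
From mathcomp Require Import ring lra.
From mathcomp.real_closed Require Import complex.

Set Implicit Arguments.
Unset Strict Implicit.
Unset Printing Implicit Defensive.

Import Order.TTheory GRing.Theory Num.Theory.
Import numFieldNormedType.Exports.
Local Open Scope classical_set_scope.
Local Open Scope ring_scope.

(** The flat coordinates of the invariant metric are replaced by covariant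
    calculus in an arbitrary chart, written with matrices. Let C_i be
    multiplication by d_i, G_i the matrix of Christoffel symbols Gamma_{i m}^k
    of the invariant metric, D_i X = d_i X + [G_i, X] the covariant derivative
    of a field of endomorphisms X, A multiplication by the Euler field E, h the
    invariant metric on 1-forms, and W = nabla E + (d - 1)/2.

    The axioms become commutation rules. Symmetry of nabla c is
    D_i C_j = D_j C_i ([fmult_codazzi]); nabla nabla E = 0 is D_i W = 0
    ([spectral_parallel]); homogeneity of the metric says that W plus its
    adjoint is the identity ([spectral_adjoint]); homogeneity of the product
    gives D_i A = C_i + [W, C_i] ([deuler_mult]). The intersection form is A h
    ([intersection_formE]), so that the pencil is (A - lam) h. Where it is
    invertible, put R = (A - lam)^-1. The connection G_i - W C_i R is symmetric
    because the C_i and R commute, and it preserves the pencil by the rules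
    above, hence it is the Levi-Civita connection of the pencil
    ([inverse_pencil_christoffel]). Its curvature is zero by the same rules and
    flatness of G ([pencil_flat_algebra]). Multiplication by the pencil cancels
    R: the contravariant Christoffel symbols are the entries of
    C_k h W^T - (A - lam) h G_k^T, smooth everywhere and affine in lam.

    The pencil is invertible on a dense set because the derivative along the
    unity e of the characteristic polynomial chi of A is - chi'
    ([unit_deriv_char_poly]): if chi(lam) vanished on an open set, so would all
    chi^(k)(lam) there, although chi is monic.

    For quasihomogeneity the 1-form dtau has to be theta = <e, .>, since h maps
    it to e and A h maps it to A e = E. The required brackets and Lie
    derivatives follow from the rules above. As nabla e = 0, theta is closed,
    so it has local potentials by the Poincare lemma
    ([closed_1form_locally_exact]); if d <> 1 a global one is <e, E> / (1 - d)
    ([unit_form_potential]).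

    The analysis has to cover real smooth and complex analytic functions at
    once. Both rest on paths parametrized by the real axis inside the scalar
    field ([real_axis]): there the fundamental theorem of calculus gives
    primitives, and Cousin induction gives a mean value inequality. From these
    follow the chain rule for functions with continuous partial derivatives,
    hence the tensor laws under changes of charts, and the Poincare lemma. *)

(** * Calculus in a chart *)

Section Calculus.
Context {K : numFieldType} {n : nat} {T : topologicalType} (x : chart K n T).
Implicit Types (U V : set T) (f g : T -> K) (p : T).

Lemma param_continuous_at p : chart_dom x p ->
  {for chart_coord x p, continuous (chart_param x)}.
Proof.
move=> xp; have := @param_continuous K n T x.
rewrite continuous_open_subspace; last exact: image_open.
by apply; apply/mem_set; exists p.
Qed.

Lemma coord_continuous_at p : chart_dom x p ->
  {for p, continuous (chart_coord x)}.
Proof.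
move=> xp; have := @Defs.coord_continuous K n T x.
rewrite continuous_open_subspace; last exact: dom_open.
by apply; apply/mem_set.
Qed.

(** Near the coordinates of a point the chart identifies the coordinate space
    with the manifold; hence partial derivatives only see an arbitrarily small
    open set. *)
Lemma near_chart U p : open U -> U `<=` chart_dom x -> U p ->
  \forall v \near chart_coord x p,
    U (chart_param x v) /\ chart_coord x (chart_param x v) = v.
Proof.
move=> oU Ux Up; have xp := Ux _ Up.
apply: filterI.
  apply: (param_continuous_at xp); rewrite coordK//.
  exact: open_nbhs_nbhs.
have : nbhs (chart_coord x p) (chart_coord x @` chart_dom x).
  by apply: open_nbhs_nbhs; split; [exact: image_open | exists p].
by apply: filterS => _ [q xq <-]; rewrite coordK.
Qed.

Lemma near_eq_param U p f g : open U -> U `<=` chart_dom x -> U p ->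
  {in U, f =1 g} ->
  \forall v \near chart_coord x p, (f \o chart_param x) v = (g \o chart_param x) v.
Proof.
move=> oU Ux Up fg; apply: filterS (near_chart oU Ux Up) => v [Uv _] /=.
by apply: fg; exact/mem_set.
Qed.

Lemma pd_eq U i f g p : open U -> U `<=` chart_dom x -> U p ->
  {in U, f =1 g} -> pd x i f p = pd x i g p.
Proof. by move=> oU Ux Up fg; exact/near_eq_derive/(near_eq_param oU Ux Up). Qed.

(** Differentiability along the coordinate axes is all that the rules for
    sums, products and inverses need; total differentiability enters only to
    change charts and to integrate forms. *)
Definition pderivable f p := forall i,
  derivable (f \o chart_param x : 'rV[K]_n -> K) (chart_coord x p) (delta_mx 0 i).

Lemma CkS U k f : Ck x U k.+1 f ->
  [/\ forall p, U p -> {for p, continuous f},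
      forall p, U p -> pderivable f p & forall i, Ck x U k (pd x i f)].
Proof. by move=> /= [? [d ?]]; split => // p Up i; exact: d. Qed.

Lemma CkSP U k f : (forall p, U p -> {for p, continuous f}) ->
  (forall p, U p -> pderivable f p) -> (forall i, Ck x U k (pd x i f)) ->
  Ck x U k.+1 f.
Proof. by move=> c d p; split=> //; split=> // q i Uq; exact: d. Qed.

Lemma Ck_continuous U k f p : Ck x U k f -> U p -> {for p, continuous f}.
Proof. by case: k => [|k] [+ _]; apply. Qed.

Lemma CkW U k f : Ck x U k.+1 f -> Ck x U k f.
Proof.
elim: k f => [|k ih] f; first by case/CkS.
by case/CkS => c d h; apply: CkSP => // i; exact/ih/h.
Qed.

Lemma near_eq_continuous f g p : (\forall q \near p, f q = g q) ->
  {for p, continuous f} -> {for p, continuous g}.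
Proof.
move=> fg cf; have gp : f p = g p by exact: nbhs_singleton fg.
change (g @ p --> g p); rewrite -gp; apply: cvg_trans cf.
by apply: near_eq_cvg; exact: filterS fg.
Qed.

Lemma Ck_sub U V k f : U `<=` V -> Ck x V k f -> Ck x U k f.
Proof.
move=> UV; elim: k f => [|k ih] f; first by case=> c _; split=> // p /UV; exact: c.
by case/CkS => c d h; apply: CkSP => [p /UV|p /UV|i]; [exact: c|exact: d|exact/ih/h].
Qed.

Lemma smooth_sub U V f : U `<=` V -> smooth_in x V f -> smooth_in x U f.
Proof. by move=> UV sf k; exact: Ck_sub (sf k). Qed.

Section OnOpen.
Variable U : set T.
Hypotheses (oU : open U) (Ux : U `<=` chart_dom x).

Lemma pderivable_eq V f g p : V `<=` chart_dom x -> open V -> V p -> {in V, f =1 g} ->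
  pderivable f p -> pderivable g p.
Proof.
move=> Vx oV Vp fg df i.
exact: near_eq_derivable (near_eq_param oV Vx Vp fg) (df i).
Qed.

Lemma Ck_eq k f g : {in U, f =1 g} -> Ck x U k f -> Ck x U k g.
Proof.
elim: k f g => [|k ih] f g fg.
  case=> cf _; split=> // p Up; apply: near_eq_continuous (cf _ Up).
  by apply: filterS (open_nbhs_nbhs (conj oU Up)) => q Uq; exact/fg/mem_set.
case/CkS => c d h; apply: CkSP.
- move=> p Up; apply: near_eq_continuous (c _ Up).
  by apply: filterS (open_nbhs_nbhs (conj oU Up)) => q Uq; exact/fg/mem_set.
- by move=> p Up; exact: (pderivable_eq Ux oU Up fg (d _ Up)).
- move=> i; apply: ih (h i) => p /set_mem Up.
  exact: pd_eq oU Ux Up fg.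
Qed.

Lemma smooth_eq f g : {in U, f =1 g} -> smooth_in x U f -> smooth_in x U g.
Proof. by move=> fg sf k; exact: Ck_eq fg (sf k). Qed.

Lemma smooth_continuous f p : smooth_in x U f -> U p -> {for p, continuous f}.
Proof. by move=> /(_ 0%N); exact: Ck_continuous. Qed.

Lemma smooth_pderivable f p : smooth_in x U f -> U p -> pderivable f p.
Proof. by move=> /(_ 1%N)/CkS[_ + _]; apply. Qed.

Lemma smooth_pd i f : smooth_in x U f -> smooth_in x U (pd x i f).
Proof. by move=> sf k; have /CkS[] := sf k.+1. Qed.

Lemma smoothP f : (forall p, U p -> {for p, continuous f}) ->
  (forall p, U p -> pderivable f p) ->
  (forall i, smooth_in x U (pd x i f)) -> smooth_in x U f.
Proof. by move=> c d h [|k]; [split | apply: CkSP => // i; exact: h]. Qed.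

Lemma pd_cst (a : K) i p : pd x i (fun _ => a) p = 0.
Proof. exact: derive_cst. Qed.

Lemma smooth_cst (a : K) : smooth_in x U (fun _ => a).
Proof.
move=> k; elim: k a => [|k ih] a; first by split=> // p _; exact: cst_continuous.
apply: CkSP => [p _|p _ i|i].
- exact: cst_continuous.
- exact: derivable_cst.
- by rewrite (_ : pd x i _ = fun _ => 0)//; apply/funext => p; exact: pd_cst.
Qed.

Lemma pdD i f g p : pderivable f p -> pderivable g p ->
  pd x i (fun q => f q + g q) p = pd x i f p + pd x i g p.
Proof. by move=> df dg; exact: deriveD. Qed.

Lemma pdN i f p : pderivable f p -> pd x i (fun q => - f q) p = - pd x i f p.
Proof. by move=> df; exact: deriveN. Qed.

Lemma pdM i f g p : chart_dom x p -> pderivable f p -> pderivable g p ->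
  pd x i (fun q => f q * g q) p = f p * pd x i g p + pd x i f p * g p.
Proof.
move=> xp df dg; rewrite /pd.
have := deriveM (df i) (dg i); rewrite /= coordK// => ->.
by rewrite [in RHS](mulrC _ (g p)).
Qed.

Lemma pdV i f p : chart_dom x p -> f p != 0 -> pderivable f p ->
  pd x i (fun q => (f q)^-1) p = - ((f p)^-1 * (f p)^-1 * pd x i f p).
Proof.
move=> xp fp df; have fp' : (f \o chart_param x) (chart_coord x p) != 0.
  by rewrite /= coordK.
have := deriveV fp' (df i); rewrite /= coordK// /pd => ->.
by rewrite scaleNr expr2 invfM.
Qed.

Lemma CkD k f g : Ck x U k f -> Ck x U k g -> Ck x U k (fun q => f q + g q).
Proof.
elim: k f g => [|k ih] f g sf sg.
  by split=> // p Up; apply: cvgD; [exact: Ck_continuous sf _|exact: Ck_continuous sg _].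
have [cf df hf] := CkS sf; have [cg dg hg] := CkS sg.
apply: CkSP => [p Up|p Up i|i].
- by apply: cvgD; [exact: cf|exact: cg].
- by apply: derivableD; [exact: df|exact: dg].
- apply: Ck_eq (ih _ _ (hf i) (hg i)) => p /set_mem Up.
  by rewrite pdD//; [exact: df|exact: dg].
Qed.

Lemma CkM k f g : Ck x U k f -> Ck x U k g -> Ck x U k (fun q => f q * g q).
Proof.
elim: k f g => [|k ih] f g sf sg.
  by split=> // p Up; apply: cvgM; [exact: Ck_continuous sf _|exact: Ck_continuous sg _].
have [cf df hf] := CkS sf; have [cg dg hg] := CkS sg.
apply: CkSP => [p Up|p Up i|i].
- by apply: cvgM; [exact: cf|exact: cg].
- by apply: derivableM; [exact: df|exact: dg].
- apply: Ck_eq (CkD (ih _ _ (CkW sf) (hg i)) (ih _ _ (hf i) (CkW sg))).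
  by move=> p /set_mem Up; rewrite pdM//; [exact: Ux|exact: df|exact: dg].
Qed.

Lemma smoothD f g : smooth_in x U f -> smooth_in x U g ->
  smooth_in x U (fun q => f q + g q).
Proof. by move=> sf sg k; exact: CkD. Qed.

Lemma smoothM f g : smooth_in x U f -> smooth_in x U g ->
  smooth_in x U (fun q => f q * g q).
Proof. by move=> sf sg k; exact: CkM. Qed.

Lemma smoothN f : smooth_in x U f -> smooth_in x U (fun q => - f q).
Proof.
move=> sf; apply: smooth_eq (smoothM (smooth_cst (-1)) sf) => p _.
by rewrite mulN1r.
Qed.

Lemma smooth_sum (I : Type) (r : seq I) (P : pred I) (F : I -> T -> K) :
  (forall i, smooth_in x U (F i)) ->
  smooth_in x U (fun q => \sum_(i <- r | P i) F i q).
Proof.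
move=> sF; elim: r => [|i r ih].
  by apply: smooth_eq (smooth_cst 0) => p _; rewrite big_nil.
case Pi: (P i); last by apply: smooth_eq ih => p _; rewrite big_cons Pi.
by apply: smooth_eq (smoothD (sF i) ih) => p _; rewrite big_cons Pi.
Qed.

Lemma smooth_prod (I : Type) (r : seq I) (P : pred I) (F : I -> T -> K) :
  (forall i, smooth_in x U (F i)) ->
  smooth_in x U (fun q => \prod_(i <- r | P i) F i q).
Proof.
move=> sF; elim: r => [|i r ih].
  by apply: smooth_eq (smooth_cst 1) => p _; rewrite big_nil.
case Pi: (P i); last by apply: smooth_eq ih => p _; rewrite big_cons Pi.
by apply: smooth_eq (smoothM (sF i) ih) => p _; rewrite big_cons Pi.
Qed.

Lemma smoothV f : (forall p, U p -> f p != 0) -> smooth_in x U f ->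
  smooth_in x U (fun q => (f q)^-1).
Proof.
move=> f0 sf; elim=> [|k ih].
  by split=> // p Up; apply: cvgV; [exact: f0|exact: smooth_continuous].
apply: CkSP => [p Up|p Up i|i].
- by apply: cvgV; [exact: f0|exact: smooth_continuous].
- apply: derivableV; last exact: smooth_pderivable.
  by rewrite /= coordK; [exact: f0|exact: Ux].
- have := CkM (CkM (CkM (smooth_cst (-1) k) ih) ih) (smooth_pd i sf k).
  apply: Ck_eq => p /set_mem Up.
  rewrite pdV ?mulN1r ?mulNr//; [exact: Ux|exact: f0|exact: smooth_pderivable].
Qed.

Definition dmx i {a b : nat} (F : T -> 'M[K]_(a, b)) (p : T) : 'M[K]_(a, b) :=
  \matrix_(r, s) pd x i (fun q => F q r s) p.

Definition smoothmx {a b : nat} (F : T -> 'M[K]_(a, b)) :=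
  forall r s, smooth_in x U (fun q => F q r s).

Definition pderivmx {a b : nat} (F : T -> 'M[K]_(a, b)) p :=
  forall r s, pderivable (fun q => F q r s) p.

Lemma dmx_entry i a b (F : T -> 'M[K]_(a, b)) p r s :
  dmx i F p r s = pd x i (fun q => F q r s) p.
Proof. by rewrite mxE. Qed.

Lemma smooth_pderivmx a b (F : T -> 'M[K]_(a, b)) p :
  smoothmx F -> U p -> pderivmx F p.
Proof. by move=> sF Up r s; exact: smooth_pderivable. Qed.

Lemma smoothmx_eq a b (F G : T -> 'M[K]_(a, b)) :
  {in U, F =1 G} -> smoothmx F -> smoothmx G.
Proof. by move=> FG sF r s; apply: smooth_eq (sF r s) => q Uq; rewrite FG. Qed.

Lemma dmx_eq i V a b (F G : T -> 'M[K]_(a, b)) p :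
  open V -> V `<=` chart_dom x -> V p -> {in V, F =1 G} -> dmx i F p = dmx i G p.
Proof.
move=> oV Vx Vp FG; apply/matrixP => r s; rewrite !mxE.
by apply: (pd_eq _ oV Vx Vp) => q Vq; rewrite FG.
Qed.

Lemma smoothmx_cst a b (A : 'M[K]_(a, b)) : smoothmx (fun=> A).
Proof. by move=> r s; exact: smooth_cst. Qed.

Lemma dmx_cst i a b (A : 'M[K]_(a, b)) p : dmx i (fun=> A) p = 0.
Proof. by apply/matrixP => r s; rewrite !mxE pd_cst. Qed.

Lemma smoothmxD a b (F G : T -> 'M[K]_(a, b)) : smoothmx F -> smoothmx G ->
  smoothmx (fun q => F q + G q).
Proof.
move=> sF sG r s; apply: smooth_eq (smoothD (sF r s) (sG r s)) => q _.
by rewrite mxE.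
Qed.

Lemma dmxD i a b (F G : T -> 'M[K]_(a, b)) p : pderivmx F p -> pderivmx G p ->
  dmx i (fun q => F q + G q) p = dmx i F p + dmx i G p.
Proof.
move=> dF dG; apply/matrixP => r s; rewrite !mxE -pdD//.
by congr (pd _ _ _ _); apply/funext => q; rewrite mxE.
Qed.

Lemma smoothmxN a b (F : T -> 'M[K]_(a, b)) : smoothmx F ->
  smoothmx (fun q => - F q).
Proof.
move=> sF r s; apply: smooth_eq (smoothN (sF r s)) => q _; by rewrite mxE.
Qed.

Lemma dmxN i a b (F : T -> 'M[K]_(a, b)) p : pderivmx F p ->
  dmx i (fun q => - F q) p = - dmx i F p.
Proof.
move=> dF; apply/matrixP => r s; rewrite !mxE -pdN//.
by congr (pd _ _ _ _); apply/funext => q; rewrite mxE.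
Qed.

Lemma smoothmxT a b (F : T -> 'M[K]_(a, b)) : smoothmx F ->
  smoothmx (fun q => (F q)^T).
Proof. by move=> sF r s; apply: smooth_eq (sF s r) => q _; rewrite mxE. Qed.

Lemma dmxT i a b (F : T -> 'M[K]_(a, b)) p :
  dmx i (fun q => (F q)^T) p = (dmx i F p)^T.
Proof.
apply/matrixP => r s; rewrite !mxE.
by congr (pd _ _ _ _); apply/funext => q; rewrite mxE.
Qed.

Lemma pderivable_sum (I : Type) (r : seq I) (F : I -> T -> K) p :
  (forall i, pderivable (F i) p) ->
  pderivable (fun q => \sum_(i <- r) F i q) p.
Proof.
move=> dF; elim: r => [|j r ih].
  under eq_fun do rewrite big_nil.
  by move=> i; exact: derivable_cst.
under eq_fun do rewrite big_cons.
by move=> i; apply: derivableD; [exact: dF|exact: ih].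
Qed.

Lemma pd_sum i (I : Type) (r : seq I) (F : I -> T -> K) p :
  (forall i, pderivable (F i) p) ->
  pd x i (fun q => \sum_(j <- r) F j q) p = \sum_(j <- r) pd x i (F j) p.
Proof.
move=> dF; elim: r => [|j r ih].
  by rewrite big_nil; under eq_fun do rewrite big_nil; rewrite pd_cst.
rewrite big_cons -ih -pdD//; last exact: pderivable_sum.
by under eq_fun do rewrite big_cons.
Qed.

Lemma pderivableM f g p : pderivable f p -> pderivable g p ->
  pderivable (fun q => f q * g q) p.
Proof. by move=> df dg i; exact: derivableM. Qed.

Lemma smoothmxM a b c (F : T -> 'M[K]_(a, b)) (G : T -> 'M[K]_(b, c)) :
  smoothmx F -> smoothmx G -> smoothmx (fun q => F q *m G q).
Proof.
move=> sF sG r s.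
apply: smooth_eq (smooth_sum (index_enum 'I_b) xpredT (fun j => smoothM (sF r j) (sG j s))).
by move=> q _; rewrite mxE.
Qed.

Lemma dmxM i a b c (F : T -> 'M[K]_(a, b)) (G : T -> 'M[K]_(b, c)) p :
  chart_dom x p -> pderivmx F p -> pderivmx G p ->
  dmx i (fun q => F q *m G q) p = dmx i F p *m G p + F p *m dmx i G p.
Proof.
move=> xp dF dG; apply/matrixP => r s; rewrite !mxE.
rewrite (_ : (fun q => _) = fun q => \sum_j F q r j * G q j s); last first.
  by apply/funext => q; rewrite mxE.
rewrite pd_sum; last by move=> j; exact: pderivableM.
rewrite -big_split/=; apply: eq_bigr => j _.
by rewrite pdM// !mxE addrC.
Qed.

Lemma smoothmxZ (f : T -> K) a b (F : T -> 'M[K]_(a, b)) :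
  smooth_in x U f -> smoothmx F -> smoothmx (fun q => f q *: F q).
Proof.
move=> sf sF r s; apply: smooth_eq (smoothM sf (sF r s)) => q _; by rewrite mxE.
Qed.

Lemma dmxZ i (f : T -> K) a b (F : T -> 'M[K]_(a, b)) p :
  chart_dom x p -> pderivable f p -> pderivmx F p ->
  dmx i (fun q => f q *: F q) p = pd x i f p *: F p + f p *: dmx i F p.
Proof.
move=> xp df dF; apply/matrixP => r s; rewrite !mxE addrC -pdM//.
by congr (pd _ _ _ _); apply/funext => q; rewrite mxE.
Qed.

Lemma smoothmx_sum (I : Type) (r : seq I) a b (F : I -> T -> 'M[K]_(a, b)) :
  (forall j, smoothmx (F j)) -> smoothmx (fun q => \sum_(j <- r) F j q).
Proof.
move=> sF r' s; apply: smooth_eq (smooth_sum r xpredT (fun j => sF j r' s)).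
by move=> q _; rewrite summxE.
Qed.

Lemma dmx_sum i (I : Type) (r : seq I) a b (F : I -> T -> 'M[K]_(a, b)) p :
  (forall j, pderivmx (F j) p) ->
  dmx i (fun q => \sum_(j <- r) F j q) p = \sum_(j <- r) dmx i (F j) p.
Proof.
move=> dF; apply/matrixP => r' s; rewrite summxE !mxE.
under [RHS]eq_bigr do rewrite mxE.
rewrite -pd_sum => [|j]; last exact: dF.
by congr (pd _ _ _ _); apply/funext => q; rewrite summxE.
Qed.

Lemma smooth_det a (F : T -> 'M[K]_a) : smoothmx F ->
  smooth_in x U (fun q => \det (F q)).
Proof.
move=> sF; apply: smooth_sum => s; apply: smoothM; first exact: smooth_cst.
by apply: smooth_prod.
Qed.

Lemma smoothmxV a (F : T -> 'M[K]_a) : (forall p, U p -> F p \in unitmx) ->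
  smoothmx F -> smoothmx (fun q => invmx (F q)).
Proof.
move=> uF sF.
have sadj : smoothmx (fun q => \adj (F q)).
  move=> r s; apply: (@smooth_eq (fun q => cofactor (F q) s r)).
    by move=> q _; rewrite mxE.
  apply: smoothM; first exact: smooth_cst.
  apply: smooth_det => u v; apply: smooth_eq (sF (lift s u) (lift r v)) => q _.
  by rewrite !mxE.
apply: smoothmx_eq (smoothmxZ (smoothV _ (smooth_det sF)) sadj).
- by move=> q /set_mem Uq; rewrite /invmx uF.
- by move=> p Up; rewrite -unitfE; exact: uF.
Qed.

(** Obtained by differentiating the constant product of [F] with its inverse.
    *)
Lemma dmxV i a (F : T -> 'M[K]_a) p : (forall q, U q -> F q \in unitmx) ->
  smoothmx F -> U p ->
  dmx i (fun q => invmx (F q)) p = - (invmx (F p) *m dmx i F p *m invmx (F p)).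
Proof.
move=> uF sF Up.
have sV := smoothmxV uF sF.
have : dmx i (fun q => invmx (F q) *m F q) p = 0.
  rewrite -(dmx_cst i (1%:M) p); apply: (dmx_eq _ oU Ux Up) => q /set_mem Uq.
  by rewrite mulVmx// uF.
rewrite dmxM; [|exact: Ux|exact: smooth_pderivmx|exact: smooth_pderivmx].
move=> /(congr1 (mulmxr (invmx (F p)))) /=; rewrite mul0mx mulmxDl mulmxK ?uF//.
by move=> /eqP; rewrite addr_eq0 => /eqP ->; rewrite -!mulmxA.
Qed.

End OnOpen.
End Calculus.

(** * The real axis of the scalar field *)

Lemma nbhs_closed_ball {K : numFieldType} {V : pseudoMetricNormedZmodType K}
    (a : V) (P : V -> Prop) :
  (\forall w \near a, P w) <->
  exists2 d : K, 0 < d & forall w, `|w - a| <= d -> P w.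
Proof.
split=> [/nbhs_normP[d /= d0 dP]|[d d0 dP]].
  exists (d / 2) => [|w wa]; first exact: divr_gt0.
  apply: dP; rewrite /= distrC; apply: le_lt_trans wa _.
  by rewrite ltr_pdivrMr// ltr_pMr// ltr1n.
by apply/nbhs_normP; exists d => //= w /= aw; apply: dP; rewrite distrC ltW.
Qed.

(** Increments [h] of a directional derivative are scalars, so this form of
    [nbhs_closed_ball] is the one that meets them. *)
Lemma near0_scalar {K : numFieldType} (P : K -> Prop) :
  (\forall h \near (0 : K), P h) <->
  exists2 d : K, 0 < d & forall h, `|h| <= d -> P h.
Proof.
split=> [/(@nbhs_closed_ball K K^o (0 : K^o) P)|] [d d0 h].
  by exists d => // k kd; apply: h; rewrite subr0.
by apply/(@nbhs_closed_ball K K^o (0 : K^o) P); exists d => // k; rewrite subr0; exact: h.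
Qed.

Section Increments.
Context {K : numFieldType} {V : normedModType K}.
Implicit Types (f : V -> K) (a v : V).

Lemma derive_increment f a v (e : K) : derivable f a v -> 0 < e ->
  exists2 d : K, 0 < d & forall h, `|h| <= d ->
    `|f (a + h *: v) - f a - h * 'D_v f a| <= e * `|h|.
Proof.
move=> /derivable_nbhs/eqaddoP/[apply].
case/nbhs_normP => d /= d0 dP; exists (d / 2) => [|h hd]; first exact: divr_gt0.
have hd' : `|h| < d.
  by apply: le_lt_trans hd _; rewrite ltr_pdivrMr// ltr_pMr// ltr1n.
have := dP h; rewrite /ball_ /= sub0r normrN => /(_ hd'); congr (`|_| <= _).
rewrite /= opprD -![(_ + _ : _ -> _) _]/(_ + _) -![(- _ : _ -> _) _]/(- _) /=.
by rewrite addrA [a + _]addrC.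
Qed.

Lemma is_derive_increment f a v (L : K) :
  (forall e : K, 0 < e -> exists2 d : K, 0 < d & forall h, `|h| <= d ->
    `|f (a + h *: v) - f a - h * L| <= e * `|h|) ->
  is_derive a v f L.
Proof.
move=> H.
have cv : h^-1 *: ((f \o shift a) (h *: v) - f a) @[h --> 0^'] --> L.
  apply/cvgrPdist_le => e e0; have [d d0 dP] := H _ e0.
  apply/nbhs_normP; exists d => //= h /=; rewrite sub0r normrN => hd h0.
  have := dP h (ltW hd); rewrite /= [h *: v + a]addrC.
  set X := f _ - f a => XP; rewrite -[_ *: X]/(h^-1 * X).
  rewrite -(ler_pM2l (x := `|h|)) ?normr_gt0// -normrM mulrBr mulrA mulfV//.
  by rewrite mul1r distrC (mulrC `|h|).
by apply: DeriveDef; [apply/cvg_ex; exists L|exact: cvg_lim cv].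
Qed.

End Increments.

Section RealAxis.
Context {K : numFieldType} {R : realType} (io : {rmorphism R -> K}).
Implicit Types (f g : R -> K) (t s : R).

(** Continuity and differentiability on the segment [0, 1] of a path [f] with
    values in [K], in explicit form: the parameter is real while the values
    may be complex. *)
Definition cont01 f := forall t, 0 <= t <= 1 -> forall e : K, 0 < e ->
  exists2 d : R, 0 < d &
    forall s, 0 <= s <= 1 -> `|s - t| <= d -> `|f s - f t| <= e.

Definition deriv01 f f' := forall t, 0 <= t <= 1 -> forall e : K, 0 < e ->
  exists2 d : R, 0 < d &
    forall s, 0 <= s <= 1 -> `|s - t| <= d ->
      `|f s - f t - io (s - t) * f' t| <= e * io `|s - t|.

End RealAxis.

(** What the scalars have to provide: a copy of the real line that carries all
    nonnegative elements (so that every norm is real), along which continuous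
    paths have primitives. A complex derivative restricts to a derivative
    along this line, but a primitive along it need not be complex
    differentiable; this is why paths have their own derivative [deriv01]. *)
Record real_axis (K : numFieldType) := RealAxis {
  axis : realType;
  axis_inj : {rmorphism axis -> K};
  axis_le : forall r s, (axis_inj r <= axis_inj s) = (r <= s);
  axis_onto : forall e : K, 0 <= e -> exists r, axis_inj r = e;
  axis_primitive : forall f : axis -> K, cont01 f ->
    exists P, deriv01 axis_inj P f
}.

(** The retraction of the line onto [0, 1] extends a path to a continuous
    function on the line. *)
Lemma clampP (R : realType) :
  exists c : R -> R, [/\ forall s, 0 <= c s <= 1,
    forall s, 0 <= s <= 1 -> c s = s &
    forall s r, `|c s - c r| <= `|s - r|].
Proof.
exists (fun s => Num.max 0 (Num.min 1 s)); split=> [s|s /andP[s0 s1]|s r].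
- by rewrite le_max lexx/= ge_max ler01 ge_min lexx.
- by rewrite (min_idPr s1) (max_idPr s0).
- case: (leP 1 s) => s1; case: (leP 1 r) => r1; rewrite ?(max_idPr ler01);
  try (case: (leP 0 s) => s0); try (case: (leP 0 r) => r0);
  rewrite ler_norml; have [h|h] := ger0P (s - r); apply/andP; split; lra.
Qed.

(** The integral from -1 is differentiable at every point of [0, 1], including
    the end points. *)
Lemma real_primitive (R : realType) (f : R -> R) :
  cont01 f -> exists P, deriv01 (idfun : {rmorphism R -> R}) P f.
Proof.
move=> cf; have [c [c01 cid clip]] := clampP R.
pose g := f \o c.
have cg : continuous (g : R -> R).
  move=> t; apply/cvgrPdist_le => e e0.
  have [d d0 fd] := cf _ (c01 t) _ e0.
  apply/nbhs_normP; exists d => //= s /= ts.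
  rewrite distrC; apply: fd => //; apply: le_trans (clip _ _) _.
  by rewrite distrC ltW.
have int : lebesgue_measure.-integrable `[(-1 : R), 2] (EFin \o g).
  apply: continuous_compact_integrable; first exact: segment_compact.
  by apply: continuous_subspaceT.
exists (fun x => \int[lebesgue_measure]_(t in `[(-1 : R), x]) g t)%R => t /andP[t0 t1] e e0.
have [||dF FE] := continuous_FTC1_closed (a := -1) (x := t) _ int _ (cg t); try lra.
have [d d0 dP] := derive_increment dF e0; exists d => // s _ st.
have sE : t + (s - t) *: (1 : R^o) = s.
  by rewrite -[_ *: _]/((s - t) * 1) mulr1 addrC subrK.
have := dP _ st; rewrite sE -derive1E FE /g /= cid//.
by rewrite t0.
Qed.

(** Over the complex numbers the real and the imaginary part of a path are
    integrated separately. *)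
Lemma real_axis_exists (K : numFieldType) :
  real_or_complex K -> inhabited (real_axis K).
Proof.
case=> R; constructor.
  apply: (@RealAxis R R idfun) => // [e _|]; first by exists e.
  exact: real_primitive.
apply: (@RealAxis R[i] R (real_complex R)) => [r s|e e0|f cf].
- exact: lecR.
- by exists (complex.Re e); exact: RRe_real (ger0_real e0).
pose re := @complex.Re R; pose im := @complex.Im R.
have reN z : `|re z|%:C%C <= `|z| by exact: normc_ge_Re.
have imN z : `|im z|%:C%C <= `|z|.
  have := reN (z * 'i%C); rewrite /re ReiNIm normrN => /le_trans; apply.
  by rewrite normrM [`|'i%C|]normc_def/= expr0n expr1n add0r sqrtr1 mulr1.
have reB z w : re (z - w) = re z - re w by case: z; case: w.
have imB z w : im (z - w) = im z - im w by case: z; case: w.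
have cre : cont01 (re \o f).
  move=> t t01 e e0; have [|d d0 dP] := cf t t01 e%:C%C; first by rewrite ltcR.
  exists d => // s s01 st; rewrite -lecR; apply: le_trans (dP s s01 st).
  by rewrite /= -reB.
have cim : cont01 (im \o f).
  move=> t t01 e e0; have [|d d0 dP] := cf t t01 e%:C%C; first by rewrite ltcR.
  exists d => // s s01 st; rewrite -lecR; apply: le_trans (dP s s01 st).
  by rewrite /= -imB.
have [P PP] := real_primitive cre; have [Q QQ] := real_primitive cim.
exists (fun t => (P t +i* Q t)%C) => t t01 e e0.
have [e' eE] : exists r, e = r%:C%C.
  by exists (complex.Re e); rewrite RRe_real// ger0_real// ltW.
move: e0; rewrite eE ltcR => e0; have e20 : 0 < e' / 2 by exact: divr_gt0.
have [d1 d10 h1] := PP _ t01 _ e20; have [d2 d20 h2] := QQ _ t01 _ e20.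
exists (Num.min d1 d2) => [|s s01]; first by rewrite lt_min d10.
rewrite le_min => /andP[sd1 sd2].
have {}h1 := h1 _ s01 sd1; have {}h2 := h2 _ s01 sd2.
rewrite [X in `|X|]complexE; apply: le_trans (ler_normD _ _) _.
rewrite normrM [`|'i%C|]normc_def/= expr0n expr1n add0r sqrtr1 mul1r.
have nR (r : R) : `|r%:C%C| = `|r|%:C%C by rewrite normc_def/= expr0n addr0 sqrtr_sqr.
rewrite !nR -rmorphD -rmorphM lecR.
have reM r z : re (r%:C%C * z) = r * re z by case: z => a b /=; rewrite mul0r subr0.
have imM r z : im (r%:C%C * z) = r * im z by case: z => a b /=; rewrite mul0r addr0.
rewrite -/(re _) -/(im _) !reB !imB reM imM.
by apply: le_trans (lerD h1 h2) _; rewrite /= -mulrDl -splitr.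
Qed.

(** The supremum of the [s] with [P 0 s] has this property itself and cannot
    be smaller than 1. Both the mean value inequality and uniformity on [0, 1]
    are instances. *)
Lemma cousin_induction (R : realType) (P : R -> R -> Prop) :
  (forall a b c, P a b -> P b c -> P a c) ->
  (forall t, 0 <= t <= 1 -> exists2 d : R, 0 < d &
     forall a b, 0 <= a -> a <= t <= b -> b <= 1 -> b - a <= d -> P a b) ->
  P 0 1.
Proof.
move=> trP locP; pose S := [set s : R | 0 <= s <= 1 /\ P 0 s].
have S0 : S 0.
  have t01 : 0 <= (0 : R) <= 1 by rewrite lexx ler01.
  have [d d0 h] := locP _ t01; split=> //.
  by apply: h; rewrite ?lexx ?ler01// subrr ltW.
have supS : has_sup S.
  by split; [exists 0 | exists 1 => s [/andP[]]].
have ubS := ub_le_sup supS.2.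
have t01 : 0 <= sup S <= 1.
  by rewrite (ubS _ S0) ge_sup//; [exists 0|move=> s [/andP[]]].
have [d d0 h] := locP _ t01.
have d20 : 0 < d / 2 by lra.
have [s [s01 Ps] ss] := sup_adherent d20 supS.
have sle : s <= sup S by exact: ubS.
(* A point strictly to the right of the supremum, unless this is already 1. *)
pose b := Num.min 1 (sup S + d / 2).
have tb : sup S <= b by rewrite /b le_min; case/andP: t01 => _ ->/=; lra.
have b1 : b <= 1 by rewrite /b ge_min lexx.
have bd : b <= sup S + d / 2 by rewrite /b ge_min lexx orbT.
have Pb : P 0 b.
  apply: trP Ps _; apply: h; rewrite ?sle//; [by case/andP: s01|lra].
have b0 : 0 <= b by apply: le_trans tb; case/andP: t01.
suff -> : 1 = b by [].
apply/eqP; rewrite eq_le b1 andbT leNgt; apply/negP => lb1.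
have Sb : S b by split=> //; rewrite b0.
have bE : b = sup S + d / 2.
  by rewrite /b min_r//; move: lb1; rewrite /b gt_min ltxx/= => /ltW.
by have := ubS _ Sb; lra.
Qed.

Section Paths.
Context {K : numFieldType} (X : real_axis K).
Local Notation R := (axis X).
Local Notation io := (axis_inj X).
Implicit Types (f g : R -> K) (t s : R).

Lemma axis_lt r s : (io r < io s) = (r < s).
Proof. by rewrite !lt_neqAle axis_le (inj_eq (fmorph_inj _)). Qed.

Lemma axis_ge0 r : (0 <= io r) = (0 <= r).
Proof. by rewrite -(rmorph0 io) axis_le. Qed.

Lemma axis_norm r : `|io r| = io `|r|.
Proof.
have [r0|r0] := ger0P r; first by rewrite ger0_norm// axis_ge0.
by rewrite rmorphN ltr0_norm// -(rmorph0 io) axis_lt.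
Qed.

Lemma axis_pos (e : K) : 0 < e -> exists2 r, 0 < r & io r = e.
Proof.
move=> e0; have [r rE] := axis_onto X (ltW e0); exists r => //.
by rewrite -axis_lt rE rmorph0.
Qed.

(** For every [e > 0] the bound with [M + e] is additive over adjacent
    intervals and holds on small ones, by definition of the derivative. *)
Lemma mean_value_inequality f f' (M : K) :
  deriv01 io f f' -> (forall t, 0 <= t <= 1 -> `|f' t| <= M) ->
  `|f 1 - f 0| <= M.
Proof.
move=> df f'M; apply/ler_addgt0Pr => e e0.
suff : `|f 1 - f 0| <= (M + e) * io (1 - 0) by rewrite subr0 rmorph1 mulr1.
apply: (@cousin_induction R (fun a b => `|f b - f a| <= (M + e) * io (b - a))).
  move=> a b c ab bc.
  have -> : f c - f a = (f c - f b) + (f b - f a) by rewrite addrA subrK.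
  apply: le_trans (ler_normD _ _) _; apply: le_trans (lerD bc ab) _.
  by rewrite -mulrDr -rmorphD addrA subrK.
move=> t t01; have [d d0 h] := df _ t01 _ e0; exists d => // a b a0 /andP[ta tb] b1 bad.
have step s : 0 <= s <= 1 -> `|s - t| <= d -> `|f s - f t| <= (M + e) * io `|s - t|.
  move=> s01 sd; have {}h := h s s01 sd.
  have -> : f s - f t = (f s - f t - io (s - t) * f' t) + io (s - t) * f' t.
    by rewrite subrK.
  apply: le_trans (ler_normD _ _) _; rewrite mulrDl addrC; apply: lerD h.
  by rewrite normrM axis_norm mulrC ler_wpM2r ?axis_ge0// f'M.
have -> : f b - f a = (f b - f t) - (f a - f t) by rewrite opprB addrA subrK.
apply: le_trans (ler_normB _ _) _.
have hb : `|f b - f t| <= (M + e) * io `|b - t|.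
  apply: step; first by rewrite b1 andbT (le_trans _ tb)//; case/andP: t01.
  by rewrite ger0_norm ?subr_ge0//; lra.
have ha : `|f a - f t| <= (M + e) * io `|a - t|.
  apply: step; first by rewrite a0/= (le_trans ta)//; case/andP: t01.
  by rewrite distrC ger0_norm ?subr_ge0//; lra.
apply: le_trans (lerD hb ha) _.
rewrite -mulrDr -rmorphD (ger0_norm (x := b - t)) ?subr_ge0//.
by rewrite distrC ger0_norm ?subr_ge0// addrA subrK.
Qed.

(** A radius that works near each parameter can be chosen independently of it:
    take the smaller of two radii when intervals are joined. *)
Lemma uniform01 (Q : R -> K -> Prop) :
  (forall t d d', 0 < d' -> d' <= d -> Q t d -> Q t d') ->
  (forall t, 0 <= t <= 1 -> exists2 r : R, 0 < r & exists2 d : K, 0 < d &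
     forall s, 0 <= s <= 1 -> `|s - t| <= r -> Q s d) ->
  exists2 d : K, 0 < d & forall t, 0 <= t <= 1 -> Q t d.
Proof.
move=> Qmon Qloc.
apply: (@cousin_induction R (fun a b => exists2 d : K, 0 < d &
  forall t, a <= t <= b -> Q t d)).
  move=> a b c [d d0 h] [d' d'0 h'].
  have [r r0 rE] := axis_pos d0; have [r' r'0 r'E] := axis_pos d'0.
  have m0 : 0 < io (Num.min r r') by rewrite -(rmorph0 io) axis_lt lt_min r0.
  exists (io (Num.min r r')) => // t /andP[ta tc].
  have [tb|/ltW tb] := leP t b.
    by apply: (Qmon _ d) (h _ _); rewrite ?ta// -rE axis_le ge_min lexx.
  by apply: (Qmon _ d') (h' _ _); rewrite ?tb// -r'E axis_le ge_min lexx orbT.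
move=> t t01; have [r r0 [d d0 h]] := Qloc _ t01; exists r => // a b a0 /andP[ta tb] b1 bad.
exists d => // s /andP[sa sb]; apply: h.
  by rewrite (le_trans a0)//= (le_trans sb).
by rewrite ler_norml; apply/andP; split; lra.
Qed.

End Paths.

(** * Differentiability from continuous partial derivatives *)

Section RowSpace.
Context {K : numFieldType} {n : nat}.
Implicit Types (F : 'rV[K]_n -> K) (b u v w : 'rV[K]_n).
Local Notation ee j := (delta_mx 0 j : 'rV[K]_n).

Lemma row_entry_le u j : `|u 0 j| <= `|u|.
Proof.
rewrite [leRHS]/Num.Def.normr/= mx_normE.
rewrite -[leLHS]nngE num_le.
exact: (le_bigmax _ (fun i : 'I_1 * 'I_n => `|u i.1 i.2|%:nng) (0, j)).
Qed.

Lemma row_norm_le u (r : K) : 0 <= r -> (forall j, `|u 0 j| <= r) -> `|u| <= r.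
Proof.
move=> r0 ur; rewrite [leLHS]/Num.Def.normr/= mx_normE.
rewrite -[leRHS]/((NngNum r0)%:num) num_le; apply/bigmax_leP; split=> //.
by move=> [i j] _; rewrite -num_le/= ord1.
Qed.

(** Total differentiability at [b] with the linear map of coefficients [L]. *)
Definition total_deriv F b (L : 'I_n -> K) := forall e : K, 0 < e ->
  exists2 d : K, 0 < d & forall u, `|u| <= d ->
    `|F (b + u) - F b - \sum_j L j * u 0 j| <= e * `|u|.

(** The inner curve is Lipschitz at the point because each of its components
    is differentiable there, so the error term of [F] stays negligible. *)
Lemma chain_rule (V : normedModType K) (F : 'rV[K]_n -> K) (g : V -> 'rV[K]_n)
    (a v : V) (L D : 'I_n -> K) :
  total_deriv F (g a) L ->
  (forall j, is_derive a v (fun z => g z 0 j) (D j)) ->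
  is_derive a v (F \o g) (\sum_j L j * D j).
Proof.
move=> tF dg; apply: is_derive_increment => e e0.
pose C : K := \sum_j (`|D j| + 1) + 1; pose B : K := \sum_j `|L j| + 1.
have B0 : 0 < B by rewrite ltr_wpDl// sumr_ge0.
have C0 : 0 < C by rewrite ltr_wpDl// sumr_ge0// => j _; rewrite addr_ge0.
have e10 : 0 < e / 2 / C by rewrite !divr_gt0.
have e20 : 0 < e / 2 / B by rewrite !divr_gt0.
have [d1 d10 h1] := tF _ e10.
have near_g (r : K) : 0 < r -> \forall h \near (0 : K), forall j,
    `|g (a + h *: v) 0 j - g a 0 j - h * D j| <= r * `|h|.
  move=> r0; apply: (filter_forall (nbhs_filter (0 : K))) => j.
  apply/near0_scalar.
  have [dj <-] := dg j; have [d d0 h] := derive_increment dj r0.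
  by exists d.
suff : \forall h \near (0 : K), `|(F \o g) (a + h *: v) - (F \o g) a -
    h * (\sum_j L j * D j)| <= e * `|h|.
  by case/near0_scalar => d d0 h; exists d.
have dC : 0 < d1 / C by rewrite divr_gt0.
near=> h.
have hd : `|h| <= d1 / C.
  by near: h; apply/near0_scalar; exists (d1 / C).
have g1 : forall j, `|g (a + h *: v) 0 j - g a 0 j - h * D j| <= 1 * `|h|.
  by near: h; exact: near_g.
have g2 : forall j, `|g (a + h *: v) 0 j - g a 0 j - h * D j| <= e / 2 / B * `|h|.
  by near: h; exact: near_g.
pose u := g (a + h *: v) - g a.
have uE j : u 0 j = g (a + h *: v) 0 j - g a 0 j by rewrite !mxE.
have uC : `|u| <= C * `|h|.
  apply: row_norm_le => [|j]; first by rewrite mulr_ge0// ltW.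
  rewrite uE -[X in `|X|](subrK (h * D j)); apply: le_trans (ler_normD _ _) _.
  apply: le_trans (lerD (g1 j) (lexx _)) _; rewrite normrM (mulrC `|h|) -mulrDl.
  rewrite ler_wpM2r// addrC /C (bigD1 j)//= -addrA lerDl addr_ge0// sumr_ge0//.
have ud : `|u| <= d1.
  by apply: le_trans uC _; rewrite mulrC -ler_pdivlMr.
have gu : g a + u = g (a + h *: v) by rewrite /u addrC subrK.
have := h1 _ ud; rewrite gu => hF.
have -> : (F \o g) (a + h *: v) - (F \o g) a - h * (\sum_j L j * D j) =
  (F (g (a + h *: v)) - F (g a) - \sum_j L j * u 0 j) +
  \sum_j L j * (u 0 j - h * D j).
  have -> : \sum_j L j * (u 0 j - h * D j) =
      \sum_j L j * u 0 j - h * \sum_j L j * D j.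
    by rewrite mulr_sumr -sumrB; apply: eq_bigr => j _; ring.
  by rewrite addrA subrK.
apply: le_trans (ler_normD _ _) _.
have -> : e * `|h| = e / 2 / C * (C * `|h|) + e / 2 / B * B * `|h|.
  by field; rewrite !gt_eqF.
apply: lerD; first by apply: le_trans hF _; rewrite ler_wpM2l// ltW.
apply: le_trans (ler_norm_sum _ _ _) _.
apply: (@le_trans _ _ (\sum_j `|L j| * (e / 2 / B * `|h|))).
  by apply: ler_sum => j _; rewrite normrM ler_wpM2l// uE.
rewrite -mulr_suml mulrCA -[leRHS]mulrA ler_wpM2l ?(ltW e20)//.
by rewrite ler_wpM2r// /B lerDl.
Unshelve. all: by end_near. Qed.

Section Axis.
Variable X : real_axis K.
Local Notation R := (axis X).
Local Notation io := (axis_inj X).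

Lemma path_deriv F w v (c : K) :
  (forall t : R, 0 <= t <= 1 -> derivable F (w + (io t * c) *: v) v) ->
  deriv01 io (fun t => F (w + (io t * c) *: v))
             (fun t => c * 'D_v F (w + (io t * c) *: v)).
Proof.
move=> dF t t01 e e0; have c10 : 0 < `|c| + 1 by rewrite ltr_wpDl.
have ec0 : 0 < e / (`|c| + 1) by rewrite divr_gt0.
have [d d0 h] := derive_increment (dF t t01) ec0.
have [r r0 rE] := axis_pos X (divr_gt0 d0 c10).
exists r => // s s01 st.
have hs : `|io (s - t) * c| <= io `|s - t| * (`|c| + 1).
  by rewrite normrM axis_norm ler_wpM2l ?axis_ge0// lerDl.
have hd : `|io (s - t) * c| <= d.
  apply: le_trans hs _; rewrite -ler_pdivlMr// -rE.
  by rewrite axis_le.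
have sE : w + (io t * c) *: v + (io (s - t) * c) *: v = w + (io s * c) *: v.
  by rewrite -addrA -scalerDl -mulrDl -rmorphD [t + _]addrC subrK.
have := h _ hd; rewrite sE => hF; rewrite [io (s - t) * _]mulrA.
apply: le_trans hF _; apply: le_trans (ler_wpM2l (ltW ec0) hs) _.
by rewrite mulrCA divfK ?gt_eqF// mulrC.
Qed.

Lemma deriv01_sub_linear (f f' : R -> K) (a : K) : deriv01 io f f' ->
  deriv01 io (fun t => f t - io t * a) (fun t => f' t - a).
Proof.
move=> df t t01 e e0; have [d d0 h] := df t t01 e e0; exists d => // s s01 st.
have := h s s01 st; congr (`|_| <= _); rewrite rmorphB; ring.
Qed.

(** Apply the mean value inequality to [F] minus its linear approximation on
    the segment. *)
Lemma increment_line F w v (c L e : K) :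
  (forall t : R, 0 <= t <= 1 -> derivable F (w + (io t * c) *: v) v /\
     `|'D_v F (w + (io t * c) *: v) - L| <= e) ->
  `|F (w + c *: v) - F w - c * L| <= `|c| * e.
Proof.
move=> h; have dF t : 0 <= t <= 1 -> _ := fun t01 => (h t t01).1.
have := mean_value_inequality (deriv01_sub_linear (c * L) (path_deriv dF)).
rewrite rmorph0 rmorph1 !mul0r !mul1r scale0r addr0 subr0.
rewrite addrAC; apply => t t01.
by rewrite -mulrBr normrM ler_wpM2l// (h t t01).2.
Qed.

(** Change the coordinates of [b] into those of [b + u] one at a time; each
    step is a move along an axis, to which [increment_line] applies. *)
Lemma total_increment F b (L : 'I_n -> K) (r e : K) :
  (forall w, `|w - b| <= r -> forall j, derivable F w (ee j) /\
     `|'D_(ee j) F w - L j| <= e) ->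
  forall u, `|u| <= r ->
  `|F (b + u) - F b - \sum_j L j * u 0 j| <= n%:R * e * `|u|.
Proof.
move=> h u ur.
(* The first [k] coordinates of [u], followed by zeros. *)
pose tr k : 'rV[K]_n := \row_j (if (j < k)%N then u 0 j else 0).
have trn : tr n = u by apply/rowP => j; rewrite mxE ltn_ord.
have tr0 : tr 0%N = 0 by apply/rowP => j; rewrite !mxE.
suff : forall k, (k <= n)%N ->
    `|F (b + tr k) - F b - \sum_j L j * tr k 0 j| <= k%:R * e * `|u|.
  by move=> /(_ _ (leqnn n)); rewrite trn.
elim=> [_|k ih kn].
  rewrite tr0 addr0 subrr sub0r normrN mul0r big1 ?normr0 ?mul0r// => j _.
  by rewrite mxE mulr0.
pose j0 := Ordinal kn.
have trS : tr k.+1 = tr k + u 0 j0 *: ee j0.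
  apply/rowP => j; rewrite !mxE eqxx/= ltnS leq_eqVlt -(inj_eq val_inj)/= eq_sym.
  have [kj|jk] := eqVneq (k : nat) j.
    have <- : j0 = j by exact/val_inj.
    by rewrite /= ltnn add0r mulr1.
  by rewrite mulr0 addr0.
have LS : \sum_j L j * tr k.+1 0 j = \sum_j L j * tr k 0 j + u 0 j0 * L j0.
  have uE j : (u 0 j0 *: ee j0) 0 j = u 0 j0 * (j == j0)%:R by rewrite !mxE eqxx.
  rewrite trS; under eq_bigr do rewrite mxE uE mulrDr.
  rewrite big_split/=; congr (_ + _); rewrite (bigD1 j0)//= eqxx mulr1 mulrC.
  by rewrite big1 ?addr0// => j /negbTE ->; rewrite !mulr0.
have seg t : 0 <= t <= 1 -> `|b + tr k + (io t * u 0 j0) *: ee j0 - b| <= r.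
  move=> /andP[t0 t1]; rewrite -[b + tr k + _]addrA [b + _]addrC addrK.
  apply: le_trans ur.
  apply: row_norm_le => // j; rewrite !mxE eqxx/=.
  have [jj0|jj0] := eqVneq j j0.
    rewrite jj0 ltnn add0r mulr1 normrM axis_norm (ger0_norm t0).
    apply: (@le_trans _ _ (1 * `|u 0 j0|)); last by rewrite mul1r row_entry_le.
    by rewrite ler_wpM2r// -(rmorph1 io) axis_le.
  rewrite mulr0 addr0; case: ifP => _; first exact: row_entry_le.
  by rewrite normr0.
have := @increment_line F (b + tr k) (ee j0) (u 0 j0) (L j0) e
  (fun t t01 => h _ (seg t t01) j0).
rewrite -[b + tr k + _]addrA -trS => hk.
have -> : F (b + tr k.+1) - F b - \sum_j L j * tr k.+1 0 j =
   (F (b + tr k.+1) - F (b + tr k) - u 0 j0 * L j0) +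
   (F (b + tr k) - F b - \sum_j L j * tr k 0 j) by rewrite LS; ring.
apply: le_trans (ler_normD _ _) _; apply: le_trans (lerD hk (ih (ltnW kn))) _.
rewrite -natr1 2!mulrDl mul1r addrC lerD2l mulrC ler_wpM2l ?row_entry_le//.
have /h : `|b - b| <= r by rewrite subrr normr0 (le_trans _ ur).
by move=> /(_ j0)[_]; exact: le_trans.
Qed.

(** Continuity of the partial derivatives, with one radius for all axes. *)
Definition C1_at F b := forall e : K, 0 < e -> exists2 d : K, 0 < d &
  forall w, `|w - b| <= d -> forall j, derivable F w (ee j) /\
    `|'D_(ee j) F w - 'D_(ee j) F b| <= e.

Lemma C1_total_deriv F b : C1_at F b -> total_deriv F b (fun j => 'D_(ee j) F b).
Proof.
move=> F1 e e0; have n0 : 0 < n%:R + 1 :> K by rewrite ltr_wpDl// ler0n.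
have [d d0 h] := F1 _ (divr_gt0 e0 n0).
exists d => // u ud; apply: le_trans (total_increment h ud) _.
rewrite ler_wpM2r// mulrA ler_pdivrMr// mulrC ler_wpM2l ?ltW// ltrDl//.
Qed.

End Axis.
End RowSpace.

(** * The Poincare lemma on a ball *)

Section Poincare.
Context {K : numFieldType} {n : nat} (X : real_axis K).
Local Notation R := (axis X).
Local Notation io := (axis_inj X).
Implicit Types (F : 'rV[K]_n -> K) (b u v w z : 'rV[K]_n).
Local Notation ee j := (delta_mx 0 j : 'rV[K]_n).

Lemma deriv01B (f f' g g' : R -> K) : deriv01 io f f' -> deriv01 io g g' ->
  deriv01 io (fun t => f t - g t) (fun t => f' t - g' t).
Proof.
move=> df dg t t01 e e0; have e20 : 0 < e / 2 by rewrite divr_gt0.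
have [d d0 h] := df t t01 _ e20; have [d' d'0 h'] := dg t t01 _ e20.
exists (Num.min d d') => [|s s01]; first by rewrite lt_min d0.
rewrite le_min => /andP[sd sd'].
have -> : f s - g s - (f t - g t) - io (s - t) * (f' t - g' t) =
  (f s - f t - io (s - t) * f' t) - (g s - g t - io (s - t) * g' t) by ring.
apply: le_trans (ler_normB _ _) _.
by apply: le_trans (lerD (h s s01 sd) (h' s s01 sd')) _; rewrite -mulrDl -splitr.
Qed.

Lemma deriv01Z (f f' : R -> K) (c : K) : deriv01 io f f' ->
  deriv01 io (fun t => c * f t) (fun t => c * f' t).
Proof.
move=> df t t01 e e0; have c0 : 0 < `|c| + 1 by rewrite ltr_wpDl.
have [d d0 h] := df t t01 _ (divr_gt0 e0 c0); exists d => // s s01 st.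
have -> : c * f s - c * f t - io (s - t) * (c * f' t) =
  c * (f s - f t - io (s - t) * f' t) by ring.
rewrite normrM; apply: le_trans (ler_wpM2l _ (h s s01 st)) _ => //.
rewrite !mulrA ler_wpM2r ?axis_ge0// ler_pdivrMr//.
by rewrite mulrC ler_wpM2l ?(ltW e0)// lerDl.
Qed.

Lemma deriv01_mulid (f f' : R -> K) : deriv01 io f f' ->
  deriv01 io (fun t => io t * f t) (fun t => f t + io t * f' t).
Proof.
move=> df t t01 e e0; have e20 : 0 < e / 2 by rewrite divr_gt0.
have c0 : 0 < `|f' t| + 1 by rewrite ltr_wpDl.
have [d d0 h] := df t t01 _ e20.
have [r r0 rE] := axis_pos X (divr_gt0 e20 c0).
exists (Num.min d r) => [|s s01]; first by rewrite lt_min d0.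
rewrite le_min => /andP[sd sr].
have -> : io s * f s - io t * f t - io (s - t) * (f t + io t * f' t) =
  io s * (f s - f t - io (s - t) * f' t) + io (s - t) * f' t * io (s - t).
  by rewrite rmorphB; ring.
apply: le_trans (ler_normD _ _) _.
rewrite {1}(splitr e) mulrDl; apply: lerD.
  rewrite normrM -[leRHS]mul1r ler_pM ?h//; case/andP: s01 => s0 s1.
  by rewrite axis_norm ger0_norm// -(rmorph1 io) axis_le.
rewrite !normrM !axis_norm ler_wpM2r ?axis_ge0//.
apply: (@le_trans _ _ (io r * (`|f' t| + 1))).
  by rewrite ler_pM ?axis_ge0// ?axis_le// lerDl.
by rewrite rE divfK// gt_eqF.
Qed.

Lemma total_deriv_continuous F z (L : 'I_n -> K) : total_deriv F z L ->
  forall e : K, 0 < e -> exists2 d : K, 0 < d &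
    forall w, `|w - z| <= d -> `|F w - F z| <= e.
Proof.
move=> tF e e0; have [d d0 h] := tF 1 ltr01.
pose B : K := \sum_j `|L j| + 1.
have B0 : 0 < B by rewrite ltr_wpDl// sumr_ge0.
have step w : `|w - z| <= d -> `|F w - F z| <= B * `|w - z|.
  move=> wd; have := h _ wd; rewrite [z + _]addrC subrK mul1r => hw.
  rewrite -[F w - F z](subrK (\sum_j L j * (w - z) 0 j)).
  apply: le_trans (ler_normD _ _) _; rewrite mulrDl mul1r addrC lerD//.
  apply: le_trans (ler_norm_sum _ _ _) _; rewrite mulr_suml; apply: ler_sum => j _.
  by rewrite normrM ler_wpM2l// row_entry_le.
have [r r0 rE] := axis_pos X d0; have [r' r'0 r'E] := axis_pos X (divr_gt0 e0 B0).
exists (io (Num.min r r')); first by rewrite -(rmorph0 io) axis_lt lt_min r0.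
move=> w wd; have wd1 : `|w - z| <= d.
  by apply: le_trans wd _; rewrite -rE axis_le ge_min lexx.
apply: le_trans (step _ wd1) _; rewrite -ler_pdivlMl// mulrC -r'E.
by apply: le_trans wd _; rewrite axis_le ge_min lexx orbT.
Qed.

(** The coefficients are a function of the point so that the derivative can
    again be read as a function of the parameter. *)
Lemma path_total_deriv F b w (L : 'rV[K]_n -> 'I_n -> K) :
  (forall t : R, 0 <= t <= 1 -> total_deriv F (b + io t *: w) (L (b + io t *: w))) ->
  deriv01 io (fun t => F (b + io t *: w))
             (fun t => \sum_j L (b + io t *: w) j * w 0 j).
Proof.
move=> tF t t01 e e0; have w0 : 0 < `|w| + 1 by rewrite ltr_wpDl.
have [d d0 h] := tF t t01 _ (divr_gt0 e0 w0).
have [r r0 rE] := axis_pos X (divr_gt0 d0 w0).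
exists r => // s s01 st; pose u := io (s - t) *: w.
have uN : `|u| = io `|s - t| * `|w| by rewrite normrZ axis_norm.
have ud : `|u| <= d.
  rewrite uN; apply: (@le_trans _ _ (io r * (`|w| + 1))).
    by rewrite ler_pM ?axis_ge0// ?axis_le// lerDl.
  by rewrite rE divfK// gt_eqF.
have us : b + io t *: w + u = b + io s *: w.
  by rewrite -addrA -scalerDl -rmorphD [t + _]addrC subrK.
have := h _ ud; rewrite us mulr_sumr.
under eq_bigr do rewrite mxE mulrCA.
move/le_trans; apply; rewrite uN mulrCA mulrC ler_wpM2r ?axis_ge0//.
by rewrite mulrAC ler_pdivrMr// ler_wpM2l ?(ltW e0)// lerDl.
Qed.

(** The error is uniform in the base point [w] near [z]; combined with
    [uniform01] this replaces uniform continuity on a segment. *)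
Lemma C1_line_increment F z (i : 'I_n) (e : K) : C1_at F z -> 0 < e ->
  exists2 d : K, 0 < d & forall w (c : K), `|w - z| <= d -> `|c| <= d ->
    `|F (w + c *: ee i) - F w - c * 'D_(ee i) F w| <= e * `|c|.
Proof.
move=> F1 e0; have e20 : 0 < e / 2 by rewrite divr_gt0.
have [d d0 h] := F1 _ e20; exists (d / 2); first by rewrite divr_gt0.
move=> w c wd cd; pose L := 'D_(ee i) F z.
have wd' : `|w - z| <= d.
  by apply: le_trans wd _; rewrite ler_pdivrMr// ler_pMr// ler1n.
have seg (t : R) : 0 <= t <= 1 -> `|w + (io t * c) *: ee i - z| <= d.
  move=> /andP[t0 t1]; rewrite addrAC [leRHS]splitr.
  apply: le_trans (ler_normD _ _) _; apply: lerD => //.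
  apply: le_trans cd; apply: row_norm_le => // j; rewrite !mxE eqxx/=.
  have t1' : io t <= 1 by rewrite -(rmorph1 io) axis_le.
  rewrite !normrM axis_norm (ger0_norm t0) normr_nat -[leRHS]mul1r -mulrA.
  rewrite ler_pM ?axis_ge0// ?mulr_ge0//.
  by case: (j == i); rewrite ?mulr1 ?mulr0.
have hl := increment_line (fun t t01 => h _ (seg t t01) i).
have -> : F (w + c *: ee i) - F w - c * 'D_(ee i) F w =
  (F (w + c *: ee i) - F w - c * L) - c * ('D_(ee i) F w - L) by ring.
apply: le_trans (ler_normB _ _) _.
rewrite [e]splitr mulrDl; apply: lerD; first by rewrite [leRHS]mulrC.
by rewrite normrM mulrC ler_wpM2r//; exact: (h _ wd' i).2.
Qed.

(** The potential at [v] is the integral of the form along the segment from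
    [b] to [v]. To differentiate it in the direction [ee i] the integral is
    never estimated: with [w = v - b] and [P w] a primitive of the integrand,
    the path [P (w + h ee_i) - P w - t h th_i] is compared at its two end
    points. By closedness the derivative of [t th_i (b + t w)] is [th_i] plus
    [t] times the sum of the [D_i th_j w_j], so that the derivative of the
    path consists of errors of first order approximations, small compared to
    [h] uniformly in [t]; the mean value inequality concludes. *)
Lemma closed_form_primitive (th : 'I_n -> 'rV[K]_n -> K) b (r : K) :
  (forall w i, `|w - b| <= r -> C1_at (th i) w) ->
  (forall w (i j : 'I_n), `|w - b| <= r -> 'D_(ee i) (th j) w = 'D_(ee j) (th i) w) ->
  exists tau : 'rV[K]_n -> K, forall v (i : 'I_n), `|v - b| < r ->
    is_derive v (ee i) tau (th i v).
Proof.
move=> th1 thC.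
pose D j := fun z i => 'D_(ee i) (th j) z.
have thT j z : `|z - b| <= r -> total_deriv (th j) z (D j z).
  by move=> zr; apply: C1_total_deriv X _ _ _; exact: th1.
have ray w (t : R) : `|w| <= r -> 0 <= t <= 1 -> `|b + io t *: w - b| <= r.
  move=> wr /andP[t0 t1]; rewrite addrC addKr normrZ axis_norm ger0_norm//.
  apply: le_trans wr; rewrite -[leRHS]mul1r ler_wpM2r//.
  by rewrite -(rmorph1 io) axis_le.
have path w j : `|w| <= r -> deriv01 io (fun t => th j (b + io t *: w))
    (fun t => \sum_i D j (b + io t *: w) i * w 0 i).
  by move=> wr; apply: path_total_deriv => t t01; apply: thT; exact: ray.
pose g w t := \sum_j th j (b + io t *: w) * w 0 j.
have gc w : `|w| <= r -> cont01 (g w).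
  move=> wr t t01 e e0; pose B : K := \sum_j `|w 0 j| + 1.
  have B0 : 0 < B by rewrite ltr_wpDl// sumr_ge0.
  have near_j j : \forall h \near (0 : K), forall s : R, 0 <= s <= 1 ->
      io `|s - t| <= `|h| ->
      `|th j (b + io s *: w) - th j (b + io t *: w)| <= e / B.
    apply/near0_scalar.
    have [d d0 h] := total_deriv_continuous (thT j _ (ray w t wr t01)) (divr_gt0 e0 B0).
    have w0 : 0 < `|w| + 1 by rewrite ltr_wpDl.
    exists (d / (`|w| + 1)); first by rewrite divr_gt0.
    move=> k kd s s01 sk; apply: h.
    rewrite opprD addrACA subrr add0r -scalerBl -rmorphB normrZ axis_norm.
    apply: (@le_trans _ _ (d / (`|w| + 1) * (`|w| + 1))); last by rewrite divfK// gt_eqF.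
    by rewrite ler_pM ?axis_ge0// ?lerDl//; exact: le_trans sk kd.
  have /near0_scalar[d d0 hd] := filter_forall (nbhs_filter (0 : K)) near_j.
  have [r' r'0 r'E] := axis_pos X d0; exists r' => // s s01 st.
  have -> : g w s - g w t =
      \sum_j (th j (b + io s *: w) - th j (b + io t *: w)) * w 0 j.
    by rewrite /g -sumrB; apply: eq_bigr => j _; rewrite mulrBl.
  apply: le_trans (ler_norm_sum _ _ _) _.
  apply: (@le_trans _ _ (\sum_j e / B * `|w 0 j|)).
    apply: ler_sum => j _; rewrite normrM ler_wpM2r//.
    by apply: (hd d); rewrite // (gtr0_norm d0)// -r'E axis_le.
  rewrite -mulr_sumr mulrAC ler_pdivrMr// ler_wpM2l ?(ltW e0)//.
  by rewrite /B lerDl.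
have /choice[P PP] : forall w, exists P : R -> K, `|w| <= r -> deriv01 io P (g w).
  move=> w; have [wr|_] := boolP (`|w| <= r); last by exists (fun=> 0).
  by have [P PP] := axis_primitive (gc w wr); exists P.
exists (fun v => P (v - b) 1 - P (v - b) 0) => v i vr.
apply: is_derive_increment => e e0.
pose w := v - b; pose B : K := \sum_j `|w 0 j| + 1.
have wr : `|w| <= r := ltW vr.
have B0 : 0 < B by rewrite ltr_wpDl// sumr_ge0.
have e20 : 0 < e / 2 by rewrite divr_gt0.
(* First order approximation of the coefficients in direction [i], uniformly
   along the segment. *)
have unif1 j : \forall h \near (0 : K), forall t : R, 0 <= t <= 1 ->
    `|th j (b + io t *: w + (io t * h) *: ee i) - th j (b + io t *: w)
      - io t * h * D j (b + io t *: w) i| <= e / 2 / B * `|h|.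
  pose Q (t : R) (d : K) := forall c : K, `|c| <= d ->
    `|th j (b + io t *: w + c *: ee i) - th j (b + io t *: w)
      - c * D j (b + io t *: w) i| <= e / 2 / B * `|c|.
  have [|t t01|d d0 Qd] := @uniform01 K X Q.
  - by move=> t d d' _ dd' h c cd; apply: h; exact: le_trans dd'.
  - have := C1_line_increment i (th1 _ j (ray w t wr t01)) (divr_gt0 e20 B0).
    case=> d d0 h; have w0 : 0 < `|w| + 1 by rewrite ltr_wpDl.
    have [r' r'0 r'E] := axis_pos X (divr_gt0 d0 w0).
    exists r' => //; exists d => // s s01 st c cd; apply: h => //.
    rewrite opprD addrACA subrr add0r -scalerBl -rmorphB normrZ axis_norm.
    apply: (@le_trans _ _ (d / (`|w| + 1) * (`|w| + 1))); last by rewrite divfK// gt_eqF.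
    by rewrite ler_pM ?axis_ge0// ?lerDl// -r'E axis_le.
  apply/near0_scalar; exists d => // h hd t t01.
  have tN : `|io t * h| <= `|h|.
    case/andP: t01 => t0 t1; rewrite normrM axis_norm (ger0_norm t0).
    by rewrite -[leRHS]mul1r ler_wpM2r// -(rmorph1 io) axis_le.
  apply: le_trans (Qd t t01 _ (le_trans tN hd)) _.
  by rewrite ler_wpM2l// ltW// divr_gt0.
(* Uniform continuity of the [i]-th coefficient along the segment. *)
have unif2 : \forall h \near (0 : K), forall t : R, 0 <= t <= 1 ->
    `|th i (b + io t *: w + (io t * h) *: ee i) - th i (b + io t *: w)| <= e / 2.
  pose Q (t : R) (d : K) := forall c : K, `|c| <= d ->
    `|th i (b + io t *: w + c *: ee i) - th i (b + io t *: w)| <= e / 2.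
  have [|t t01|d d0 Qd] := @uniform01 K X Q.
  - by move=> t d d' _ dd' h c cd; apply: h; exact: le_trans dd'.
  - have e40 : 0 < e / 2 / 2 by rewrite divr_gt0.
    have [d d0 h] := total_deriv_continuous (thT i _ (ray w t wr t01)) e40.
    have w0 : 0 < `|w| + 1 by rewrite ltr_wpDl.
    have d20 : 0 < d / 2 by rewrite divr_gt0.
    have [r' r'0 r'E] := axis_pos X (divr_gt0 d20 w0).
    exists r' => //; exists (d / 2) => // s s01 st c cd.
    have close : `|b + io s *: w - (b + io t *: w)| <= d / 2.
      rewrite opprD addrACA subrr add0r -scalerBl -rmorphB normrZ axis_norm.
      apply: (@le_trans _ _ (d / 2 / (`|w| + 1) * (`|w| + 1))); last by rewrite divfK// gt_eqF.
      by rewrite ler_pM ?axis_ge0// ?lerDl// -r'E axis_le.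
    have cN : `|c *: ee i| <= d / 2.
      apply: le_trans cd; apply: row_norm_le => // k; rewrite !mxE eqxx/= normrM normr_nat.
      by case: (k == i); rewrite ?mulr1 ?mulr0.
    rewrite -[X in `|X|](subrKA (th i (b + io t *: w))) [leRHS]splitr.
    apply: le_trans (ler_normD _ _) _; apply: lerD; last first.
      rewrite distrC; apply: h; apply: le_trans close _.
      by rewrite ler_pdivrMr// ler_pMr// ler1n.
    apply: h; rewrite addrAC [leRHS]splitr.
    by apply: le_trans (ler_normD _ _) _; exact: lerD.
  apply/near0_scalar; exists d => // h hd t t01; apply: (Qd t t01).
  apply: le_trans hd; case/andP: t01 => t0 t1; rewrite normrM axis_norm (ger0_norm t0).
  by rewrite -[leRHS]mul1r ler_wpM2r// -(rmorph1 io) axis_le.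
have /near0_scalar[d1 d10 h1] := filter_forall (nbhs_filter (0 : K)) unif1.
have /near0_scalar[d2 d20 h2] := unif2.
have d30 : 0 < r - `|w| by rewrite subr_gt0.
apply/near0_scalar; near=> h.
have hd1 : `|h| <= d1 by near: h; apply/near0_scalar; exists d1.
have hd2 : `|h| <= d2 by near: h; apply/near0_scalar; exists d2.
have hd3 : `|h| <= r - `|w| by near: h; apply/near0_scalar; exists (r - `|w|).
have hN : `|h *: ee i| <= `|h|.
  apply: row_norm_le => // k; rewrite !mxE eqxx/= normrM normr_nat.
  by case: (k == i); rewrite ?mulr1 ?mulr0.
have whr : `|w + h *: ee i| <= r.
  by apply: le_trans (ler_normD _ _) _; rewrite addrC -lerBrDr; exact: le_trans hN hd3.
have -> : v + h *: ee i - b = w + h *: ee i by rewrite addrAC.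
rewrite -/w.
have dQ := deriv01B (deriv01B (PP _ whr) (PP _ wr))
  (deriv01_mulid (deriv01Z h (path w i wr))).
have vE : b + w = v by rewrite /w addrC subrK.
have := @mean_value_inequality _ X _ _ (e * `|h|) dQ.
rewrite rmorph1 rmorph0 mul0r subr0 scale1r vE mul1r.
have -> : P (w + h *: ee i) 1 - P w 1 - h * th i v -
    (P (w + h *: ee i) 0 - P w 0) =
  P (w + h *: ee i) 1 - P (w + h *: ee i) 0 - (P w 1 - P w 0) - h * th i v by ring.
apply=> t t01; set z := b + io t *: w.
have zE : b + io t *: (w + h *: ee i) = z + (io t * h) *: ee i.
  by rewrite scalerDr scalerA addrA.
have -> : g (w + h *: ee i) t - g w t -
    (h * th i z + io t * (h * \sum_j D i z j * w 0 j)) =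
  \sum_j (th j (z + (io t * h) *: ee i) - th j z - io t * h * D j z i) * w 0 j +
  h * (th i (z + (io t * h) *: ee i) - th i z).
  rewrite /g zE -/z.
  have -> : \sum_j th j (z + (io t * h) *: ee i) * (w + h *: ee i) 0 j =
     \sum_j th j (z + (io t * h) *: ee i) * w 0 j + h * th i (z + (io t * h) *: ee i).
    have wE j : (w + h *: ee i) 0 j = w 0 j + h * (j == i)%:R by rewrite !mxE eqxx.
    under eq_bigr do rewrite wE mulrDr.
    rewrite big_split/=; congr (_ + _); rewrite (bigD1 i)//= eqxx mulr1 mulrC.
    by rewrite big1 ?addr0// => j /negbTE ->; rewrite !mulr0.
  have -> : \sum_j D i z j * w 0 j = \sum_j D j z i * w 0 j.
    by apply: eq_bigr => j _; rewrite /D thC//; exact: ray.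
  under [\sum_j (_ - _) * _]eq_bigr do rewrite 2!mulrBl -[io t * h * _ * _]mulrA.
  rewrite !sumrB -mulr_sumr; ring.
apply: le_trans (ler_normD _ _) _; rewrite {1}[e]splitr mulrDl; apply: lerD; last first.
  by rewrite normrM mulrC ler_wpM2r// h2.
apply: le_trans (ler_norm_sum _ _ _) _.
apply: (@le_trans _ _ (\sum_j e / 2 / B * `|h| * `|w 0 j|)).
  by apply: ler_sum => j _; rewrite normrM ler_wpM2r// h1.
rewrite -mulr_sumr mulrAC ler_wpM2r// mulrAC ler_pdivrMr// ler_wpM2l ?(ltW e20)//.
by rewrite /B lerDl.
Unshelve. all: by end_near. Qed.

End Poincare.

(** * Change of charts *)

Section ChartChange.
Context {K : numFieldType} {n : nat} {T : topologicalType} (X : real_axis K).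
Implicit Types (x y : chart K n T) (f : T -> K) (p : T) (U : set T).
Local Notation ee j := (delta_mx 0 j : 'rV[K]_n).

(** Continuity of the partial derivatives on the manifold is carried to the
    coordinate space by the continuous parametrization. *)
Lemma chart_C1 x U f p : open U -> U `<=` chart_dom x -> U p ->
  (forall q, U q -> pderivable x f q) ->
  (forall i, {for p, continuous (pd x i f)}) ->
  C1_at (f \o chart_param x) (chart_coord x p).
Proof.
move=> oU Ux Up df cf e e0; have xp := Ux _ Up.
have near_i i : \forall v \near chart_coord x p,
    `|pd x i f (chart_param x v) - pd x i f p| <= e.
  have := param_continuous_at xp.
  have := cf i; rewrite -{1}(coordK xp) => ci cp.
  have cc := cvg_comp _ _ cp ci.
  have cce := (cvgrPdist_le (FF := nbhs_filter (chart_coord x p))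
    (pd x i f \o chart_param x) _).1 cc e e0.
  apply: (@filterS _ _ (nbhs_filter (chart_coord x p)) _ _ _ cce) => v /=.
  by rewrite coordK// distrC.
have [d d0 h] := (@nbhs_closed_ball K 'rV[K]_n _ _).1 (filterI (near_chart oU Ux Up)
  (filter_forall (nbhs_filter (chart_coord x p)) near_i)).
exists d => // w wd j.
have [[Uw wE] hw] := h w wd; split.
  by have := df _ Uw j; rewrite wE.
have := hw j; rewrite /pd wE; apply: le_trans.
by rewrite le_eqVlt eqxx.
Qed.

Lemma chart_total_deriv x U f p : open U -> U `<=` chart_dom x -> U p ->
  (forall q, U q -> pderivable x f q) ->
  (forall i, {for p, continuous (pd x i f)}) ->
  total_deriv (f \o chart_param x) (chart_coord x p) (fun i => pd x i f p).
Proof.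
move=> oU Ux Up df cf; exact: (C1_total_deriv X (chart_C1 oU Ux Up df cf)).
Qed.

(** The chain rule for the coordinate transition, of which only the components
    need to be differentiable. *)
Lemma pd_change x y U f p k : open U -> U `<=` chart_dom y -> U p ->
  chart_dom x p ->
  (forall q, U q -> pderivable y f q) ->
  (forall i, {for p, continuous (pd y i f)}) ->
  (forall j, pderivable x (fun q => chart_coord y q 0 j) p) ->
  is_derive (chart_coord x p) (ee k) (f \o chart_param x)
    (\sum_j pd y j f p * pd x k (fun q => chart_coord y q 0 j) p).
Proof.
move=> oU Uy Up xp df cf dy; have yp := Uy _ Up.
have tf := chart_total_deriv oU Uy Up df cf.
have oV : open (U `&` chart_dom x) by apply: openI => //; exact: dom_open.
have nV := near_chart oV (@subIsetr _ _ _) (conj Up xp).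
pose g := chart_coord y \o chart_param x.
apply: (@near_eq_is_derive _ _ _ ((f \o chart_param y) \o g)).
  apply: filterS nV => v [[Uv _] _] /=.
  by rewrite coordK//; exact: Uy.
apply: chain_rule.
  by rewrite /g /= coordK.
by move=> j; apply: DeriveDef => //; exact: dy.
Qed.

Lemma pd_coord x p i k : chart_dom x p ->
  pd x k (fun q => chart_coord x q 0 i) p = (i == k)%:R.
Proof.
move=> xp.
have : is_derive (chart_coord x p) (ee k)
    ((fun q => chart_coord x q 0 i) \o chart_param x) (i == k)%:R.
  apply: (@near_eq_is_derive _ _ _ (fun v : 'rV[K]_n => v 0 i)).
    apply: filterS (near_chart (@dom_open _ _ _ x) (@subset_refl _ _) xp).
    by move=> v [_ /= ->].
  apply: is_derive_increment => e e0; exists 1 => // h _.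
  by rewrite !mxE eqxx/= [_ 0 i + _]addrC addrK subrr normr0 mulr_ge0// ltW.
by case.
Qed.

(** This is [pd_change] for the coordinate functions of [x] themselves. *)
Lemma jac_mul x y U p : open U -> U `<=` chart_dom x `&` chart_dom y -> U p ->
  (forall i, smooth_in y U (fun q => chart_coord x q 0 i)) ->
  (forall i, smooth_in x U (fun q => chart_coord y q 0 i)) ->
  jac x y p *m jac y x p = 1%:M.
Proof.
move=> oU Uxy Up sx sy.
have Ux : U `<=` chart_dom x by move=> q /Uxy[].
have Uy : U `<=` chart_dom y by move=> q /Uxy[].
apply/matrixP => i k; rewrite !mxE.
have [] := @pd_change x y U (fun q => chart_coord x q 0 i) p k oU Uy Up (Ux _ Up).
- by move=> q Uq; exact: smooth_pderivable (sx i) Uq.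
- by move=> j; exact: smooth_continuous (smooth_pd j (sx i)) Up.
- by move=> j; exact: smooth_pderivable (sy j) Up.
move=> _; rewrite -/(pd _ _ _ _) pd_coord; last exact: Ux.
by move=> ->; apply: eq_bigr => j _; rewrite !mxE.
Qed.

End ChartChange.

Section ManifoldCharts.
Context {K : numFieldType} (X : real_axis K) {n : nat} (M : manifold K n).
Implicit Types (x y : chart K n M) (p : M).

Lemma overlap_smooth x y i : atlas M x -> atlas M y ->
  smooth_in y (chart_dom x `&` chart_dom y) (fun q => chart_coord x q 0 i).
Proof. exact: atlas_smooth. Qed.

Lemma overlap_open x y : open (chart_dom x `&` chart_dom y).
Proof. by apply: openI; exact: dom_open. Qed.

Lemma jacK x y p : atlas M x -> atlas M y -> chart_dom x p -> chart_dom y p ->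
  jac x y p *m jac y x p = 1%:M.
Proof.
move=> ax ay xp yp.
apply: (jac_mul X (overlap_open x y) (@subset_refl _ _) (conj xp yp)) => i.
  exact: overlap_smooth.
by rewrite setIC; exact: overlap_smooth.
Qed.

(** The potential is built in one chart on a coordinate ball. In any other
    chart its differential is again the form, by [pd_change] and the
    transformation law of 1-forms; since the form is smooth, so is the
    potential. *)
Lemma closed_1form_locally_exact (th : chart K n M -> M -> 'cV[K]_n) :
  closed_1form th -> locally_exact_1form th.
Proof.
move=> [[sth tth] cth]; split=> // p0.
have [x ax xp0] := atlas_cover p0.
have ox := @dom_open _ _ _ x; have xx := @subset_refl _ (chart_dom x).
pose b := chart_coord x p0.
have [r r0 rP] := (@nbhs_closed_ball K 'rV[K]_n _ _).1 (near_chart ox xx xp0).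
have onball w : `|w - b| <= r ->
    chart_dom x (chart_param x w) /\ chart_coord x (chart_param x w) = w.
  exact: rP.
pose th' j : 'rV[K]_n -> K := (fun q => th x q j 0) \o chart_param x.
have th'1 w i : `|w - b| <= r -> C1_at (th' i) w.
  move=> /onball[xw wE]; rewrite -wE; apply: (chart_C1 ox xx xw).
    by move=> q xq; exact: smooth_pderivable (sth x i ax) xq.
  by move=> j; exact: smooth_continuous (smooth_pd j (sth x i ax)) xw.
have th'C w i j : `|w - b| <= r ->
    'D_(delta_mx 0 i : 'rV[K]_n) (th' j) w = 'D_(delta_mx 0 j : 'rV[K]_n) (th' i) w.
  by move=> /onball[xw wE]; have := cth x _ i j ax xw; rewrite /pd wE.
have [tau' tauP] := closed_form_primitive X th'1 th'C.
pose U : set M := chart_dom x `&` (chart_coord x @^-1` [set w | `|w - b| < r]).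
have oB : open [set w : 'rV[K]_n | `|w - b| < r].
  have -> : [set w : 'rV[K]_n | `|w - b| < r] = ball b r.
    by rewrite -ball_normE; apply/seteqP; split=> w /=; rewrite distrC.
  exact: ball_open.
have oU : open U.
  rewrite /U openE => q [xq Bq]; apply: filterI.
    exact: (open_nbhs_nbhs (conj ox xq)).
  exact: (coord_continuous_at xq (open_nbhs_nbhs (conj oB Bq))).
have Ux : U `<=` chart_dom x by move=> q [].
have Up0 : U p0 by split=> //=; rewrite subrr normr0.
pose tau : M -> K := tau' \o chart_coord x.
have tau_x q : U q -> forall i,
    is_derive (chart_coord x q) (delta_mx 0 i : 'rV[K]_n) (tau \o chart_param x) (th x q i 0).
  move=> [xq Bq] i.
  apply: (@near_eq_is_derive _ _ _ tau').
    apply: filterS (near_chart ox xx xq) => v [_ vE].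
    by rewrite /tau /= vE.
  by have := tauP _ i Bq; rewrite /th' /= coordK.
have tau_d q : U q -> pderivable x tau q by move=> Uq i; case: (tau_x q Uq i).
have tau_pd i : {in U, pd x i tau =1 fun q => th x q i 0}.
  by move=> q /set_mem Uq; rewrite /pd; case: (tau_x q Uq i).
have tau_c q i : U q -> {for q, continuous (pd x i tau)}.
  move=> Uq; apply: near_eq_continuous (smooth_continuous (sth x i ax) (Ux _ Uq)).
  by apply: filterS (open_nbhs_nbhs (conj oU Uq)) => q' Uq'; rewrite tau_pd//; exact/mem_set.
have tau_y y q : atlas M y -> chart_dom y q -> U q -> forall i,
    is_derive (chart_coord y q) (delta_mx 0 i : 'rV[K]_n) (tau \o chart_param y) (th y q i 0).
  move=> ay yq Uq i; have xq := Ux _ Uq.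
  have := pd_change X i oU Ux Uq yq tau_d (tau_c q ^~ Uq).
  have sy j : pderivable y (fun q => chart_coord x q 0 j) q.
    exact: smooth_pderivable (overlap_smooth j ax ay) (conj xq yq).
  move=> /(_ sy); congr (is_derive _ _ _ _).
  rewrite (tth _ _ _ ay ax yq xq) mxE; apply: eq_bigr => j _.
  by rewrite !mxE tau_pd ?inE// mulrC.
exists U, tau; split=> //; split=> [y ay|y q ay yq Uq]; last first.
  by apply/colP => i; rewrite mxE /pd; case: (tau_y y q ay yq Uq i).
have oUy : open (U `&` chart_dom y) by apply: openI => //; exact: dom_open.
apply: smoothP => [q [Uq _]|q [Uq yq] i|i].
- apply/cvgrPdist_le => e e0.
  have [d d0 h] := total_deriv_continuous X
    (chart_total_deriv X oU Ux Uq tau_d (tau_c q ^~ Uq)) e0.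
  have /cvgrPdist_le/(_ d d0) cd := coord_continuous_at (Ux _ Uq).
  apply: filterS (filterI (open_nbhs_nbhs (conj oU Uq)) cd) => q' [Uq' qq'].
  have := h (chart_coord x q'); rewrite distrC => /(_ qq').
  by rewrite /= !coordK; [rewrite distrC|exact: Ux|exact: Ux].
- by case: (tau_y y q ay yq Uq i).
- apply: (@smooth_eq _ _ _ _ _ oUy (@subIsetr _ _ _) (fun q => th y q i 0)).
    by move=> q /set_mem[Uq yq]; rewrite /pd; case: (tau_y y q ay yq Uq i).
  by apply: smooth_sub (sth y i ay); exact: subIsetr.
Qed.

End ManifoldCharts.

(** * Christoffel symbols in matrix form *)

Section MatrixTools.
Context {K : numFieldType} {n : nat}.

Lemma addmx_entry a b (A B : 'M[K]_(a, b)) i j : (A + B) i j = A i j + B i j.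
Proof. by rewrite mxE. Qed.
Lemma oppmx_entry a b (A : 'M[K]_(a, b)) i j : (- A) i j = - A i j.
Proof. by rewrite mxE. Qed.
Lemma scalemx_entry a b c (A : 'M[K]_(a, b)) i j : (c *: A) i j = c * A i j.
Proof. by rewrite mxE. Qed.

Lemma zeromx_entry a b i j : (0 : 'M[K]_(a, b)) i j = 0.
Proof. by rewrite mxE. Qed.

Lemma trmxD a b (A B : 'M[K]_(a, b)) : (A + B)^T = A^T + B^T.
Proof. exact: linearD. Qed.
Lemma trmxN a b (A : 'M[K]_(a, b)) : (- A)^T = - A^T.
Proof. exact: linearN. Qed.

(** With [C_s] multiplication by [d_s] this is multiplication by the vector
    [v]; with [C_s] a derivative in direction [s] it is the derivative along
    [v]. *)
Definition contr {a b} (C : 'I_n -> 'M[K]_(a, b)) (v : 'cV[K]_n) : 'M[K]_(a, b) :=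
  \sum_s v s 0 *: C s.

Lemma contr_entry a b (C : 'I_n -> 'M[K]_(a, b)) v i j :
  contr C v i j = \sum_s v s 0 * C s i j.
Proof. by rewrite /contr summxE; apply: eq_bigr => s _; rewrite mxE. Qed.

Lemma eq_contr a b (C C' : 'I_n -> 'M[K]_(a, b)) v :
  (forall s, C s = C' s) -> contr C v = contr C' v.
Proof. by move=> CC; apply: eq_bigr => s _; rewrite CC. Qed.

Lemma contrDl a b (C C' : 'I_n -> 'M[K]_(a, b)) v :
  contr (fun s => C s + C' s) v = contr C v + contr C' v.
Proof. by rewrite /contr -big_split; apply: eq_bigr => s _; rewrite scalerDr. Qed.

Lemma contrNl a b (C : 'I_n -> 'M[K]_(a, b)) v :
  contr (fun s => - C s) v = - contr C v.
Proof. by rewrite /contr -sumrN; apply: eq_bigr => s _; rewrite scalerN. Qed.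

Lemma contrD a b (C : 'I_n -> 'M[K]_(a, b)) u v :
  contr C (u + v) = contr C u + contr C v.
Proof. by rewrite /contr -big_split; apply: eq_bigr => s _; rewrite mxE scalerDl. Qed.

Lemma contrN a b (C : 'I_n -> 'M[K]_(a, b)) v : contr C (- v) = - contr C v.
Proof. by rewrite /contr -sumrN; apply: eq_bigr => s _; rewrite mxE scaleNr. Qed.

Lemma contr_delta a b (C : 'I_n -> 'M[K]_(a, b)) i : contr C (delta_mx i 0) = C i.
Proof.
rewrite /contr (bigD1 i)//= mxE !eqxx scale1r big1 ?addr0// => j ji.
by rewrite mxE (negbTE ji) scale0r.
Qed.

Lemma contr_mull a b c (B : 'M[K]_(c, a)) (C : 'I_n -> 'M[K]_(a, b)) v :
  B *m contr C v = contr (fun s => B *m C s) v.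
Proof. by rewrite mulmx_sumr; apply: eq_bigr => s _; rewrite scalemxAr. Qed.

Lemma contr_mulr a b c (B : 'M[K]_(b, c)) (C : 'I_n -> 'M[K]_(a, b)) v :
  contr C v *m B = contr (fun s => C s *m B) v.
Proof. by rewrite mulmx_suml; apply: eq_bigr => s _; rewrite scalemxAl. Qed.

Lemma contr_tr a b (C : 'I_n -> 'M[K]_(a, b)) v :
  (contr C v)^T = contr (fun s => (C s)^T) v.
Proof. by rewrite raddf_sum; apply: eq_bigr => s _; rewrite /= linearZ. Qed.

Lemma contr_sym a (C : 'I_n -> 'M[K]_(a, n)) :
  (forall i j k, C i k j = C j k i) ->
  forall u v, contr C u *m v = contr C v *m u.
Proof.
move=> sC u v; rewrite !contr_mulr; apply/colP => k.
rewrite !contr_entry.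
under eq_bigr do rewrite mxE mulr_sumr.
under [RHS]eq_bigr do rewrite mxE mulr_sumr.
rewrite exchange_big; apply: eq_bigr => i _; apply: eq_bigr => j _.
by rewrite sC; ring.
Qed.

Lemma col_ext a (A B : 'M[K]_(a, n)) :
  (forall j : 'I_n, A *m delta_mx j (0 : 'I_1) = B *m delta_mx j 0) -> A = B.
Proof.
move=> h; apply/matrixP => i j; have := h j; rewrite -!colE.
by move=> /colP/(_ i); rewrite !mxE.
Qed.

End MatrixTools.

Ltac mxdist := rewrite ?(mulmxDl, mulmxDr, mulmxBl, mulmxBr, mulNmx, mulmxN,
  mulmxA, mulmx1, mul1mx, mulmx0, mul0mx).
Ltac mxabel := let i := fresh "i" in let j := fresh "j" in
  apply/matrixP => i j; rewrite ?(addmx_entry, oppmx_entry, scalemx_entry, zeromx_entry); ring.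

Section FirstKind.
Context {K : numFieldType} {n : nat} (Dg : 'I_n -> 'M[K]_n).

(** Twice the Christoffel symbols of the first kind, from the derivatives [Dg
    i] of the metric. *)
Definition first_kind (i : 'I_n) : 'M[K]_n :=
  \matrix_(l, j) (Dg i l j + Dg j i l - Dg l i j).

Hypothesis Dg_sym : forall i, (Dg i)^T = Dg i.

Let sD r a b : Dg r a b = Dg r b a.
Proof. by rewrite -{1}Dg_sym mxE. Qed.

Lemma first_kind_sym i l j : first_kind i l j = first_kind j l i.
Proof. by rewrite !mxE (sD i l j) (sD j l i) (sD l i j); ring. Qed.

Lemma first_kind_compat i : (first_kind i)^T + first_kind i = 2 *: Dg i.
Proof.
by apply/matrixP => l j; rewrite !mxE (sD i j l); ring.
Qed.

End FirstKind.

(** The usual three-term cancellation; [N i] are the lowered symbols of a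
    symmetric connection that preserves the metric. *)
Lemma first_kind_unique (K : numFieldType) n (Dg N : 'I_n -> 'M[K]_n) :
  (forall i, Dg i = (N i)^T + N i) -> (forall i l j, N i l j = N j l i) ->
  forall i, first_kind Dg i = 2 *: N i.
Proof.
move=> DN sN i; apply/matrixP => l j; rewrite !mxE !DN !mxE.
by rewrite (sN i j l) (sN j l i) (sN j i l); ring.
Qed.

Section Christoffel.
Context {K : numFieldType} {n : nat} {T : topologicalType} (x : chart K n T).

(** Row [k], column [j] holds Gamma_{i j}^k, so that the covariant derivative
    of a vector field [Y] is [d_i Y] plus this matrix times [Y]. *)
Definition christoffel_mx (g : T -> 'M[K]_n) (i : 'I_n) (p : T) : 'M[K]_n :=
  \matrix_(k, j) christoffel x g k i j p.

Lemma christoffel_mxE (g : T -> 'M[K]_n) i p : christoffel_mx g i p =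
  2^-1 *: (invmx (g p) *m first_kind (fun r => dmx x r g p) i).
Proof.
apply/matrixP => k j; rewrite [LHS]mxE scalemx_entry [(_ *m _) k j]mxE /christoffel.
congr (_ * _); apply: eq_bigr => l _.
by rewrite [first_kind _ _ _ _]mxE !dmx_entry.
Qed.

Lemma christoffel_mx_sym (g : T -> 'M[K]_n) p :
  (forall i, (dmx x i g p)^T = dmx x i g p) ->
  forall i j k, christoffel_mx g i p k j = christoffel_mx g j p k i.
Proof.
move=> sg i j k; rewrite !christoffel_mxE !scalemx_entry; congr (_ * _).
rewrite [LHS]mxE [RHS]mxE; apply: eq_bigr => l _.
by rewrite (first_kind_sym sg).
Qed.

Lemma christoffel_mx_compat (g : T -> 'M[K]_n) p : g p \in unitmx ->
  (g p)^T = g p -> (forall i, (dmx x i g p)^T = dmx x i g p) ->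
  forall i, dmx x i g p =
    (christoffel_mx g i p)^T *m g p + g p *m christoffel_mx g i p.
Proof.
move=> ug sg sdg i.
have gG : g p *m christoffel_mx g i p = 2^-1 *: first_kind (fun r => dmx x r g p) i.
  by rewrite christoffel_mxE -scalemxAr mulmxA mulmxV// mul1mx.
have -> : (christoffel_mx g i p)^T *m g p = (g p *m christoffel_mx g i p)^T.
  by rewrite trmx_mul sg.
rewrite gG linearZ -scalerDr (first_kind_compat sdg) scalerA mulVf ?scale1r//.
Qed.

(** A symmetric connection that preserves the metric is the Levi-Civita
    connection. *)
Lemma christoffel_mx_unique (g : T -> 'M[K]_n) (G : 'I_n -> 'M[K]_n) p :
  g p \in unitmx -> (g p)^T = g p ->
  (forall i, dmx x i g p = (G i)^T *m g p + g p *m G i) ->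
  (forall i j k, G i k j = G j k i) ->
  forall i, christoffel_mx g i p = G i.
Proof.
move=> ug sg dg sG i.
have dN r : dmx x r g p = (g p *m G r)^T + g p *m G r.
  by rewrite dg trmx_mul sg.
have sN a l b : (g p *m G a) l b = (g p *m G b) l a.
  by rewrite !mxE; apply: eq_bigr => k _; rewrite sG.
rewrite christoffel_mxE (first_kind_unique dN sN) -scalemxAr scalerA mulVf.
  by rewrite scale1r mulKmx.
by rewrite pnatr_eq0.
Qed.

Lemma smooth_christoffel_mx U (g : T -> 'M[K]_n) i : open U ->
  U `<=` chart_dom x -> (forall p, U p -> g p \in unitmx) -> smoothmx x U g ->
  smoothmx x U (christoffel_mx g i).
Proof.
move=> oU Ux ug sg k j.
apply: (smooth_eq oU Ux (f := christoffel x g k i j)).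
  by move=> q _; rewrite mxE.
apply: (smoothM oU Ux); first exact: smooth_cst.
apply: smooth_sum => // l; apply: smoothM => //; first exact: smoothmxV.
apply: smoothD => //; last first.
  by apply: smoothN => //; apply: smooth_pd; exact: sg.
by apply: smoothD => //; apply: smooth_pd; exact: sg.
Qed.

End Christoffel.

(** * The structure of a Frobenius manifold in a chart *)

Local Opaque dmx pd.

(** Column [s] is the derivative of [Y] in direction [s]; hence [vjac Y]
    applied to [v] is the derivative of [Y] along [v]. *)
Definition vjac {K : numFieldType} {n : nat} {T : topologicalType}
    (x : chart K n T) (Y : T -> 'cV[K]_n) (p : T) : 'M[K]_n :=
  \matrix_(k, s) dmx x s Y p k 0.

Section LocalGeometry.
Context {K : numFieldType} {n : nat} {M : manifold K n} {d : K}.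
Variable F : frobenius_manifold M d.
Variable x : chart K n M.
Hypothesis ax : atlas M x.
Local Notation D := (chart_dom x).
Implicit Types (p : M).

Local Notation eta := (fm_metric F x).
Local Notation h := (cometric F x).
Local Notation e := (fm_unit F x).
Local Notation E := (fm_euler F x).

(** Multiplication by the coordinate field [d_i] as a matrix on columns. *)
Definition fmult (i : 'I_n) p : 'M[K]_n := \matrix_(k, j) fm_prod F x p k i j.
Definition fgamma (i : 'I_n) p : 'M[K]_n := christoffel_mx x eta i p.
(** The endomorphism nabla E. It is written with the Christoffel matrix
    contracted with [E], using symmetry of the symbols ([grad_eulerE]). *)
Definition grad_euler p : 'M[K]_n :=
  vjac x E p + contr (fgamma ^~ p) (E p).
(** The shift makes this endomorphism and its adjoint add up to the identity.
    When it is diagonal in flat coordinates, its entries are the coefficients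
    in the known formula for the contravariant Christoffel symbols of the
    intersection form. *)
Definition spectral p : 'M[K]_n := grad_euler p + ((d - 1) / 2)%:M.
Definition euler_mult p : 'M[K]_n := contr (fmult ^~ p) (E p).



Local Notation C := fmult.
Local Notation Gam := fgamma.


Local Notation P := (vjac x E).
Local Notation U := grad_euler.
Local Notation W := spectral.
Local Notation A := euler_mult.
Local Notation dd i := (dmx x i).

Let oD : open D. Proof. exact: dom_open. Qed.
Let DD : D `<=` chart_dom x. Proof. exact: subset_refl. Qed.

Lemma fmult_entry i p k j : C i p k j = fm_prod F x p k i j.
Proof. by rewrite [LHS]mxE. Qed.

Lemma alg_mulE p u v : alg_mul (fm_prod F x p) u v = contr (C ^~ p) u *m v.
Proof.
apply/colP => k; rewrite [LHS]mxE /form_val [LHS]mxE [RHS]mxE.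
apply: eq_bigr => j _; congr (_ * _); rewrite contr_entry [LHS]mxE.
by apply: eq_bigr => i _; rewrite [_^T _ _]mxE fmult_entry.
Qed.

Section AtPoint.
Variable p : M.
Hypothesis xp : D p.

Let falg := tangent_algebra F ax xp.

Lemma form_valE (B : 'M[K]_n) i j : form_val B (delta_mx i 0) (delta_mx j 0) = B i j.
Proof. by rewrite /form_val trmx_delta -rowE -colE !mxE. Qed.

Lemma fmetric_sym : (eta p)^T = eta p.
Proof.
apply/matrixP => i j; rewrite [LHS]mxE -!form_valE.
exact: (falg_sym falg).
Qed.

Lemma fmetric_unit : eta p \in unitmx.
Proof.
rewrite -row_free_unit; apply/row_freeP.
suff : kermx (eta p) == 0 by rewrite kermx_eq0 => /row_freeP.
apply/eqP/row_matrixP => i; rewrite row0.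
have k0 : row i (kermx (eta p)) *m eta p = 0.
  by apply/sub_kermxP; exact: row_sub.
apply: trmx_inj; rewrite trmx0; apply: (falg_nondeg falg) => v.
by rewrite /form_val trmxK k0 mul0mx mxE.
Qed.

Lemma fcometric_unit : h p \in unitmx.
Proof. by rewrite unitmx_inv fmetric_unit. Qed.

Lemma fcometric_sym : (h p)^T = h p.
Proof. by rewrite /cometric trmx_inv fmetric_sym. Qed.

Lemma metricK : h p *m eta p = 1%:M.
Proof. exact/mulVmx/fmetric_unit. Qed.

Lemma metricVK : eta p *m h p = 1%:M.
Proof. exact/mulmxV/fmetric_unit. Qed.

Lemma contr_multE i : contr (C ^~ p) (delta_mx i 0) = C i p.
Proof. exact: contr_delta. Qed.

Lemma mult_sym i j k : C i p k j = C j p k i.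
Proof.
have := falg_comm falg (delta_mx i 0) (delta_mx j 0); rewrite !alg_mulE !contr_multE.
by rewrite -!colE => /colP/(_ k); rewrite !mxE.
Qed.

Lemma mult_contr_sym u v : contr (C ^~ p) u *m v = contr (C ^~ p) v *m u.
Proof. exact: contr_sym mult_sym u v. Qed.

Lemma mult_comm u v :
  contr (C ^~ p) u *m contr (C ^~ p) v = contr (C ^~ p) v *m contr (C ^~ p) u.
Proof.
apply: col_ext => j; set w := delta_mx j 0.
have aE := falg_assoc falg; have cE := falg_comm falg.
rewrite -!mulmxA -!alg_mulE.
by rewrite -aE (cE u) aE.
Qed.

Lemma mult_unit : contr (C ^~ p) (e p) = 1%:M.
Proof. by apply: col_ext => j; rewrite -alg_mulE (falg_unit falg) mul1mx. Qed.

Lemma form_val_mul (B R S : 'M[K]_n) i j :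
  form_val B (R *m delta_mx i 0) (S *m delta_mx j 0) = (R^T *m B *m S) i j.
Proof. by rewrite -[RHS]form_valE /form_val trmx_mul !mulmxA. Qed.

(** Invariance of the metric: multiplication operators are self-adjoint. *)
Lemma mult_adjoint v :
  (contr (C ^~ p) v)^T *m eta p = eta p *m contr (C ^~ p) v.
Proof.
apply/matrixP => i j.
have := falg_inv falg (delta_mx i 0) v (delta_mx j 0).
rewrite (falg_comm falg _ v) !alg_mulE -(mul1mx (delta_mx j 0)) form_val_mul.
by rewrite mulmx1 mul1mx -(mul1mx (delta_mx i 0)) form_val_mul trmx1 mul1mx.
Qed.

End AtPoint.

Lemma smooth_fmetric : smoothmx x D eta.
Proof. by move=> i j; exact: (metric_tensor F).1. Qed.

Lemma smooth_fcometric : smoothmx x D h.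
Proof. exact: (smoothmxV oD DD fmetric_unit smooth_fmetric). Qed.

Lemma smooth_fmult i : smoothmx x D (C i).
Proof.
move=> k j; apply: (smooth_eq oD DD) ((prod_tensor F).1 x i j k ax) => q _.
by rewrite mxE.
Qed.

Lemma smooth_funit : smoothmx x D e.
Proof. by move=> i j; rewrite (ord1 j); exact: (unit_tensor F).1. Qed.

Lemma smooth_feuler : smoothmx x D E.
Proof. by move=> i j; rewrite (ord1 j); exact: (euler_tensor F).1. Qed.

Lemma smooth_fgamma i : smoothmx x D (Gam i).
Proof. exact: (smooth_christoffel_mx i oD DD fmetric_unit smooth_fmetric). Qed.

Lemma smooth_contr a b (B : 'I_n -> M -> 'M[K]_(a, b)) (Y : M -> 'cV[K]_n) :
  (forall i, smoothmx x D (B i)) -> smoothmx x D Y ->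
  smoothmx x D (fun q => contr (B ^~ q) (Y q)).
Proof.
move=> sB sY; apply: (smoothmx_sum oD DD) => s.
exact: smoothmxZ oD DD _ _ _ _ (sY s 0) (sB s).
Qed.

Lemma smooth_euler_mult : smoothmx x D A.
Proof. exact: smooth_contr smooth_fmult smooth_feuler. Qed.

Lemma smooth_grad_euler : smoothmx x D U.
Proof.
apply: (smoothmxD oD DD); last exact: smooth_contr smooth_fgamma smooth_feuler.
move=> k s; apply: (smooth_eq oD DD) (smooth_pd s (smooth_feuler k 0)) => q _.
by rewrite [RHS]mxE dmx_entry.
Qed.

Lemma smooth_spectral : smoothmx x D W.
Proof.
by apply: (smoothmxD oD DD smooth_grad_euler); exact: smoothmx_cst.
Qed.

Lemma dmx_contr i a b (B : 'I_n -> M -> 'M[K]_(a, b)) (Y : M -> 'cV[K]_n) p :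
  (forall i, smoothmx x D (B i)) -> smoothmx x D Y -> D p ->
  dd i (fun q => contr (B ^~ q) (Y q)) p =
  contr (B ^~ p) (dd i Y p) + contr (fun s => dd i (B s) p) (Y p).
Proof.
move=> sB sY xp; rewrite [LHS]dmx_sum; last first.
  move=> s; apply: (smooth_pderivmx (U := D)) => //.
  exact: smoothmxZ oD DD _ _ _ _ (sY s 0) (sB s).
rewrite -big_split; apply: eq_bigr => s _ /=.
rewrite dmxZ//; [|exact: smooth_pderivable (sY s 0) xp|exact: smooth_pderivmx (sB s) xp].
by rewrite dmx_entry.
Qed.

Lemma fgamma_entry i p k m : Gam i p k m = christoffel x eta k i m p.
Proof. by rewrite [LHS]mxE. Qed.

Local Opaque fgamma fmult.

Section Derivatives.
Variable p : M.
Hypothesis xp : D p.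

Lemma dmetric_sym i : (dd i eta p)^T = dd i eta p.
Proof.
rewrite -dmxT; apply: (dmx_eq i oD DD xp) => q /set_mem xq.
by rewrite fmetric_sym.
Qed.

Lemma gamma_sym i j k : Gam i p k j = Gam j p k i.
Proof. exact: christoffel_mx_sym dmetric_sym i j k. Qed.

Lemma dmetric i : dd i eta p = (Gam i p)^T *m eta p + eta p *m Gam i p.
Proof.
exact: christoffel_mx_compat (fmetric_unit xp) (fmetric_sym xp) dmetric_sym i.
Qed.

Lemma dcometric i : dd i h p = - (Gam i p *m h p + h p *m (Gam i p)^T).
Proof.
rewrite [LHS](dmxV oD DD i fmetric_unit smooth_fmetric xp) dmetric.
rewrite mulmxDr mulmxDl; congr (- _); rewrite addrC -!mulmxA; congr (_ + _).
  by rewrite mulKmx// fmetric_unit.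
by rewrite metricVK// mulmx1.
Qed.

Lemma dunit i : dd i e p = - (Gam i p *m e p).
Proof.
apply/eqP; rewrite -addr_eq0; apply/eqP/colP => k.
rewrite [RHS]mxE -[RHS](unit_parallel F i k ax xp) addmx_entry /nabla_vec.
rewrite dmx_entry; congr (_ + _); rewrite [LHS]mxE.
by apply: eq_bigr => m _; rewrite [Gam _ _ _ _]mxE.
Qed.

End Derivatives.

Lemma grad_eulerE p k j : D p -> U p k j = nabla_vec x eta E j k p.
Proof.
move=> xp; rewrite addmx_entry /nabla_vec [vjac _ _ _ _ _]mxE dmx_entry.
congr (_ + _); rewrite contr_entry; apply: eq_bigr => m _.
by rewrite mulrC (gamma_sym xp) fgamma_entry.
Qed.

Section SecondDerivatives.
Variable p : M.
Hypothesis xp : D p.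

Lemma grad_euler_parallel i : dd i U p = U p *m Gam i p - Gam i p *m U p.
Proof.
apply/eqP; rewrite -subr_eq0; apply/eqP/matrixP => k j.
rewrite [RHS]mxE -[RHS](nabla2_euler F i j k ax xp) /nabla2_vec.
rewrite !(addmx_entry, oppmx_entry) opprB addrA addrAC; congr (_ + _); last first.
  rewrite [LHS]mxE; apply: eq_bigr => m _; rewrite fgamma_entry.
  by rewrite grad_eulerE.
congr (_ - _).
  rewrite dmx_entry; apply: (pd_eq i oD DD xp) => q /set_mem xq.
  exact: grad_eulerE.
rewrite [LHS]mxE; apply: eq_bigr => m _; rewrite fgamma_entry.
by rewrite grad_eulerE// mulrC.
Qed.

Lemma metric_flatE i j :
  dd i (Gam j) p - dd j (Gam i) p + (Gam i p *m Gam j p - Gam j p *m Gam i p) = 0.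
Proof.
apply/matrixP => k l; rewrite [RHS]mxE -[RHS](metric_flat F k l i j ax xp) /riemann.
rewrite !(addmx_entry, oppmx_entry).
have dg a b : dd a (Gam b) p k l = pd x a (christoffel x eta k b l) p.
  rewrite dmx_entry; apply: (pd_eq a oD DD xp) => q _; exact: fgamma_entry.
rewrite [(_ *m _) k l]mxE [(Gam j p *m _) k l]mxE -sumrB.
congr (_ - _ + _); [exact: dg | exact: dg | apply: eq_bigr => m _].
by rewrite (fgamma_entry i) (fgamma_entry j) (fgamma_entry j) (fgamma_entry i).
Qed.

(** Lower an index: since the metric is parallel, nabla_l c_{ijk} is the
    matrix of [D_l C_i] lowered by the metric, up to the term Gamma_{l i}^m
    c_{m j k}, which is symmetric in [l] and [i]. *)
Lemma fmult_codazzi i j :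
  dd i (C j) p + (Gam i p *m C j p - C j p *m Gam i p) =
  dd j (C i) p + (Gam j p *m C i p - C i p *m Gam j p).
Proof.
have lowE l q a b : D q ->
    lowered_product (fm_prod F x) eta l a b q = ((C l q)^T *m eta q) a b.
  by move=> xq; rewrite [RHS]mxE; apply: eq_bigr => m _; rewrite [_^T _ _]mxE fmult_entry.
(* The covariant derivative of the lowered product, as matrices in the last
   two indices. *)
pose N0 l i := dd l (fun q => (C i q)^T *m eta q) p
  - \sum_m Gam l p m i *: ((C m p)^T *m eta p)
  - (Gam l p)^T *m ((C i p)^T *m eta p) - (C i p)^T *m eta p *m Gam l p.
have [N ND] : exists N, forall l i, N l i = N0 l i by exists N0.
have NE l i' a b : N l i' a b =
    nabla_form3 x eta (lowered_product (fm_prod F x) eta) l i' a b p.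
  rewrite ND /N0 /nabla_form3 !(addmx_entry, oppmx_entry); congr (_ - _ - _ - _).
  - rewrite dmx_entry; apply: (pd_eq l oD DD xp) => q /set_mem xq.
    by rewrite lowE.
  - rewrite summxE; apply: eq_bigr => m _.
    by rewrite scalemx_entry fgamma_entry lowE.
  - rewrite [LHS]mxE; apply: eq_bigr => m _.
    by rewrite [_^T _ _]mxE fgamma_entry lowE.
  - rewrite [LHS]mxE; apply: eq_bigr => m _.
    by rewrite fgamma_entry lowE// mulrC.
have NS : N i j = N j i.
  apply/matrixP => a b; rewrite (NE i j) (NE j i).
  by have [] := nabla_c_symmetric F i j a b ax xp.
have dlow l i' : dd l (fun q => (C i' q)^T *m eta q) p =
    (dd l (C i') p)^T *m eta p +
    (C i' p)^T *m ((Gam l p)^T *m eta p + eta p *m Gam l p).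
  have dCT : pderivmx x (fun q => (C i' q)^T) p.
    exact: smooth_pderivmx (smoothmxT oD DD (smooth_fmult i')) xp.
  by rewrite (dmxM l xp dCT (smooth_pderivmx smooth_fmetric xp)) dmxT dmetric.
have NF l i' : N l i' = (dd l (C i') p + (Gam l p *m C i' p - C i' p *m Gam l p))^T *m eta p
    - \sum_m Gam l p m i' *: ((C m p)^T *m eta p).
  rewrite ND /N0 dlow trmxD (trmxD (_ *m _)) trmxN !trmx_mul.
  move: (\sum_m _) (dd l _ _) => S B.
  move: (Gam l p) (C i' p) (eta p) => G B' H; mxdist; mxabel.
have sumS : \sum_m Gam i p m j *: ((C m p)^T *m eta p) =
            \sum_m Gam j p m i *: ((C m p)^T *m eta p).
  by apply: eq_bigr => m _; rewrite gamma_sym.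
move: NS; rewrite (NF i j) (NF j i) sumS => /addIr.
by move=> /(can_inj (mulmxK (fmetric_unit xp)))/trmx_inj.
Qed.

End SecondDerivatives.
End LocalGeometry.

(** * The Euler vector field *)

Local Opaque dmx pd.

Section VectorFields.
Context {K : numFieldType} {n : nat} {T : topologicalType} (x : chart K n T).

Lemma vjac_mul (Y : T -> 'cV[K]_n) p (v : 'cV[K]_n) :
  vjac x Y p *m v = contr (fun s => dmx x s Y p) v.
Proof.
apply/colP => k; rewrite [LHS]mxE contr_entry; apply: eq_bigr => s _.
by rewrite [vjac _ _ _ _ _]mxE mulrC.
Qed.

Lemma vjac_col (Y : T -> 'cV[K]_n) p i :
  dmx x i Y p = vjac x Y p *m delta_mx i 0.
Proof. by rewrite vjac_mul contr_delta. Qed.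

Lemma lie_bracketE (Y Z : T -> 'cV[K]_n) p : lie_bracket x Y Z p =
  contr (fun s => dmx x s Z p) (Y p) - vjac x Y p *m Z p.
Proof.
rewrite vjac_mul; apply/colP => k.
rewrite [LHS]mxE addmx_entry oppmx_entry !contr_entry -sumrB.
by apply: eq_bigr => s _; rewrite !dmx_entry.
Qed.

Lemma lie_contraE (Y : T -> 'cV[K]_n) (g : T -> 'M[K]_n) p : lie_contra x Y g p =
  contr (fun s => dmx x s g p) (Y p) - vjac x Y p *m g p - g p *m (vjac x Y p)^T.
Proof.
apply/matrixP => i j.
rewrite [LHS]mxE !(addmx_entry, oppmx_entry) contr_entry.
rewrite [(vjac _ _ _ *m _) i j]mxE [(_ *m (vjac _ _ _)^T) i j]mxE -!sumrB.
apply: eq_bigr => s _; rewrite [_^T _ _]mxE.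
rewrite [vjac _ _ _ i s]mxE [vjac _ _ _ j s]mxE !dmx_entry.
by congr (_ - _ - _); rewrite mulrC.
Qed.

End VectorFields.

Section EulerField.
Context {K : numFieldType} {n : nat} {M : manifold K n} {d : K}.
Variable F : frobenius_manifold M d.
Variable x : chart K n M.
Hypothesis ax : atlas M x.
Local Notation D := (chart_dom x).
Local Notation eta := (fm_metric F x).
Local Notation h := (cometric F x).
Local Notation e := (fm_unit F x).
Local Notation E := (fm_euler F x).
Local Notation C := (fmult F x).
Local Notation Gam := (fgamma F x).
Local Notation P := (vjac x E).
Local Notation U := (grad_euler F x).
Local Notation W := (spectral F x).
Local Notation A := (euler_mult F x).
Local Notation dd i := (dmx x i).
Let oD : open D. Proof. exact: dom_open. Qed.
Let DD : D `<=` chart_dom x. Proof. exact: subset_refl. Qed.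

Variable p : M.
Hypothesis xp : D p.

Lemma Qvect_const (u : 'cV[K]_n) : Qvect x E (fun=> u) p = u - P p *m u.
Proof.
rewrite /Qvect lie_bracketE /contr big1 ?add0r// => s _.
by rewrite dmx_cst scaler0.
Qed.

(** Apply the grading axiom to the constant fields [d_i] and [d_j] and read
    off the columns. *)
Lemma euler_lie_mult i : contr (fun s => dd s (C i) p) (E p) =
  C i p - contr (C ^~ p) (P p *m delta_mx i 0) + (P p *m C i p - C i p *m P p).
Proof.
apply: col_ext => j.
have := graded_product F (a := fun=> delta_mx i 0) (b := fun=> delta_mx j 0) ax xp
  (fun k => smooth_cst _ _ _) (fun k => smooth_cst _ _ _).
rewrite !Qvect_const !alg_mulE.
have -> : (fun q => alg_mul (fm_prod F x q) (delta_mx i 0) (delta_mx j 0)) =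
          (fun q => C i q *m delta_mx j 0).
  by apply/funext => q; rewrite alg_mulE contr_multE.
have dCj s : dd s (fun q => C i q *m delta_mx j (0 : 'I_1)) p = dd s (C i) p *m delta_mx j 0.
  have dC := smooth_pderivmx (smooth_fmult F ax i) xp.
  have dc := smooth_pderivmx (smoothmx_cst x D (delta_mx j 0 : 'cV[K]_n)) xp.
  by rewrite (dmxM s xp dC dc) dmx_cst mulmx0 addr0.
rewrite /Qvect lie_bracketE (eq_contr _ dCj) -contr_mulr contrD contrN contr_multE.
move: (contr (fun s => dd s (C i) p) (E p)) (contr _ (P p *m _)) => X Y.
move: (C i p) (P p) (delta_mx j 0) => Ci Pp v; mxdist => /(canRL (addKr _)).
move/(canRL (subrK _)) => ->; mxdist; mxabel.
Qed.

Lemma euler_lie_metric : contr (fun s => dd s eta p) (E p) =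
  (2 - d) *: eta p - (P p)^T *m eta p - eta p *m P p.
Proof.
apply/matrixP => i j.
have := graded_metric F (a := fun=> delta_mx i 0) (b := fun=> delta_mx j 0) ax xp
  (fun k => smooth_cst _ _ _) (fun k => smooth_cst _ _ _).
rewrite !Qvect_const.
have -> : act_on_function x E (fun q => form_val (eta q) (delta_mx i 0) (delta_mx j 0)) p =
    contr (fun s => dd s eta p) (E p) i j.
  rewrite contr_entry; apply: eq_bigr => s _; rewrite dmx_entry.
  by congr (_ * pd _ _ _ _); apply/funext => q; rewrite form_valE.
have dP k : delta_mx k (0 : 'I_1) - P p *m delta_mx k 0 = (1%:M - P p) *m delta_mx k 0.
  by rewrite mulmxBl mul1mx.
rewrite (dP i) (dP j).
have -> : form_val (eta p) (delta_mx i 0) ((1%:M - P p) *m delta_mx j 0) =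
    (1%:M^T *m eta p *m (1%:M - P p)) i j by rewrite -form_val_mul mul1mx.
have -> : form_val (eta p) ((1%:M - P p) *m delta_mx i 0) (delta_mx j 0) =
    ((1%:M - P p)^T *m eta p *m 1%:M) i j by rewrite -form_val_mul mul1mx.
rewrite form_valE => /(canRL (addrK _)) ->; rewrite trmxD trmxN trmx1; mxdist.
by rewrite !(addmx_entry, oppmx_entry, scalemx_entry); ring.
Qed.

Lemma contr_gamma_metric Y :
  contr (fun s => dd s eta p) Y =
  (contr (Gam ^~ p) Y)^T *m eta p + eta p *m contr (Gam ^~ p) Y.
Proof.
rewrite (eq_contr _ (dmetric F ax xp)) contrDl -contr_mull; congr (_ + _).
by rewrite -(contr_mulr (eta p) (fun s => (Gam s p)^T)) contr_tr.
Qed.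

Lemma contr_gamma_cometric Y :
  contr (fun s => dd s h p) Y =
  - (contr (Gam ^~ p) Y *m h p + h p *m (contr (Gam ^~ p) Y)^T).
Proof.
rewrite (eq_contr _ (dcometric F ax xp)) contrNl contrDl contr_tr; congr (- (_ + _)).
  by rewrite (contr_mulr (h p)).
by rewrite contr_mull.
Qed.

(** Homogeneity of the metric, with the ordinary derivatives of the metric
    expressed by Christoffel symbols. *)
Lemma grad_euler_adjoint : (U p)^T *m eta p + eta p *m U p = (2 - d) *: eta p.
Proof.
have := euler_lie_metric; rewrite contr_gamma_metric /grad_euler trmxD; mxdist.
move=> /eqP; rewrite -subr_eq0 => /eqP H; apply/eqP; rewrite -subr_eq0; apply/eqP.
by rewrite -[RHS]H; mxabel.
Qed.

(** In index-raised form: nabla E plus its adjoint is [2 - d], and the shift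
    contributes [d - 1]. *)
Lemma spectral_adjoint : h p *m (W p)^T + W p *m h p = h p.
Proof.
have H : h p *m (U p)^T + U p *m h p = (2 - d) *: h p.
  have := congr1 (fun X => h p *m X *m h p) grad_euler_adjoint.
  rewrite mulmxDr mulmxDl -scalemxAr -scalemxAl !mulmxA (metricK F ax xp) !mul1mx.
  by rewrite -!mulmxA (metricVK F ax xp) mulmx1.
rewrite /spectral trmxD tr_scalar_mx mulmxDr mulmxDl mul_scalar_mx mul_mx_scalar.
rewrite addrACA -scalerDl -splitr.
by rewrite H -scalerDl (_ : 2 - d + (d - 1) = 1) ?scale1r//; ring.
Qed.

Lemma spectral_comm (X : 'M[K]_n) : W p *m X - X *m W p = U p *m X - X *m U p.
Proof.
rewrite /spectral mulmxDl mulmxDr mul_scalar_mx mul_mx_scalar.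
by rewrite opprD addrACA subrr addr0.
Qed.

Lemma spectral_parallel i : dd i W p = W p *m Gam i p - Gam i p *m W p.
Proof.
rewrite spectral_comm -(grad_euler_parallel F ax xp).
have dc := smooth_pderivmx (smoothmx_cst x D (((d - 1) / 2)%:M : 'M[K]_n)) xp.
have dU := smooth_pderivmx (smooth_grad_euler F ax) xp.
by rewrite [LHS](dmxD i dU dc) dmx_cst addr0.
Qed.

(** The derivative of [E^s C_s] along [i] is rewritten by the symmetry
    [fmult_codazzi] as a derivative of [C_i] along [E], which homogeneity of
    the product determines. *)
Lemma deuler_mult i : dd i A p = C i p + (W p *m C i p - C i p *m W p)
  - (Gam i p *m A p - A p *m Gam i p).
Proof.
rewrite [LHS](dmx_contr i (smooth_fmult F ax) (smooth_feuler F ax) xp).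
rewrite vjac_col spectral_comm.
have cod s : dd i (C s) p = dd s (C i) p + (Gam s p *m C i p - C i p *m Gam s p)
    - (Gam i p *m C s p - C s p *m Gam i p).
  by rewrite -(fmult_codazzi F ax xp) addrK.
rewrite (eq_contr _ cod) !contrDl !contrNl !contrDl !contrNl euler_lie_mult.
have GC : contr (fun s => Gam s p *m C i p) (E p) =
    contr (Gam ^~ p) (E p) *m C i p by rewrite contr_mulr.
have CG : contr (fun s => C i p *m Gam s p) (E p) =
    C i p *m contr (Gam ^~ p) (E p) by rewrite contr_mull.
have GA : contr (fun s => Gam i p *m C s p) (E p) = Gam i p *m A p by rewrite contr_mull.
have AG : contr (fun s => C s p *m Gam i p) (E p) = A p *m Gam i p by rewrite contr_mulr.
rewrite GC CG GA AG /grad_euler.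
move: (C i p) (Gam i p) (A p) (P p) (contr (Gam ^~ p) (E p)) (contr (C ^~ p) _).
by move=> Ci Gi Ap Pp GE CP; mxdist; mxabel.
Qed.

Lemma euler_mult_unit : A p *m e p = E p.
Proof. by rewrite (mult_contr_sym F ax xp) (mult_unit F ax xp) mul1mx. Qed.

Lemma lie_bracket_eq (Y Y' Z Z' : M -> 'cV[K]_n) :
  {in D, Y =1 Y'} -> {in D, Z =1 Z'} -> lie_bracket x Y Z p = lie_bracket x Y' Z' p.
Proof.
move=> YY ZZ; have pD : p \in D by exact/mem_set.
apply/colP => k; rewrite !mxE; apply: eq_bigr => s _; rewrite YY// ZZ//.
congr (_ * _ - _ * _); apply: (pd_eq s oD DD xp) => q Dq; first by rewrite ZZ.
by rewrite YY.
Qed.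

Lemma unit_idem q : D q -> alg_mul (fm_prod F x q) (e q) (e q) = e q.
Proof. by move=> xq; rewrite alg_mulE (mult_unit F ax xq) mul1mx. Qed.

(** The grading operator is a derivation of the product, so it annihilates the
    idempotent [e]: [e + [E, e] = 0], and nabla e = 0 turns the bracket into
    [- nabla_e E]. *)
Lemma grad_euler_unit : U p *m e p = e p.
Proof.
have se i : smooth_in x D (fun q => e q i 0) by exact: smooth_funit.
have Qee : Qvect x E (fun q => alg_mul (fm_prod F x q) (e q) (e q)) p = Qvect x E e p.
  rewrite /Qvect unit_idem//; congr (_ + _).
  by apply: lie_bracket_eq => // q /set_mem xq; rewrite unit_idem.
have := graded_product F ax xp se se; rewrite Qee.
rewrite !alg_mulE (mult_contr_sym F ax xp (Qvect _ _ _ _)) (mult_unit F ax xp) mul1mx.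
move=> /eqP; rewrite -subr_eq0 opprD addrA subrr sub0r oppr_eq0 => /eqP.
rewrite /Qvect lie_bracketE (eq_contr _ (dunit F ax xp)) contrNl -(contr_mulr (e p) (Gam ^~ p)).
move=> H; apply/esym/eqP; rewrite -subr_eq0 /grad_euler mulmxDl -[X in _ == X]H.
by rewrite [P p *m _ + _]addrC opprD.
Qed.

End EulerField.

(** * The Levi-Civita connection of the pencil *)

Local Opaque dmx pd.

(** The curvature of the connection [G - W C R], with every derivative already
    expressed by the commutation rules ([dW] and [dR] are the derivatives of
    [W] and of the resolvent [R]). What does not cancel formally is killed by
    flatness of [G], by the Codazzi symmetry, and because [C_j R C_i] is
    symmetric in [i] and [j]. *)
Lemma pencil_flat_algebra (K : numFieldType) n
    (W B R Gi Gj Ci Cj dGij dGji dCij dCji : 'M[K]_n) :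
  R *m B = 1%:M -> B *m R = 1%:M ->
  Ci *m Cj = Cj *m Ci -> Ci *m R = R *m Ci -> Cj *m R = R *m Cj ->
  dGij - dGji + (Gi *m Gj - Gj *m Gi) = 0 ->
  dCij + (Gi *m Cj - Cj *m Gi) = dCji + (Gj *m Ci - Ci *m Gj) ->
  let dW (G : 'M[K]_n) := W *m G - G *m W in
  let dR G c := - (R *m (c + (W *m c - c *m W) - (G *m B - B *m G)) *m R) in
  let gi := Gi - W *m Ci *m R in
  let gj := Gj - W *m Cj *m R in
  let dgij := dGij - (dW Gi *m Cj *m R + W *m dCij *m R + W *m Cj *m dR Gi Ci) in
  let dgji := dGji - (dW Gj *m Ci *m R + W *m dCji *m R + W *m Ci *m dR Gj Cj) in
  dgij - dgji + (gi *m gj - gj *m gi) = 0.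
Proof.
move=> RB BR CC CiR CjR flat cod /=.
have ddG : dGij = dGji - (Gi *m Gj - Gj *m Gi).
  by apply/eqP; rewrite -subr_eq0 opprB addrA addrAC -subr_eq0 -[X in _ == X]flat subr0.
have ddC : dCij = dCji + (Gj *m Ci - Ci *m Gj) - (Gi *m Cj - Cj *m Gi).
  by rewrite -cod addrK.
have RBG G c : R *m (c + (W *m c - c *m W) - (G *m B - B *m G)) *m R =
    R *m c *m R + R *m W *m c *m R - R *m c *m W *m R - R *m G + G *m R.
  mxdist; rewrite -(mulmxA _ B R) BR RB; mxdist.
  by move: (R *m c *m R) (R *m W *m c *m R) (R *m c *m W *m R) (R *m G) (G *m R)
    => a b c' d' e'; mxabel.
rewrite !RBG ddG ddC; mxdist.
have swap (Y Z : 'M[K]_n) : Y *m Cj *m R *m Ci *m Z = Y *m Ci *m R *m Cj *m Z.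
  rewrite -(mulmxA _ R Ci) -CiR mulmxA -(mulmxA Y Cj Ci) -CC mulmxA.
  by rewrite -(mulmxA _ Cj R) CjR mulmxA.
rewrite (swap W R) (swap W W); mxabel.
Qed.

Section PencilGeometry.
Context {K : numFieldType} {n : nat} {M : manifold K n} {d : K}.
Variable F : frobenius_manifold M d.
Variable x : chart K n M.
Hypothesis ax : atlas M x.
Variable lam : K.
Local Notation D := (chart_dom x).
Local Notation eta := (fm_metric F x).
Local Notation h := (cometric F x).
Local Notation E := (fm_euler F x).
Local Notation C := (fmult F x).
Local Notation Gam := (fgamma F x).
Local Notation W := (spectral F x).
Local Notation A := (euler_mult F x).
Local Notation dd i := (dmx x i).
Let oD : open D. Proof. exact: dom_open. Qed.
Let DD : D `<=` chart_dom x. Proof. exact: subset_refl. Qed.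

Lemma mult_cometric p : D p -> forall v,
  h p *m (contr (C ^~ p) v)^T = contr (C ^~ p) v *m h p.
Proof.
move=> xp v; have := congr1 (fun X => h p *m X *m h p) (mult_adjoint F ax xp v).
rewrite !mulmxA (metricK F ax xp) mul1mx -!mulmxA (metricVK F ax xp) mulmx1.
by [].
Qed.

Lemma fmult_cometric p : D p -> forall i, h p *m (C i p)^T = C i p *m h p.
Proof. by move=> xp i; rewrite -!(contr_multE F x p i); exact: mult_cometric. Qed.

(** Multiplication is self-adjoint, so contracting a product of 1-forms with
    [E] amounts to multiplying one of them by [E]. *)
Lemma intersection_formE p : D p -> intersection_form F x p = A p *m h p.
Proof.
move=> xp; rewrite -(mult_cometric xp); apply/matrixP => i j.
rewrite [LHS]mxE /form_mul alg_mulE.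
set v := h p *m _; set w := h p *m _.
have -> : (E p)^T *m (eta p *m (contr (C ^~ p) v *m w)) =
    (contr (C ^~ p) v *m E p)^T *m (eta p *m w).
  by rewrite trmx_mul -[RHS]mulmxA (mulmxA (contr _ v)^T (eta p)) (mult_adjoint F ax xp) !mulmxA.
rewrite (mult_contr_sym F ax xp) /w (mulmxA (eta p)) (metricVK F ax xp) mul1mx.
rewrite trmx_mul /v trmx_mul (fcometric_sym F ax xp) trmx_delta -!mulmxA mulmxA.
by rewrite mulmxA -!mulmxA -rowE !mulmxA -colE !mxE.
Qed.

Definition pencil_op p : 'M[K]_n := A p - lam%:M.

Local Notation B := pencil_op.
Local Notation G := (metric_pencil (intersection_form F) (cometric F) lam x).

Lemma metric_pencilE p : D p -> G p = B p *m h p.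
Proof.
by move=> xp; rewrite /metric_pencil intersection_formE// mulmxBl mul_scalar_mx.
Qed.

Lemma pencil_unit p : D p -> (G p \in unitmx) = (B p \in unitmx).
Proof.
by move=> xp; rewrite metric_pencilE// unitmx_mul (fcometric_unit F ax xp) andbT.
Qed.

Lemma metric_pencil_sym p : D p -> (G p)^T = G p.
Proof.
move=> xp; rewrite metric_pencilE// trmx_mul trmxD trmxN tr_scalar_mx.
rewrite (fcometric_sym F ax xp) mulmxDr mulmxN mul_mx_scalar mulmxBl mul_scalar_mx.
by rewrite mult_cometric.
Qed.

Lemma smooth_pencil_op : smoothmx x D B.
Proof.
apply: (smoothmxD oD DD (smooth_euler_mult F ax)); exact: smoothmx_cst.
Qed.

Lemma smooth_metric_pencil : smoothmx x D G.
Proof.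
apply: (smoothmx_eq oD DD) (smoothmxM oD DD smooth_pencil_op (smooth_fcometric F ax)).
by move=> q /set_mem xq; rewrite metric_pencilE.
Qed.

Lemma dpencil_op p i : D p -> dd i B p =
  C i p + (W p *m C i p - C i p *m W p) - (Gam i p *m B p - B p *m Gam i p).
Proof.
move=> xp.
have dA := smooth_pderivmx (smooth_euler_mult F ax) xp.
have dl := smooth_pderivmx (smoothmx_cst x D (- lam%:M : 'M[K]_n)) xp.
rewrite [LHS](dmxD i dA dl) dmx_cst addr0 (deuler_mult F ax xp) /pencil_op.
congr (_ - _); rewrite mulmxBr mulmxBl mul_mx_scalar mul_scalar_mx.
by rewrite opprB addrA subrK.
Qed.

Lemma dmetric_pencil p i : D p -> dd i G p =
  C i p *m h p + W p *m C i p *m h p - C i p *m W p *m h p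
  - (Gam i p *m G p + G p *m (Gam i p)^T).
Proof.
move=> xp.
have dB := smooth_pderivmx smooth_pencil_op xp.
have dh := smooth_pderivmx (smooth_fcometric F ax) xp.
have -> : dd i G p = dd i (fun q => B q *m h q) p.
  by apply: (dmx_eq i oD DD xp) => q /set_mem xq; rewrite metric_pencilE.
rewrite (dmxM i xp dB dh) dpencil_op// (dcometric F ax xp) metric_pencilE//.
move: (Gam i p) (C i p) (h p) (B p) (W p) => Gi Ci hp Bp Wp; mxdist; mxabel.
Qed.

Definition nondegenerate_locus := [set q | D q /\ G q \in unitmx].
Local Notation V := nondegenerate_locus.

Lemma nondegenerate_open : open V.
Proof.
have -> : V = D `&` [set q | D q /\ \det (G q) != 0].
  by apply/seteqP; split=> q; rewrite /nondegenerate_locus /= unitmxE unitfE => -[].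
rewrite openE => q [_ [xq Gq]].
have cd : {for q, continuous (fun q => \det (G q))}.
  exact: smooth_continuous (smooth_det oD DD smooth_metric_pencil) xq.
apply: filterI; first exact: open_nbhs_nbhs.
have nz : \forall q' \near q, \det (G q') != 0.
  exact: cvgr_neq0 cd Gq.
by apply: filterS (filterI (open_nbhs_nbhs (conj oD xq)) nz).
Qed.

Lemma nondegenerate_sub : V `<=` chart_dom x.
Proof. by move=> q []. Qed.

Definition resolvent p : 'M[K]_n := invmx (B p).
Local Notation R := resolvent.

(** The Levi-Civita connection of the inverse of the pencil. *)
Definition gamma_pencil i p : 'M[K]_n := Gam i p - W p *m C i p *m R p.

Lemma pencil_op_comm p : D p -> forall i, C i p *m B p = B p *m C i p.
Proof.
move=> xp i; rewrite mulmxBr mulmxBl mul_mx_scalar mul_scalar_mx; congr (_ - _).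
by rewrite -(contr_multE F x p i) (mult_comm F ax xp).
Qed.

Lemma resolvent_comm p : V p -> forall i, C i p *m R p = R p *m C i p.
Proof.
move=> [xp]; rewrite pencil_unit// => uB i.
rewrite -[RHS](mulmxK uB) -(mulmxA _ _ (B p)) (pencil_op_comm xp) mulmxA.
by rewrite mulVmx// mul1mx.
Qed.

Lemma fmult_comm p : D p -> forall i j, C i p *m C j p = C j p *m C i p.
Proof.
by move=> xp i j; rewrite -(contr_multE F x p i) -(contr_multE F x p j) (mult_comm F ax xp).
Qed.

Lemma gamma_pencil_sym p : V p -> forall i j k,
  gamma_pencil i p k j = gamma_pencil j p k i.
Proof.
move=> Vp i j k; have xp := Vp.1; rewrite !addmx_entry !oppmx_entry.
rewrite (gamma_sym F ax xp); congr (_ - _).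
rewrite -!mulmxA !resolvent_comm// !mulmxA [LHS]mxE [RHS]mxE; apply: eq_bigr => m _.
by rewrite (mult_sym F ax xp).
Qed.

(** Multiplying the connection by the pencil cancels the resolvent; all that
    follows about smoothness rests on this. *)
Lemma gamma_pencil_metric p : V p -> forall i,
  gamma_pencil i p *m G p = Gam i p *m G p - W p *m C i p *m h p.
Proof.
move=> [xp uG] i; rewrite mulmxBl metric_pencilE//; congr (_ - _).
rewrite -[W p *m C i p *m R p *m _]mulmxA (mulmxA (R p)) mulVmx ?mul1mx//.
by rewrite -pencil_unit.
Qed.

Lemma metric_gamma_pencil p : V p -> forall i,
  G p *m (gamma_pencil i p)^T = G p *m (Gam i p)^T - C i p *m h p *m (W p)^T.
Proof.
move=> Vp i; have xp := Vp.1.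
rewrite -{1}(metric_pencil_sym xp) -trmx_mul gamma_pencil_metric//.
rewrite trmxD trmxN !trmx_mul (metric_pencil_sym xp) (fcometric_sym F ax xp).
by rewrite mulmxA fmult_cometric.
Qed.

(** Compatibility with the inverse of the pencil is compatibility with the
    pencil, [d G = - (G gamma^T + gamma G)], which comes down to [W + W^* =
    1]. *)
Lemma inverse_pencil_christoffel p : V p -> forall i,
  christoffel_mx x (fun q => invmx (G q)) i p = gamma_pencil i p.
Proof.
move=> Vp; have [xp uG] := Vp.
apply: christoffel_mx_unique.
- by rewrite unitmx_inv.
- by rewrite trmx_inv metric_pencil_sym.
- move=> i.
  have uV q : V q -> G q \in unitmx by case.
  have sV : smoothmx x V G by move=> r s; exact: smooth_sub nondegenerate_sub (smooth_metric_pencil r s).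
  rewrite [LHS](dmxV nondegenerate_open nondegenerate_sub i uV sV Vp).
  have -> : dd i G p = - (G p *m (gamma_pencil i p)^T + gamma_pencil i p *m G p).
    rewrite dmetric_pencil// metric_gamma_pencil// gamma_pencil_metric//.
    have hW : C i p *m h p *m (W p)^T = C i p *m h p - C i p *m W p *m h p.
      have := congr1 (mulmx (C i p)) (spectral_adjoint F ax xp).
      by rewrite mulmxDr !mulmxA => /(canRL (addrK _)).
    rewrite hW; move: (Gam i p *m G p) (G p *m (Gam i p)^T) (W p *m C i p *m h p).
    move: (C i p *m W p *m h p) (C i p *m h p) => X1 X2 X3 X4 X5; mxabel.
  rewrite mulmxN mulNmx opprK mulmxDr mulmxDl; congr (_ + _).
    by rewrite !mulmxA mulVmx// mul1mx.
  by rewrite -!mulmxA mulmxV// mulmx1.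
- exact: gamma_pencil_sym.
Qed.

Lemma dgamma_pencil p i j : V p -> dd i (gamma_pencil j) p =
  dd i (Gam j) p - ((W p *m Gam i p - Gam i p *m W p) *m C j p *m R p
    + W p *m dd i (C j) p *m R p
    + W p *m C j p *m - (R p *m (C i p + (W p *m C i p - C i p *m W p)
         - (Gam i p *m B p - B p *m Gam i p)) *m R p)).
Proof.
move=> Vp; have [xp uG] := Vp.
have uB q : V q -> B q \in unitmx by case=> xq; rewrite pencil_unit.
have sV a b (H : M -> 'M[K]_(a, b)) : smoothmx x D H -> smoothmx x V H.
  by move=> sH r s; exact: smooth_sub nondegenerate_sub (sH r s).
have oV := nondegenerate_open; have Vx := nondegenerate_sub.
have sB := sV _ _ _ smooth_pencil_op.
have sR := smoothmxV oV Vx uB sB.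
have sW := sV _ _ _ (smooth_spectral F ax); have sC := sV _ _ _ (smooth_fmult F ax j).
have sWC := smoothmxM oV Vx sW sC; have sY := smoothmxM oV Vx sWC sR.
have dW := smooth_pderivmx sW Vp; have dC := smooth_pderivmx sC Vp.
have dR := smooth_pderivmx sR Vp; have dWC := smooth_pderivmx sWC Vp.
have dY := smooth_pderivmx sY Vp.
have dG := smooth_pderivmx (smooth_fgamma F ax j) xp.
have dNY := smooth_pderivmx (smoothmxN oV Vx sY) Vp.
rewrite [LHS](dmxD i dG dNY) (dmxN i dY) (dmxM i xp dWC dR) (dmxM i xp dW dC).
rewrite (dmxV oV Vx i uB sB Vp) (spectral_parallel F ax xp) dpencil_op//.
by rewrite mulmxDl.
Qed.

Lemma gamma_pencil_flat p i j : V p ->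
  dd i (gamma_pencil j) p - dd j (gamma_pencil i) p +
  (gamma_pencil i p *m gamma_pencil j p - gamma_pencil j p *m gamma_pencil i p) = 0.
Proof.
move=> Vp; have [xp uG] := Vp; have uB : B p \in unitmx by rewrite -pencil_unit.
have alg := (pencil_flat_algebra (W p) (mulVmx uB) (mulmxV uB) (fmult_comm xp i j)
  (resolvent_comm Vp i) (resolvent_comm Vp j) (metric_flatE F ax xp i j)
  (fmult_codazzi F ax xp i j)).
cbv zeta in alg; refine (etrans _ alg).
congr (_ - _ + _); exact: dgamma_pencil.
Qed.

Lemma inverse_pencil_flat p k l i j : V p ->
  riemann x (fun q => invmx (G q)) k l i j p = 0.
Proof.
move=> Vp.
have cE a k' m q : V q -> christoffel x (fun q => invmx (G q)) k' a m q = gamma_pencil a q k' m.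
  by move=> Vq; rewrite -inverse_pencil_christoffel// mxE.
have dE a b : pd x a (christoffel x (fun q => invmx (G q)) k b l) p = dd a (gamma_pencil b) p k l.
  rewrite dmx_entry; apply: (pd_eq a nondegenerate_open nondegenerate_sub Vp) => q /set_mem Vq.
  exact: cE.
have := congr1 (fun X : 'M[K]_n => X k l) (gamma_pencil_flat i j Vp).
rewrite [X in _ = X]mxE => <-; rewrite /riemann !(addmx_entry, oppmx_entry).
congr (_ - _ + _); [exact: dE | exact: dE|].
rewrite [(_ *m _) k l]mxE [(gamma_pencil j p *m _) k l]mxE -sumrB; apply: eq_bigr => m _.
by rewrite !cE.
Qed.

(** The left hand side makes sense, and is smooth, where the pencil
    degenerates. *)
Lemma pencil_contravariant_gamma p : V p -> forall k i j,
  (C k p *m h p *m (W p)^T - G p *m (Gam k p)^T) i j =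
  - \sum_s G p i s * christoffel x (fun q => invmx (G q)) j s k p.
Proof.
move=> Vp k i j; have xp := Vp.1.
have -> : C k p *m h p *m (W p)^T - G p *m (Gam k p)^T = - (G p *m (gamma_pencil k p)^T).
  by rewrite metric_gamma_pencil// opprB.
rewrite oppmx_entry [(_ *m _) i j]mxE; congr (- _); apply: eq_bigr => s _.
rewrite [_^T _ _]mxE (gamma_pencil_sym Vp) -inverse_pencil_christoffel//.
by congr (_ * _); rewrite [LHS]mxE.
Qed.

End PencilGeometry.

(** * Nondegeneracy of the pencil on a dense set *)

(** Stated for any pair of a product [P] and its derivative [D], to serve both
    polynomials and functions on the manifold. *)
Lemma leibniz_prod (S : comPzRingType) (I : eqType) (a d : I -> S) (P D : seq I -> S) :
  P [::] = 1 -> D [::] = 0 ->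
  (forall i r, P (i :: r) = a i * P r) ->
  (forall i r, D (i :: r) = d i * P r + a i * D r) ->
  forall r, uniq r ->
    D r = \sum_(i <- r) d i * \prod_(j <- r | j != i) a j.
Proof.
move=> P0 D0 PS DS.
have PE r : P r = \prod_(j <- r) a j.
  by elim: r => [|i r ih]; rewrite ?big_nil// PS big_cons ih.
elim=> [_|i r ih /= /andP[ir ur]]; first by rewrite D0 big_nil.
rewrite DS ih// big_cons; congr (_ * _ + _).
  rewrite PE big_cons eqxx/= [LHS]big_seq [RHS]big_seq_cond; apply: eq_bigl => j.
  by case: (boolP (j \in r)) => //= jr; apply/esym; apply: contraNneq ir => <-.
rewrite big_distrr/= [LHS]big_seq [RHS]big_seq; apply: eq_bigr => j jr.
have ij : i != j by apply: contraNneq ir => ->.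
by rewrite big_cons ij mulrCA.
Qed.

(** Group the permutations by the value at the differentiated row; each group
    is a cofactor. *)
Lemma jacobi_formula (S : comPzRingType) n (a d : 'M[S]_n) :
  \sum_(s : 'S_n) (-1) ^+ s * (\sum_i d i (s i) * \prod_(j | j != i) a j (s j)) =
  \tr (d *m \adj a).
Proof.
have -> : \tr (d *m \adj a) = \sum_i \sum_j d i j * cofactor a i j.
  apply: eq_bigr => i _; rewrite mxE; apply: eq_bigr => j _; by rewrite mxE.
under eq_bigr do rewrite big_distrr/=.
rewrite exchange_big; apply: eq_bigr => i _ /=.
rewrite (partition_big (fun s : 'S_n => s i) xpredT)//=; apply: eq_bigr => j _.
rewrite expand_cofactor big_distrr/=; apply: eq_bigr => s /eqP <-.
rewrite mulrCA; congr (_ * (_ * _)); by apply: eq_bigl => k; rewrite eq_sym.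
Qed.

Lemma deriv_det (K : fieldType) n (M : 'M[{poly K}]_n) :
  (\det M)^`() = \tr (map_mx (@deriv K) M *m \adj M).
Proof.
rewrite -jacobi_formula /determinant raddf_sum; apply: eq_bigr => s _ /=.
have -> (Q : {poly K}) : ((-1) ^+ s * Q)^`() = (-1) ^+ s * Q^`().
  by case: (s : bool); rewrite ?expr1 ?expr0 ?mulN1r ?mul1r ?derivN.
congr (_ * _).
rewrite (leibniz_prod (a := fun i => M i (s i)) (d := fun i => (M i (s i))^`())
  (P := fun r => \prod_(i <- r) M i (s i))
  (D := fun r => (\prod_(i <- r) M i (s i))^`()) _ _ _ _ (index_enum_uniq _)).
- by apply: eq_bigr => i _; rewrite mxE.
- by rewrite big_nil.
- by rewrite big_nil -[1]/(1%:P) derivC.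
- by move=> i r; rewrite big_cons.
- by move=> i r; rewrite big_cons derivM.
Qed.

Section DetDerivative.
Context {K : numFieldType} {n : nat} {T : topologicalType} (x : chart K n T).

Lemma pderivable_cst (c : K) p : pderivable x (fun=> c) p.
Proof. by move=> i; exact: derivable_cst. Qed.

Lemma pderivable_prod (I : Type) (f : I -> T -> K) (r : seq I) p :
  (forall i, pderivable x (f i) p) ->
  pderivable x (fun q => \prod_(i <- r) f i q) p.
Proof.
move=> df; elim: r => [|i r ih].
  under eq_fun do rewrite big_nil.
  exact: pderivable_cst.
under eq_fun do rewrite big_cons.
exact: pderivableM.
Qed.

Lemma pd_det i a (F : T -> 'M[K]_a) p : chart_dom x p -> pderivmx x F p ->
  pd x i (fun q => \det (F q)) p = \tr (dmx x i F p *m \adj (F p)).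
Proof.
move=> xp dF; rewrite -jacobi_formula.
have dP (s : {perm 'I_a}) r : pderivable x (fun q => \prod_(j <- r) F q j (s j)) p.
  by apply: pderivable_prod => j; exact: dF.
rewrite [LHS]pd_sum => [|s]; last first.
  by apply: pderivableM; [exact: pderivable_cst | exact: dP].
apply: eq_bigr => s _; rewrite (pdM i xp (@pderivable_cst _ p) (dP s _)) pd_cst mul0r addr0; congr (_ * _).
rewrite (leibniz_prod (a := fun j => F p j (s j)) (d := fun j => dmx x i F p j (s j))
  (P := fun r => \prod_(j <- r) F p j (s j))
  (D := fun r => pd x i (fun q => \prod_(j <- r) F q j (s j)) p)
  _ _ _ _ (index_enum_uniq _)) //.
- by rewrite big_nil.
- under eq_fun do rewrite big_nil.
  exact: pd_cst.
- by move=> j r; rewrite big_cons.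
- move=> j r; under eq_fun do rewrite big_cons.
  by rewrite (pdM i xp (dF j (s j)) (dP s r)) dmx_entry addrC.
Qed.

End DetDerivative.

(** Derivatives at [lam] of polynomials of bounded degree are fixed linear
    combinations of values. Thus a differentiation rule for the values of a
    family of polynomials extends to their derivatives. *)
Lemma derivn_lagrange (K : numFieldType) (N k : nat) (P : {poly K}) (lam : K) :
  (size P <= N.+1)%N ->
  (P^`(k)).[lam] = \sum_(i < N.+1) P.[i%:R] *
     ((tnth (N.+1.-lagrange (fun j : nat => j%:R : K)) i : {poly K})^`(k)).[lam].
Proof.
move=> sP.
have inj : injective (fun j : nat => j%:R : K) by move=> u v /eqP; rewrite eqr_nat => /eqP.
rewrite {1}(lagrange_gen (ltn0Sn N) inj sP).
rewrite linear_sum horner_sum; apply: eq_bigr => i _.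
by rewrite mul_polyC /= derivnZ hornerZ.
Qed.

Lemma horner_char_poly (K : fieldType) n (A : 'M[K]_n) mu :
  (char_poly A).[mu] = \det (mu%:M - A).
Proof.
rewrite -horner_evalE -det_map_mx; congr (\det _); apply/matrixP => i j.
by rewrite !mxE raddfB raddfMn /= !horner_evalE hornerX hornerC.
Qed.

(** Jacobi formula for the matrix [X - A], whose entrywise derivative is the
    identity. *)
Lemma horner_deriv_char_poly (K : fieldType) n (A : 'M[K]_n) mu :
  ((char_poly A)^`()).[mu] = \tr (\adj (mu%:M - A)).
Proof.
have -> : (char_poly A)^`() = \tr (\adj (char_poly_mx A)).
  rewrite /char_poly deriv_det (_ : map_mx _ _ = 1%:M) ?mul1mx//.
  apply/matrixP => i j; rewrite !mxE derivB derivC subr0 derivMn derivX.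
  by [].
rewrite -horner_evalE raddf_sum; apply: eq_bigr => i _ /=.
rewrite !mxE -cofactor_map_mx; congr (cofactor _ _ _); apply/matrixP => k l.
by rewrite !mxE raddfB raddfMn /= !horner_evalE hornerX hornerC.
Qed.

Local Opaque dmx pd.

Section Density.
Context {K : numFieldType} {n : nat} {M : manifold K n} {d : K}.
Variable F : frobenius_manifold M d.
Variable x : chart K n M.
Hypothesis ax : atlas M x.
Local Notation D := (chart_dom x).
Local Notation e := (fm_unit F x).
Local Notation C := (fmult F x).
Local Notation Gam := (fgamma F x).
Local Notation W := (spectral F x).
Local Notation A := (euler_mult F x).
Local Notation dd i := (dmx x i).
Let oD : open D. Proof. exact: dom_open. Qed.
Let DD : D `<=` chart_dom x. Proof. exact: subset_refl. Qed.

Definition unit_deriv (f : M -> K) p := \sum_s e p s 0 * pd x s f p.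

(** Contract [deuler_mult] with the unity: [e^s C_s] is the identity, whose
    commutator with [W] is zero. *)
Lemma unit_lie_euler_mult p : D p -> contr (fun s => dd s A p) (e p) =
  1%:M - (contr (Gam ^~ p) (e p) *m A p - A p *m contr (Gam ^~ p) (e p)).
Proof.
move=> xp; rewrite (eq_contr _ (deuler_mult F ax xp)) !contrDl !contrNl !contrDl !contrNl.
have eC : contr (C ^~ p) (e p) = 1%:M := mult_unit F ax xp.
have WC : contr (fun s => W p *m C s p) (e p) = W p by rewrite -[RHS]mulmx1 -eC contr_mull.
have CW : contr (fun s => C s p *m W p) (e p) = W p by rewrite -[RHS]mul1mx -eC contr_mulr.
have GA : contr (fun s => Gam s p *m A p) (e p) = contr (Gam ^~ p) (e p) *m A p.
  by rewrite contr_mulr.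
have AG : contr (fun s => A p *m Gam s p) (e p) = A p *m contr (Gam ^~ p) (e p).
  by rewrite contr_mull.
by rewrite WC CW GA AG [contr _ _]eC subrr addr0.
Qed.

(** By the Jacobi formula only the trace of the adjugate times the derivative
    of [A] along [e] matters. That derivative is the identity up to a
    commutator with [A], and such a commutator has zero trace against the
    adjugate. *)
Lemma unit_deriv_char_poly p mu : D p ->
  unit_deriv (fun q => (char_poly (A q)).[mu]) p = - ((char_poly (A p))^`()).[mu].
Proof.
move=> xp; pose N q := mu%:M - A q.
have sN : smoothmx x D N.
  apply: (smoothmxD oD DD (smoothmx_cst x D mu%:M)).
  exact: (smoothmxN oD DD (smooth_euler_mult F ax)).
have dN := smooth_pderivmx sN xp.
have dA := smooth_pderivmx (smooth_euler_mult F ax) xp.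
have dNA := smooth_pderivmx (smoothmxN oD DD (smooth_euler_mult F ax)) xp.
have dc := smooth_pderivmx (smoothmx_cst x D (mu%:M : 'M[K]_n)) xp.
have -> : (fun q => (char_poly (A q)).[mu]) = (fun q => \det (N q)).
  by apply/funext => q; exact: horner_char_poly.
have eN : contr (fun s => dd s N p) (e p) =
    - (1%:M - (N p *m contr (Gam ^~ p) (e p) - contr (Gam ^~ p) (e p) *m N p)).
  have -> : contr (fun s => dd s N p) (e p) = - contr (fun s => dd s A p) (e p).
    rewrite -contrNl; apply: eq_contr => s.
    by rewrite [LHS](dmxD s dc dNA) dmx_cst add0r (dmxN s dA).
  rewrite unit_lie_euler_mult// /N; move: (contr _ (e p)) (A p) => G A'.
  rewrite mulmxBl mulmxBr mul_scalar_mx mul_mx_scalar.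
  by move: (mu *: G) (A' *m G) (G *m A') => X Y Z; mxabel.
have -> : unit_deriv (fun q => \det (N q)) p =
    \tr (contr (fun s => dd s N p) (e p) *m \adj (N p)).
  rewrite contr_mulr /contr raddf_sum; apply: eq_bigr => s _ /=.
  by rewrite mxtraceZ (pd_det s xp dN).
rewrite eN horner_deriv_char_poly -/(N p) mulNmx raddfN /=; congr (- _).
rewrite mulmxBl mul1mx mulmxBl raddfB raddfB /= -mulmxA mxtrace_mulC -mulmxA.
by rewrite mul_adj_mx -mulmxA mul_mx_adj subrr subr0.
Qed.

Lemma unit_deriv_char_polyn p k lam : D p ->
  unit_deriv (fun q => ((char_poly (A q))^`(k)).[lam]) p =
  - ((char_poly (A p))^`(k.+1)).[lam].
Proof.
move=> xp; have sz (q : M) : (size (char_poly (A q)) <= n.+1)%N by rewrite size_char_poly.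
have sz' : (size ((char_poly (A p))^`()) <= n.+1)%N.
  by apply: leq_trans (size_poly _ _) _; rewrite size_char_poly.
have dchi mu : pderivable x (fun q => (char_poly (A q)).[mu]) p.
  have -> : (fun q => (char_poly (A q)).[mu]) = (fun q => \det (mu%:M - A q)).
    by apply/funext => q; exact: horner_char_poly.
  apply: (smooth_pderivable (U := D)) => //; apply: (smooth_det oD DD).
  apply: (smoothmxD oD DD); first exact: smoothmx_cst.
  exact: (smoothmxN oD DD (smooth_euler_mult F ax)).
rewrite derivSn (derivn_lagrange k lam sz').
have -> : (fun q => ((char_poly (A q))^`(k)).[lam]) = (fun q => _) :=
  funext (fun q => derivn_lagrange k lam (sz q)).
rewrite /unit_deriv.
under eq_bigr => s _.
  rewrite pd_sum => [|j]; last by apply: pderivableM => //; exact: pderivable_cst.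
  rewrite big_distrr/=.
  under eq_bigr => j _ do rewrite (pdM s xp (dchi _) (@pderivable_cst _ _ _ _ _ p)) pd_cst mulr0 add0r mulrA.
  over.
rewrite exchange_big/= -sumrN; apply: eq_bigr => j _.
by rewrite -mulr_suml [X in X * _](unit_deriv_char_poly _ xp) mulNr.
Qed.

(** Otherwise [chi(lam) = 0] on an open set. Differentiating along [e]
    repeatedly, all derivatives of [chi] vanish at [lam]; but the derivative
    of order [n] of a monic polynomial of degree [n] is the constant [n!]. *)
Lemma nondegenerate_dense lam (O : set M) : open O -> O `&` D !=set0 ->
  O `&` nondegenerate_locus F x lam !=set0.
Proof.
move=> oO [p0 [Op0 xp0]]; apply: contrapT => none.
have oOD : open (O `&` D) by exact: openI.
have ODx : O `&` D `<=` chart_dom x by move=> q [].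
have vanish k q : (O `&` D) q -> ((char_poly (A q))^`(k)).[lam] = 0.
  elim: k q => [|k ih] q [Oq xq].
    rewrite derivn0 horner_char_poly; apply/eqP; apply: contrapT => nz; apply: none.
    exists q; split=> //; split=> //; rewrite pencil_unit// unitmxE unitfE.
    by rewrite -[pencil_op _ _ _ _]opprB -scaleN1r detZ mulf_neq0 ?expf_neq0 ?oppr_eq0 ?oner_eq0//; apply/negP.
  apply/eqP; rewrite -oppr_eq0 -unit_deriv_char_polyn//; apply/eqP.
  apply: big1 => s _.
  have -> : pd x s (fun q => ((char_poly (A q))^`(k)).[lam]) q = pd x s (fun=> 0) q.
    by apply: (pd_eq s oOD ODx) => // q' /set_mem; exact: ih.
  by rewrite pd_cst mulr0.
have := vanish n p0 (conj Op0 xp0).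
(* The top coefficient of the [n]-th derivative is the only one left. *)
have -> : (char_poly (A p0))^`(n) = (n`!%:R)%:P.
  apply/polyP => i; rewrite coef_derivn coefC.
  have [->|i0] := eqVneq i 0%N.
    rewrite addn0 ffactnn; have := monicP (char_poly_monic (A p0)).
    by rewrite lead_coefE size_char_poly /= => ->.
  by rewrite nth_default ?mul0rn// size_char_poly -addn1 leq_add2l lt0n.
by rewrite hornerC => /eqP; rewrite pnatr_eq0 -leqn0 leqNgt fact_gt0.
Qed.

End Density.

(** * Lie derivatives along the unity and the Euler field *)

Local Opaque dmx pd.

Section Quasihomogeneity.
Context {K : numFieldType} {n : nat} {M : manifold K n} {d : K}.
Variable F : frobenius_manifold M d.
Variable x : chart K n M.
Hypothesis ax : atlas M x.
Local Notation D := (chart_dom x).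
Local Notation eta := (fm_metric F x).
Local Notation h := (cometric F x).
Local Notation g := (intersection_form F x).
Local Notation e := (fm_unit F x).
Local Notation E := (fm_euler F x).
Local Notation C := (fmult F x).
Local Notation Gam := (fgamma F x).
Local Notation P := (vjac x E).
Local Notation U := (grad_euler F x).
Local Notation W := (spectral F x).
Local Notation A := (euler_mult F x).
Local Notation dd i := (dmx x i).
Let oD : open D. Proof. exact: dom_open. Qed.
Let DD : D `<=` chart_dom x. Proof. exact: subset_refl. Qed.
Variable p : M.
Hypothesis xp : D p.

Lemma lie_contra_eq (Y Y' : M -> 'cV[K]_n) (b : M -> 'M[K]_n) :
  {in D, Y =1 Y'} -> lie_contra x Y b p = lie_contra x Y' b p.
Proof.
move=> YY; have pD : p \in D by exact/mem_set.
apply/matrixP => i j; rewrite !mxE; apply: eq_bigr => s _; rewrite YY//.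
by congr (_ - _ * _ - _ * _); apply: (pd_eq s oD DD xp) => q Dq; rewrite YY.
Qed.

Lemma contr_dintersection (Y : 'cV[K]_n) : contr (fun s => dd s g p) Y =
  contr (C ^~ p) Y *m h p + W p *m contr (C ^~ p) Y *m h p
  - contr (C ^~ p) Y *m W p *m h p
  - (contr (Gam ^~ p) Y *m g p + g p *m (contr (Gam ^~ p) Y)^T).
Proof.
have dg s : dd s g p = C s p *m h p + W p *m C s p *m h p - C s p *m W p *m h p
    - (Gam s p *m g p + g p *m (Gam s p)^T).
  have := dmetric_pencil F ax 0 s xp; rewrite metric_pencilE// intersection_formE//.
  rewrite /pencil_op raddf0 subr0 => <-; apply: (dmx_eq s oD DD xp) => q /set_mem xq.
  by rewrite /metric_pencil scale0r subr0.
rewrite (eq_contr _ dg) !contrDl !contrNl !contrDl.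
have c1 : contr (fun s => C s p *m h p) Y = contr (C ^~ p) Y *m h p by rewrite contr_mulr.
have c2 : contr (fun s => W p *m C s p *m h p) Y = W p *m contr (C ^~ p) Y *m h p.
  by rewrite -contr_mulr; congr (_ *m _); rewrite contr_mull.
have c3 : contr (fun s => C s p *m W p *m h p) Y = contr (C ^~ p) Y *m W p *m h p.
  by rewrite -contr_mulr; congr (_ *m _); rewrite contr_mulr.
have c4 : contr (fun s => Gam s p *m g p) Y = contr (Gam ^~ p) Y *m g p by rewrite contr_mulr.
have c5 : contr (fun s => g p *m (Gam s p)^T) Y = g p *m (contr (Gam ^~ p) Y)^T.
  by rewrite contr_tr contr_mull.
by rewrite c1 c2 c3 c4 c5.
Qed.

(** The unity is parallel, so its derivatives are Christoffel symbols. *)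
Lemma vjac_unit : vjac x e p = - contr (Gam ^~ p) (e p).
Proof.
apply: col_ext => j; rewrite vjac_mul (eq_contr _ (dunit F ax xp)) contrNl mulNmx.
congr (- _); rewrite -(contr_sym (gamma_sym F ax xp)).
by rewrite contr_mulr.
Qed.

Lemma lie_bracket_unit_euler : lie_bracket x e E p = e p.
Proof.
rewrite lie_bracketE -vjac_mul vjac_unit mulNmx opprK.
by rewrite (contr_sym (gamma_sym F ax xp)) -mulmxDl (grad_euler_unit F ax xp).
Qed.

Lemma lie_euler_intersection : lie_contra x E g p = (d - 1) *: g p.
Proof.
rewrite lie_contraE contr_dintersection intersection_formE// -/(A p).
have PE : P p = W p - ((d - 1) / 2)%:M - contr (Gam ^~ p) (E p).
  by rewrite /spectral addrK /grad_euler addrK.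
have hW := spectral_adjoint F ax xp.
have AhW : A p *m h p *m (W p)^T = A p *m h p - A p *m W p *m h p.
  by rewrite -[A p *m W p *m _]mulmxA -mulmxBr -{2}hW addrK mulmxA.
rewrite PE trmxD trmxD !trmxN tr_scalar_mx; move: AhW {hW PE}.
move: (W p) (A p) (h p) (contr _ _) => W' A' h' G AhW; mxdist.
rewrite mul_scalar_mx mul_mx_scalar AhW -scalemxAl.
move: (A' *m h') (A' *m W' *m h') (G *m A' *m h') (W' *m A' *m h') (A' *m h' *m _).
move=> Y1 Y2 Y3 Y4 Y5; apply/matrixP => i j.
by rewrite !(addmx_entry, oppmx_entry, scalemx_entry); field.
Qed.

Lemma lie_unit_intersection : lie_contra x e g p = h p.
Proof.
rewrite lie_contraE contr_dintersection vjac_unit (mult_unit F ax xp).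
rewrite mulmx1 !mul1mx addrK mulNmx opprK trmxN mulmxN opprK.
by rewrite -addrA addrNK.
Qed.

Lemma lie_unit_cometric : lie_contra x e h p = 0.
Proof.
rewrite lie_contraE (contr_gamma_cometric F ax xp) vjac_unit mulNmx trmxN mulmxN !opprK.
by rewrite -addrA addNr.
Qed.

(** The 1-form <e, .>, whose potential is the function tau of the
    quasihomogeneity conditions. *)
Definition unit_form q : 'cV[K]_n := eta q *m e q.

Lemma cometric_unit_form q : D q -> h q *m unit_form q = e q.
Proof. by move=> xq; rewrite mulmxA (metricK F ax xq) mul1mx. Qed.

Lemma intersection_unit_form q : D q -> g q *m unit_form q = E q.
Proof.
move=> xq; rewrite intersection_formE// -mulmxA cometric_unit_form//.
exact: euler_mult_unit.
Qed.

Lemma dunit_form i : dd i unit_form p = (Gam i p)^T *m unit_form p.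
Proof.
have deta := smooth_pderivmx (smooth_fmetric F ax) xp.
have de := smooth_pderivmx (smooth_funit F ax) xp.
rewrite [LHS](dmxM i xp deta de) (dmetric F ax xp) (dunit F ax xp).
by rewrite mulmxN mulmxDl !mulmxA addrK.
Qed.

Lemma smooth_unit_form : smoothmx x D unit_form.
Proof. exact: (smoothmxM oD DD (smooth_fmetric F ax) (smooth_funit F ax)). Qed.

(** The unity is parallel, hence so is this form; the antisymmetrized
    derivative vanishes since the connection has no torsion. *)
Lemma unit_form_closed i j :
  pd x i (fun q => unit_form q j 0) p = pd x j (fun q => unit_form q i 0) p.
Proof.
rewrite -!dmx_entry !dunit_form [LHS]mxE [RHS]mxE; apply: eq_bigr => m _.
by rewrite [_^T j m]mxE [_^T i m]mxE (gamma_sym F ax xp).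
Qed.

(** The function <e, E> has differential <e, nabla E>, and [nabla E] acts on
    <e, .> as the adjoint of [2 - d - nabla E], which multiplies [e] by [1 -
    d]. *)
Lemma deriv_unit_form_euler i :
  dd i (fun q => (unit_form q)^T *m E q) p = (1 - d) *: ((unit_form p)^T *m delta_mx i 0).
Proof.
have dE := smooth_pderivmx (smooth_feuler F ax) xp.
have dth := smooth_pderivmx (smoothmxT oD DD smooth_unit_form) xp.
rewrite (dmxM i xp dth dE) dmxT dunit_form trmx_mul trmxK vjac_col -mulmxA -mulmxDr.
have -> : Gam i p *m E p + P p *m delta_mx i 0 = U p *m delta_mx i 0.
  rewrite /grad_euler mulmxDl addrC; congr (_ + _).
  by rewrite -[RHS](contr_sym (gamma_sym F ax xp)) contr_delta.
rewrite mulmxA scalemxAl; congr (_ *m _).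
rewrite trmx_mul (fmetric_sym F ax xp) -mulmxA.
have -> : eta p *m U p = (2 - d) *: eta p - (U p)^T *m eta p.
  by rewrite -(grad_euler_adjoint F ax xp) addrC addKr.
rewrite mulmxBr mulmxA -trmx_mul (grad_euler_unit F ax xp) -scalemxAr.
by rewrite -[X in _ - X]scale1r -scalerBl; congr (_ *: _); ring.
Qed.

End Quasihomogeneity.

(** * The flat pencil and its potential *)

Section Assembly.
Context {K : numFieldType} (X : real_axis K) {n : nat} {M : manifold K n} {d : K}.
Variable F : frobenius_manifold M d.
Implicit Types (x y : chart K n M) (p : M).

Section Overlap.
Variables (x y : chart K n M) (p : M).
Hypotheses (ax : atlas M x) (ay : atlas M y) (xp : chart_dom x p) (yp : chart_dom y p).

Let JK : jac x y p *m jac y x p = 1%:M. Proof. exact: (jacK X ax ay xp yp). Qed.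

Let KJ : jac y x p *m jac x y p = 1%:M. Proof. exact: mulmx1C JK. Qed.

Lemma cometric_change :
  cometric F x p = jac x y p *m cometric F y p *m (jac x y p)^T.
Proof.
have etaE := (metric_tensor F).2 x y p ax ay xp yp.
have h1 : jac x y p *m cometric F y p *m (jac x y p)^T *m fm_metric F x p = 1%:M.
  rewrite etaE !mulmxA -(mulmxA _ _^T _^T) -trmx_mul KJ trmx1 mulmx1.
  by rewrite -(mulmxA _ (cometric F y p)) (metricK F ay yp) mulmx1.
rewrite -[RHS]mulmx1 -(metricVK F ax xp) mulmxA h1 mul1mx.
by [].
Qed.

(** The Jacobian is an algebra homomorphism between the tangent algebras in
    the two charts, and it maps [E] to [E]. *)
Lemma euler_mult_change :
  euler_mult F x p *m jac x y p = jac x y p *m euler_mult F y p.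
Proof.
apply: col_ext => j; rewrite -!mulmxA -!alg_mulE.
rewrite ((euler_tensor F).2 x y p ax ay xp yp).
exact: (prod_tensor F).2.
Qed.

Lemma metric_pencil_change lam :
  metric_pencil (intersection_form F) (cometric F) lam x p =
  jac x y p *m metric_pencil (intersection_form F) (cometric F) lam y p *m (jac x y p)^T.
Proof.
rewrite /metric_pencil !intersection_formE// cometric_change.
rewrite mulmxBr mulmxBl -scalemxAr -scalemxAl !mulmxA euler_mult_change.
by [].
Qed.

Lemma unit_form_change : unit_form F x p = (jac y x p)^T *m unit_form F y p.
Proof.
rewrite /unit_form ((metric_tensor F).2 x y p ax ay xp yp).
rewrite ((unit_tensor F).2 x y p ax ay xp yp) -!mulmxA.
by rewrite (mulmxA (jac y x p)) KJ mul1mx.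
Qed.

Lemma unit_form_euler_change :
  (unit_form F x p)^T *m fm_euler F x p = (unit_form F y p)^T *m fm_euler F y p.
Proof.
rewrite unit_form_change ((euler_tensor F).2 x y p ax ay xp yp) trmx_mul trmxK.
by rewrite -!mulmxA (mulmxA (jac y x p)) KJ mul1mx.
Qed.

Lemma pencil_unit_change lam :
  metric_pencil (intersection_form F) (cometric F) lam x p \in unitmx ->
  metric_pencil (intersection_form F) (cometric F) lam y p \in unitmx.
Proof.
by rewrite metric_pencil_change !unitmx_mul => /andP[/andP[]].
Qed.

End Overlap.

Lemma metric_pencil0 g1 g2 :
  metric_pencil g1 g2 0 = g1 :> (chart K n M -> M -> 'M[K]_n).
Proof. by apply/funext => x; apply/funext => p; rewrite /metric_pencil scale0r subr0. Qed.

(** The open dense set consists of the points where the pencil is invertible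
    in every chart, equivalently in one chart. *)
Lemma contravariant_metric_pencil lam :
  contravariant_metric (metric_pencil (intersection_form F) (cometric F) lam).
Proof.
split.
- split=> [x i j ax|x y p ax ay xp yp]; first exact: smooth_metric_pencil.
  exact: metric_pencil_change.
- by move=> x p ax xp; exact: metric_pencil_sym.
exists [set p | forall x, atlas M x -> chart_dom x p ->
  metric_pencil (intersection_form F) (cometric F) lam x p \in unitmx].
have spread x p : atlas M x -> nondegenerate_locus F x lam p ->
    forall y, atlas M y -> chart_dom y p ->
    metric_pencil (intersection_form F) (cometric F) lam y p \in unitmx.
  by move=> ax [xp uG] y ay yp; exact: pencil_unit_change uG.
split.
- rewrite openE => p Up; have [x ax xp] := atlas_cover p.
  apply: filterS (open_nbhs_nbhs (conj (nondegenerate_open F ax lam) (conj xp (Up x ax xp)))).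
  by move=> q Vq y ay yq; exact: spread Vq y ay yq.
- move=> O [p Op] oO; have [x ax xp] := atlas_cover p.
  have [|q [Oq Vq]] := nondegenerate_dense F ax lam oO; first by exists p.
  by exists q; split=> // y ay yq; exact: spread Vq y ay yq.
- by move=> x p ax xp; apply.
Qed.

Lemma contravariant_metric_cometric : contravariant_metric (cometric F).
Proof.
split.
- split=> [x i j ax|x y p ax ay xp yp]; first exact: smooth_fcometric.
  exact: cometric_change.
- by move=> x p ax xp; exact: fcometric_sym.
exists setT; split; [exact: openT | by move=> O [p Op] _; exists p|].
by move=> x p ax xp _; exact: fcometric_unit.
Qed.

(** The contravariant Christoffel symbols of the intersection form, in a form
    that does not involve its inverse. *)
Definition gamma_intersection x (k i j : 'I_n) p : K :=
  (fmult F x k p *m cometric F x p *m (spectral F x p)^T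
   - intersection_form F x p *m (fgamma F x k p)^T) i j.

Definition gamma_cometric x (k i j : 'I_n) p : K :=
  (- (cometric F x p *m (fgamma F x k p)^T)) i j.

Lemma gamma_pencilE lam x k i j p :
  gamma_intersection x k i j p - lam * gamma_cometric x k i j p =
  (fmult F x k p *m cometric F x p *m (spectral F x p)^T
   - metric_pencil (intersection_form F) (cometric F) lam x p *m (fgamma F x k p)^T) i j.
Proof.
rewrite /gamma_intersection /gamma_cometric /metric_pencil mulmxBl -scalemxAl.
rewrite !(addmx_entry, oppmx_entry, scalemx_entry); ring.
Qed.

Lemma levi_civita_cometric :
  contravariant_levi_civita (cometric F) gamma_cometric.
Proof.
split=> [x k i j ax|x p k i j ax xp _].
  have oD := @dom_open _ _ _ x; have DD := @subset_refl _ (chart_dom x).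
  apply: (smoothmxN oD DD); apply: (smoothmxM oD DD); first exact: smooth_fcometric.
  by apply: (smoothmxT oD DD); exact: smooth_fgamma.
have -> : inverse_metric (cometric F) x = fm_metric F x.
  by apply/funext => q; exact: invmxK.
rewrite /gamma_cometric oppmx_entry mxE; congr (- _); apply: eq_bigr => s _.
by rewrite [_^T _ _]mxE (gamma_sym F ax xp) fgamma_entry.
Qed.

Lemma levi_civita_pencil lam :
  contravariant_levi_civita (metric_pencil (intersection_form F) (cometric F) lam)
    (fun x k i j p => gamma_intersection x k i j p - lam * gamma_cometric x k i j p).
Proof.
split=> [x k i j ax|x p k i j ax xp uG].
  have oD := @dom_open _ _ _ x; have DD := @subset_refl _ (chart_dom x).
  apply: (smooth_eq oD DD) => [q _|]; first by rewrite gamma_pencilE.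
  apply: (smoothmxD oD DD).
    apply: (smoothmxM oD DD); last by apply: (smoothmxT oD DD); exact: smooth_spectral.
    by apply: (smoothmxM oD DD); [exact: smooth_fmult|exact: smooth_fcometric].
  apply: (smoothmxN oD DD); apply: (smoothmxM oD DD); first exact: smooth_metric_pencil.
  by apply: (smoothmxT oD DD); exact: smooth_fgamma.
rewrite gamma_pencilE; exact: (pencil_contravariant_gamma ax (conj xp uG)).
Qed.

Lemma frobenius_flat_pencil : flat_pencil (intersection_form F) (cometric F).
Proof.
split.
- split; last exact: contravariant_metric_cometric.
  by rewrite -(metric_pencil0 (intersection_form F) (cometric F)); exact: contravariant_metric_pencil.
- exact: contravariant_metric_pencil.
- exists gamma_intersection, gamma_cometric; split.
  + have := levi_civita_pencil 0; rewrite metric_pencil0.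
    congr (contravariant_levi_civita _ _).
    apply/funext => x; apply/funext => k; apply/funext => i; apply/funext => j.
    by apply/funext => p; rewrite mul0r subr0.
  + exact: levi_civita_cometric.
  + exact: levi_civita_pencil.
- by move=> lam x p k l i j ax xp uG; exact: (inverse_pencil_flat ax k l i j (conj xp uG)).
Qed.

(** The conditions involve the derivatives of the fields obtained from
    [theta], so equality on the whole domain of the chart is used. *)
Lemma quasihomogeneity_unit_form theta :
  (forall x p, atlas M x -> chart_dom x p -> theta x p = unit_form F x p) ->
  quasihomogeneity (intersection_form F) (cometric F) d theta.
Proof.
move=> thE x p ax xp /=.
have EE : {in chart_dom x, (fun q => intersection_form F x q *m theta x q) =1 fm_euler F x}.
  by move=> q /set_mem xq; rewrite thE// intersection_unit_form.
have eE : {in chart_dom x, (fun q => cometric F x q *m theta x q) =1 fm_unit F x}.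
  by move=> q /set_mem xq; rewrite thE// (cometric_unit_form F ax).
rewrite (lie_bracket_eq xp eE EE) !(lie_contra_eq xp _ EE) !(lie_contra_eq xp _ eE).
rewrite (lie_bracket_unit_euler F ax xp) eE; last exact/mem_set.
split=> //.
- exact: lie_euler_intersection.
- exact: lie_unit_intersection.
- exact: lie_unit_cometric.
Qed.

Lemma closed_unit_form : closed_1form (unit_form F).
Proof.
split; last by move=> x p i j ax xp; exact: unit_form_closed.
split=> [x i ax|x y p ax ay xp yp]; first exact: smooth_unit_form.
exact: unit_form_change.
Qed.

(** The function is defined by choosing a chart at each point; <e, E> does not
    depend on the choice. *)
Lemma unit_form_potential : d <> 1 ->
  exists tau, potential_on setT (unit_form F) tau.
Proof.
move=> d1; have d10 : 1 - d != 0 by rewrite subr_eq0 eq_sym; apply/eqP.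
pose f x p := (1 - d)^-1 * ((unit_form F x p)^T *m fm_euler F x p) 0 0.
have [tau tauE] : exists tau : M -> K, forall x p, atlas M x -> chart_dom x p -> tau p = f x p.
  have /choice[c cP] : forall p, exists x, atlas M x /\ chart_dom x p.
    by move=> p; have [x ax xp] := atlas_cover p; exists x.
  exists (fun p => f (c p) p) => x p ax xp; have [ac pc] := cP p.
  by rewrite /f (unit_form_euler_change ac ax pc xp).
have sf x : atlas M x -> smooth_in x (chart_dom x) (f x).
  move=> ax; have oD := @dom_open _ _ _ x; have DD := @subset_refl _ (chart_dom x).
  apply: (smoothM oD DD); first exact: smooth_cst.
  apply: (smoothmxM oD DD); last exact: smooth_feuler.
  by apply: (smoothmxT oD DD); exact: smooth_unit_form.
exists tau; split=> [x ax|x p ax xp _].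
  rewrite setTI; apply: (smooth_eq (@dom_open _ _ _ x) (@subset_refl _ _)) (sf x ax).
  by move=> q /set_mem xq; rewrite (tauE x).
have oD := @dom_open _ _ _ x; have DD := @subset_refl _ (chart_dom x).
apply/colP => i; rewrite [RHS]mxE.
rewrite (pd_eq i oD DD xp (g := f x)); last by move=> q /set_mem xq; exact: (tauE x).
have smx : smoothmx x (chart_dom x) (fun q => (unit_form F x q)^T *m fm_euler F x q).
  apply: (smoothmxM oD DD); last exact: smooth_feuler.
  by apply: (smoothmxT oD DD); exact: smooth_unit_form.
rewrite pdM//; last 2 first.
- exact: smooth_pderivable (smooth_cst _ _ _) xp.
- exact: smooth_pderivable (smx 0 0) xp.
rewrite pd_cst mul0r addr0 -dmx_entry deriv_unit_form_euler// scalemx_entry.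
by rewrite mulrA mulVf// mul1r -colE !mxE.
Qed.

End Assembly.

Theorem theorem1p1 (K : numFieldType) (hK : real_or_complex K) (n : nat)
    (M : manifold K n) (d : K) (F : frobenius_manifold M d) :
  [/\ flat_pencil (intersection_form F) (cometric F),
      quasihomogeneous_multivalued (intersection_form F) (cometric F) d
    & d <> 1 \/ closed_1forms_exact M ->
      quasihomogeneous (intersection_form F) (cometric F) d].
Proof.
have [X] := real_axis_exists hK.
split.
- exact: (frobenius_flat_pencil X F).
- exists (unit_form F); split; last exact: quasihomogeneity_unit_form.
  exact: (closed_1form_locally_exact X (closed_unit_form X F)).
- move=> H; have [tau [stau tauE]] : exists tau, potential_on setT (unit_form F) tau.
    case: H => [d1|ex]; first exact: (unit_form_potential X F d1).
    exact: (ex _ (closed_unit_form X F)).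
  exists tau; split=> //; apply: quasihomogeneity_unit_form => x p ax xp.
  by rewrite -tauE.
Qed.
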